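(* Let $0<p<a<1$, let $\beta\in(\beta_1^{cr},\beta_2^{cr})$, where $\beta_1^{cr}=\beta_*\sqrt{p/a}$ and $\beta_2^{cr}=\beta_*\sqrt{(1-p)/(1-a)}$, and suppose also that $\beta<2\frac{\sqrt{ap}}{1-a}\beta_*$. Let $\alpha_1=\beta_1^{cr}/\beta$, let $\gamma_1$ be the corresponding random environment, and let $\tilde X_1\sim\mathcal K(\hat{\mathfrak f},1)$ started at $\infty$, with $\hat{\mathfrak f}(x_1)=\frac1p\gamma_1(x_1)$, $x_1\in\mathbb N$. For $t_w,t>0$ let $\tilde\Pi_1(t_w,t_w+t)$ be the probability (given the environment) that $\tilde X_1$ gives no jump within $(t_w,t_w+t)$. Then for every $\theta>0$, for almost every realization of the environment, $$\lim_{\substack{t_w,t\to0\\ t/t_w\to\theta}}\tilde\Pi_1(t_w,t_w+t)=\mathrm{Asl}_{\alpha_1}\Big(\frac1{1+\theta}\Big).$$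
   Context: $\beta_*=\sqrt{2\ln 2}$. For $\alpha,u\in(0,1)$, $\mathrm{Asl}_\alpha(u)=\frac{\sin\pi\alpha}{\pi}\int_0^ux^{-(1-\alpha)}(1-x)^{-\alpha}dx$. $\{\gamma_1(x_1),x_1\in\mathbb N\}$ is a Poisson point process on $(0,\infty)$, enumerated in decreasing order, with intensity $\alpha_1x^{-1-\alpha_1}dx$ (here $0<\alpha_1<1$). Uniform K-process $\mathcal K(\mathfrak f,1)$ on $\mathbb N\cup\{\infty\}$: for $\mathfrak f:\mathbb N\to(0,\infty)$ with $\sum_x\mathfrak f(x)<\infty$, let $\theta_x(i)$, $i\ge1$, $x\in\mathbb N$, be event times of independent rate-1 Poisson processes, $\mathcal S$ the set of all these times, $\omega(\theta_x(i))=x$, $\omega(s)=\infty$ for $s\notin\mathcal S$; with $\{T_s\}$ i.i.d. mean-one exponentials independent of the Poisson processes, $\Gamma(r)=\sum_{s\in\mathcal S\cap[0,r]}\mathfrak f(\omega(s))T_s$ and $\varphi$ the right-continuous inverse of $\Gamma$. The process $\omega(\varphi(t))$, $t\ge0$, is the uniform K-process with waiting time function $\mathfrak f$ started at $\infty$, whose law (given $\mathfrak f$) is $\mathcal K(\mathfrak f,1)$. *)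

(* Defs.v *)
From HB Require Import structures.
From mathcomp Require Import all_boot all_order all_algebra finmap.
From mathcomp Require Import all_classical all_reals all_analysis.
From mathcomp Require Import measurable_realfun.

Set Implicit Arguments.
Unset Strict Implicit.
Unset Printing Implicit Defensive.

Import Order.TTheory GRing.Theory Num.Theory.
Import numFieldNormedType.Exports.

Local Open Scope classical_set_scope.
Local Open Scope ring_scope.

Section constants.
Context {R : realType}.
Implicit Types p a alpha u : R.

Definition beta_star : R := Num.sqrt (2 * ln 2).

Definition beta1_cr p a : R := beta_star * Num.sqrt (p / a).

Definition beta2_cr p a : R := beta_star * Num.sqrt ((1 - p) / (1 - a)).

Definition Asl alpha u : R :=
  sin (pi * alpha) / pi *
  \int[lebesgue_measure]_(x in `[0, u])
    (x `^ (- (1 - alpha)) * (1 - x) `^ (- alpha)).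

End constants.

Section independence.
Context d (Omega : measurableType d) (R : realType) (P : probability Omega R).

(* Only meant for families of measurable maps [X i]. *)
Definition mutually_independent (I : choiceType) d' (E : measurableType d')
    (X : I -> Omega -> E) : Prop :=
  forall (J : {fset I}) (A : I -> set E), (forall i, measurable (A i)) ->
    P (\bigcap_(i in [set` J]) (X i @^-1` A i)) =
    (\prod_(i <- J) P (X i @^-1` A i))%E.

End independence.

Section poisson_point_process.
Context d (Omega : measurableType d) (R : realType) (P : probability Omega R).

Definition point_count (gamma : nat -> Omega -> R) (B : set R) (w : Omega)
    : \bar R :=
  counting [set x | B (gamma x w)].

(* [gamma] enumerates (with multiplicity) the points of a Poisson point process
   on [D] with intensity measure [Lambda]. The probability mass function is
   spelled out because [poisson_pmf] is 1, not a Dirac mass, at rate 0. *)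
Definition poisson_point_process (D : set R) (Lambda : set R -> \bar R)
    (gamma : nat -> {RV P >-> R}) : Prop :=
  [/\ {ae P, forall w, forall x, D (gamma x w)},
      forall B, measurable B -> B `<=` D -> (Lambda B < +oo)%E ->
        forall k : nat,
        P [set w | point_count gamma B w = k%:R%:E] =
        (fine (Lambda B) ^+ k / k`!%:R * expR (- fine (Lambda B)))%:E,
      forall B, measurable B -> B `<=` D -> Lambda B = +oo%E ->
        {ae P, forall w, point_count gamma B w = +oo%E} &
      forall (n : nat) (B : 'I_n -> set R),
        (forall i, measurable (B i)) -> (forall i, B i `<=` D) ->
        trivIset setT B ->
        mutually_independent P (fun i => point_count gamma (B i))].

Definition stable_intensity (alpha : R) (B : set R) : \bar R :=
  (\int[lebesgue_measure]_(x in B) (alpha * x `^ (- 1 - alpha))%:E)%E.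

(* The environment: the index [x : nat] stands for the [x.+1]-th site. *)
Definition random_environment (alpha : R) (gamma : nat -> {RV P >-> R}) : Prop :=
  poisson_point_process `]0, +oo[ (stable_intensity alpha) gamma /\
  {ae P, forall w, nonincreasing_seq (fun x => gamma x w)}.

End poisson_point_process.

Section K_process_drivers.
Context d (Omega : measurableType d) (R : realType) (P : probability Omega R).

Definition interarrival (theta : nat -> nat -> Omega -> R) (x i : nat)
    (w : Omega) : R :=
  if i is j.+1 then theta x i w - theta x j w else theta x 0%N w.

Definition driving_family (theta T : nat -> nat -> Omega -> R)
    (k : nat * nat + nat * nat) : Omega -> R :=
  match k with
  | inl (x, i) => interarrival theta x i
  | inr (x, i) => T x i
  end.

(* The event times [theta x i] ([i] starting from 0) of independent rate-1
   Poisson processes indexed by [x], and the i.i.d. mean-one exponentials,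
   independent of them. The exponential T_s attached to the event time
   s = theta x i is [T x i]. *)
Definition K_drivers (theta T : nat -> nat -> {RV P >-> R}) : Prop :=
  (forall k (A : set R), measurable A ->
     P (driving_family theta T k @^-1` A) = exponential_prob 1 A) /\
  mutually_independent P (driving_family theta T).

End K_process_drivers.

Section K_process.
Context {R : realType}.
(* Sample path level: a waiting time function, and a realization of the event
   times and of the exponentials. The state space is [option nat], [None] being
   the state infinity. *)
Variables (f : nat -> R) (theta T : nat -> nat -> R).

(* Almost surely the event times are pairwise distinct, and [xget] has nothing
   to choose. *)
Definition visited_site (s : R) : option nat :=
  xget None [set o | exists x i, s = theta x i /\ o = Some x].

Definition K_clock (r : R) : \bar R :=
  \esum_(k in [set k : nat * nat | 0 <= theta k.1 k.2 <= r])
    (f k.1 * T k.1 k.2)%:E.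

Definition K_clock_inv (t : R) : R := inf [set r | 0 <= r /\ (t%:E < K_clock r)%E].

Definition K_process (t : R) : option nat := visited_site (K_clock_inv t).

End K_process.

(* The path is constant on the open interval; as [option nat], seen as the
   one-point compactification of [nat], is totally disconnected, this amounts
   to the absence of discontinuities there. *)
Definition no_jump_within (R : realType) (X : R -> option nat) (s t : R) : Prop :=
  forall u v, s < u < t -> s < v < t -> X u = X v.

(* The probability that the K-process with waiting time function [f] has no
   jump within (tw, tw + t). This event, which involves uncountably many times,
   coincides with a measurable event up to a null set, hence is measurable for
   the completion of [P], but need not be measurable itself. The value of [P]
   on non-measurable sets being unspecified, its probability is taken through
   the outer measure [mu_ext P], which extends [P] and coincides with the
   completion of [P] where the latter is defined. *)
Definition no_jump_probability d (Omega : measurableType d) (R : realType)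
    (P : probability Omega R) (theta T : nat -> nat -> {RV P >-> R})
    (f : nat -> R) (tw t : R) : \bar R :=
  mu_ext P [set w | no_jump_within
    (K_process f (fun x i => theta x i w) (fun x i => T x i w)) tw (tw + t)].

(* The regime tw, t -> 0 with tw, t > 0 and t / tw -> theta, for z = (tw, t). *)
Definition aging_regime (R : realType) (theta : R) : set_system (R * R) :=
  filter_from [set e : R | 0 < e]
    (fun e => [set z : R * R | [/\ 0 < z.1 < e, 0 < z.2 < e &
                                   `|z.2 / z.1 - theta| < e]]).

Lemma aging_regime_filter (R : realType) (theta : R) :
  Filter (aging_regime theta).
Proof.
apply: filter_from_filter; first by exists 1 => /=.
move=> e1 e2 /= e10 e20; exists (Num.min e1 e2) => /=.
  by rewrite lt_min e10.
by move=> z /=; rewrite !lt_min => -[/and3P[-> -> ->] /and3P[-> -> ->] /andP[-> ->]].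
Qed.
#[global] Existing Instance aging_regime_filter.

(* Main.v *)
Require Import Defs.
From HB Require Import structures.
From mathcomp Require Import all_boot all_order all_algebra finmap.
From mathcomp Require Import all_classical all_reals all_analysis.
From mathcomp Require Import measurable_realfun ring lra.

Set Implicit Arguments.
Unset Strict Implicit.
Unset Printing Implicit Defensive.

Import Order.TTheory GRing.Theory Num.Theory.
Import numFieldNormedType.Exports.

Local Open Scope classical_set_scope.
Local Open Scope ring_scope.

(** Fix the environment, put tau_x = 1 / f x, and let nu y be the sum over x of
    e^{- y tau_x} and Phi l the sum over x of 1 / (1 + tau_x / l).

    The path is constant on (s, s + t) exactly when one jump of the clock, of
    size f x * T x i, covers [s, s + t]: wherever the clock increases otherwise,
    infinitely many sites are visited at once ([no_jump_withinP]). Let Y x i be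
    the clock just before the i-th event of site x. As T x i is exponential and
    independent of Y x i, the probability of no jump is the sum over x and i of
    the expectations of 1(Y x i <= s) e^{- (s + t - Y x i) tau_x}
    ([no_jump_probabilityE]).

    Let U_x be the sum over i of the laws of Y x i. Integrating out the sites
    one at a time gives the Laplace transform of Y x i ([pre_clock_laplace]), and
    a geometric series shows that U_x has transform 1 / Phi for every x
    ([renewal_laplace]). Hence all U_x coincide with U_0, and the probability of
    no jump is the integral over [0, s] of nu (s + t - y) against U_0(dy)
    ([no_jump_renewal]).

    The number of x with tau_x <= a grows like a constant times a^alpha in almost
    every environment: numbers of points of a Poisson process concentrate, by
    Chebyshev and Borel-Cantelli along squares ([ae_environment]). Averaging
    against e^{-b} db turns this into nu y ~ C y^{- alpha} as y -> 0 and
    Phi l ~ C Gamma(1 - alpha) l^alpha as l -> oo ([power_like_laplace],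
    [power_like_stieltjes]). By Karamata's argument the image of
    s^{- alpha} e^{- y / s} U_0(dy) under y |-> e^{- y / s} converges, because its
    moments do, to the image under u |-> e^{- u} of a multiple of
    u^{alpha - 1} e^{- u} du. So the limit is the integral of
    u^{alpha - 1} (1 + theta - u)^{- alpha} over [0, 1], divided by
    Gamma(alpha) Gamma(1 - alpha) ([no_jump_limit]). The substitution
    u = (1 + theta) x ([incomplete_beta]) and Euler's reflection formula
    ([gammaE_reflection]) identify it with the arcsine law. *)

(** * Densities and blocks of independent coordinates *)

Section density.
Local Open Scope ereal_scope.
Context d (T : measurableType d) (R : realType).
Variables (mu Q : {measure set T -> \bar R}) (rho : T -> R).
Hypothesis mrho : measurable_fun setT rho.
Hypothesis rho0 : forall x, (0 <= rho x)%R.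
Hypothesis Qrho : forall A, measurable A -> Q A = \int[mu]_(x in A) (rho x)%:E.

Import HBNNSimple.

Let density_indic A (mA : measurable A) :
  \int[Q]_x (\1_A x)%:E = \int[mu]_x ((\1_A x)%:E * (rho x)%:E).
Proof.
rewrite integral_indic// setIT Qrho// integral_mkcond.
apply: eq_integral => x _; rewrite patchE indicE.
by case: ifPn => _; rewrite ?mul1e ?mul0e.
Qed.

(** The two sides agree on indicators by hypothesis, hence on simple functions,
    hence on monotone limits of those. *)
Lemma ge0_integral_density (h : T -> \bar R) :
  measurable_fun setT h -> (forall x, 0 <= h x) ->
  \int[Q]_x h x = \int[mu]_x (h x * (rho x)%:E).
Proof.
move=> mh h0; pose g := nnsfun_approx measurableT mh.
have hE x : h x = limn (fun n => (g n x)%:E).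
  by apply/esym/cvg_lim => //; exact: cvg_nnsfun_approx.
have simple n : \int[Q]_x (g n x)%:E = \int[mu]_x ((g n x)%:E * (rho x)%:E).
  under eq_integral do rewrite fimfunE -fsumEFin//.
  rewrite ge0_integral_fsum//; last 2 first.
  - by move=> y; exact/measurable_EFinP/measurable_funM.
  - by move=> y x _; rewrite nnfun_muleindic_ge0.
  under [RHS]eq_integral => x _.
    rewrite fimfunE -fsumEFin// ge0_mule_fsuml; last first.
      by move=> y; exact: nnfun_muleindic_ge0.
    over.
  rewrite ge0_integral_fsum//; last 2 first.
  - by move=> y; apply: emeasurable_funM; apply/measurable_EFinP => //;
      exact: measurable_funM.
  - by move=> y x _; rewrite mule_ge0 ?nnfun_muleindic_ge0// lee_fin.
  apply: eq_fsbigr => r /[!inE] rg; rewrite integralZl_indic_nnsfun//.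
  rewrite density_indic//.
  have [x _ xr] := rg; have r0 : (0 <= r)%R by rewrite -xr.
  rewrite -ge0_integralZl//.
  - by apply: eq_integral => y _; rewrite EFinM muleA.
  - by apply: emeasurable_funM; exact/measurable_EFinP.
  - by move=> y _; rewrite mule_ge0// lee_fin.
transitivity (limn (fun n => \int[Q]_x (g n x)%:E)).
  rewrite -monotone_convergence//.
  - by apply: eq_integral => x _.
  - by move=> n; exact/measurable_EFinP.
  - by move=> n x _; rewrite lee_fin.
  - by move=> x _ m n mn; rewrite lee_fin; exact/lefP/nd_nnsfun_approx.
transitivity (limn (fun n => \int[mu]_x ((g n x)%:E * (rho x)%:E))).
  by congr (limn _); apply/funext => n; exact: simple.
rewrite -monotone_convergence//.
- apply: eq_integral => x _; apply/cvg_lim => //.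
  apply: cvgeZr => //; exact: cvg_nnsfun_approx.
- by move=> n; apply: emeasurable_funM; exact/measurable_EFinP.
- by move=> n x _; rewrite mule_ge0 ?lee_fin.
- move=> x _ m n mn; rewrite lee_wpmul2r ?lee_fin//.
  exact/lefP/nd_nnsfun_approx.
Qed.

End density.

Section independence_blocks.
Local Open Scope ereal_scope.
Context d (Omega : measurableType d) (R : realType) (P : probability Omega R).
Variables (I : choiceType) (X : I -> Omega -> R).
Hypothesis mX : forall i, measurable_fun setT (X i).
Hypothesis indX : mutually_independent P X.

Definition cylinders (K : set I) : set (set Omega) :=
  [set A | exists (J : {fset I}) (B : I -> set R),
    [/\ forall i, measurable (B i), [set` J] `<=` K &
        A = \bigcap_(i in [set` J]) (X i @^-1` B i)]].

(** Measurability for the sigma-algebra generated by the coordinates in [K]; this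
    makes every closure property of measurable functions available for
    dependence. *)
Definition depends_on (K : set I) d' (E : measurableType d') (Y : Omega -> E) :=
  measurable_fun setT (Y : g_sigma_algebraType (cylinders K) -> E).

Lemma cylinders_measurable K : cylinders K `<=` measurable.
Proof.
move=> _ [J [B [mB _ ->]]]; apply: fin_bigcap_measurable => // i _.
by rewrite -[X in measurable X]setTI; exact: mX.
Qed.

Lemma cylindersT K : cylinders K setT.
Proof.
exists fset0, (fun=> setT); split => //; rewrite set_fset0//.
by rewrite bigcap_set0.
Qed.

Lemma cylindersI K : setI_closed (cylinders K).
Proof.
move=> _ _ [J1 [B1 [mB1 J1K ->]]] [J2 [B2 [mB2 J2K ->]]].
pose C (J : {fset I}) (B : I -> set R) i : set R := if i \in J then B i else setT.
exists (J1 `|` J2)%fset, (fun i => C J1 B1 i `&` C J2 B2 i); split.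
- by move=> i; apply: measurableI; rewrite /C; case: ifP.
- by move=> i /=; rewrite inE => /orP[/J1K|/J2K].
- apply/seteqP; split => [w [H1 H2] i /= _|w H].
    by rewrite /C; split; case: ifPn => //= iJ; [exact: H1|exact: H2].
  split=> i /= iJ.
    have /= := H i; rewrite inE iJ /C iJ => /(_ isT) [+ _]; exact.
  have /= := H i; rewrite inE iJ orbT /C iJ => /(_ isT) [_ +]; exact.
Qed.

Lemma depends_on_measurable K d' (E : measurableType d') (Y : Omega -> E) :
  depends_on K Y -> measurable_fun setT Y.
Proof.
move=> mY _ B mB; have := mY measurableT B mB.
by apply: smallest_sub => //; [exact: sigma_algebra_measurable|exact: cylinders_measurable].
Qed.

Lemma depends_onS K K' d' (E : measurableType d') (Y : Omega -> E) :
  K `<=` K' -> depends_on K Y -> depends_on K' Y.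
Proof.
move=> KK' mY _ B mB; have := mY measurableT B mB.
apply: smallest_sub; first exact: smallest_sigma_algebra.
move=> A [J [C [mC JK ->]]]; apply: sub_sigma_algebra.
by exists J, C; split => //; apply: subset_trans KK'.
Qed.

Lemma depends_on_coord K i : K i -> depends_on K (X i).
Proof.
move=> Ki _ B mB; rewrite setTI; apply: sub_sigma_algebra.
exists [fset i]%fset, (fun=> B); split => //.
- by move=> j /=; rewrite inE => /eqP ->.
- by rewrite set_fset1 bigcap_set1.
Qed.

(** Both sides are finite measures in [A]; they agree on cylinders, which are
    stable under intersection, hence on the sigma-algebra they generate. *)
Lemma indep_coord K i A B : ~ K i -> <<s cylinders K >> A -> measurable B ->
  P (A `&` X i @^-1` B) = P A * P (X i @^-1` B).
Proof.
move=> Ki KA mB; have mXB : measurable (X i @^-1` B).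
  by rewrite -[X in measurable X]setTI; exact: mX.
have fP : P (X i @^-1` B) \is a fin_num by exact: fin_num_measure.
pose c : {nonneg R} := NngNum (fine_ge0 (measure_ge0 P (X i @^-1` B))).
have cE : c%:num%:E = P (X i @^-1` B) by rewrite /= fineK.
rewrite muleC -cE -[LHS]/(mrestr P mXB A) -[RHS]/(mscale c P A).
apply: (g_sigma_algebra_measure_unique _ (@cylinders_measurable K) (fun=> setT)) => //.
- by move=> n; exact: cylindersT.
- by rewrite bigcup_const.
- exact: cylindersI.
- move=> _ [J [C [mC JK ->]]];
  set F := \bigcap_(_ in _) _.
  rewrite -[LHS]/(P (F `&` X i @^-1` B)) -[RHS]/(c%:num%:E * P F) cE {}/F.
  have iJ : i \notin J by apply/negP => /JK.
  pose C' j : set R := if j == i then B else C j.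
  have mC' j : measurable (C' j) by rewrite /C'; case: ifP.
  have C'E j : j \in J -> C' j = C j.
    by move=> jJ; rewrite /C'; case: eqP => // ji; rewrite ji (negbTE iJ) in jJ.
  have := indX (i |` J)%fset mC'.
  have C'i : C' i = B by rewrite /C' eqxx.
  rewrite big_fsetU1//= C'i.
  rewrite (_ : \prod_(j <- J) _ = P (\bigcap_(j in [set` J]) X j @^-1` C j)); last first.
    rewrite indX// [in LHS]big_seq [in RHS]big_seq.
    by apply: eq_bigr => j jJ; rewrite C'E.
  rewrite /= => <-; congr (P _); apply/seteqP; split => [w [H1 H2] j /=|w H].
    rewrite !inE => /orP[/eqP ->|jJ]; first by rewrite C'i.
    by rewrite C'E//; exact: H1.
  split=> [j /= jJ|].
    by have := H j; rewrite /= !inE jJ orbT C'E//; exact.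
  by have := H i; rewrite /= !inE eqxx C'i; exact.
- move=> _; rewrite -[X in X < _]/(P (setT `&` X i @^-1` B)).
  by rewrite setTI ltey_eq fP.
Qed.

(** A coordinate outside [K] can be integrated out first: the joint law of [Y]
    and [X i0] is the product of their laws. *)
Lemma ge0_integral_indep_coord (K : set I) i0
    d' (E : measurableType d') (Y : Omega -> E) (g : E * R -> \bar R)
    (Q : {measure set R -> \bar R}) :
  ~ K i0 -> depends_on K Y -> measurable_fun setT g -> (forall z, 0 <= g z) ->
  (forall A, measurable A -> P (X i0 @^-1` A) = Q A) ->
  \int[P]_w g (Y w, X i0 w) = \int[P]_w \int[Q]_v g (Y w, v).
Proof.
move=> Ki0 KY mg g0 XQ.
have mY := depends_on_measurable KY.
pose Ym : {mfun Omega >-> E} :=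
  HB.pack Y (isMeasurableFun.Build _ _ _ _ _ mY).
pose Xm : {mfun Omega >-> R} :=
  HB.pack (X i0) (isMeasurableFun.Build _ _ _ _ _ (mX i0)).
pose YX w := (Ym w, Xm w).
have mYX : measurable_fun setT YX by exact: measurable_fun_pair.
pose YXm : {mfun Omega >-> (E * R)%type} :=
  HB.pack YX (isMeasurableFun.Build _ _ _ _ _ mYX).
pose m1 := distribution P Ym.
pose m2 := distribution P Xm.
pose m3 := distribution P YXm.
have mE A : measurable A -> m3 A = (m1 \x m2)%E A.
  move=> mA; apply/esym; apply: product_measure_unique => // B C mB mC.
  rewrite -[LHS]/(P (Y @^-1` B `&` X i0 @^-1` C)) (indep_coord Ki0)//.
  by have := KY measurableT B mB; rewrite setTI.
have m2Q A : measurable A -> m2 A = Q A by move=> mA; exact: XQ.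
transitivity (\int[m3]_z g z).
  by rewrite ge0_integral_pushforward.
transitivity (\int[(m1 \x m2)%E]_z g z).
  by apply: eq_measure_integral => A mA _; exact: mE.
rewrite fubini_tonelli1// ge0_integral_pushforward//; last first.
- by move=> y _; exact: integral_ge0.
- exact: measurable_fun_fubini_tonelli_F.
apply: eq_integral => w _; rewrite /fubini_F/=.
by apply: eq_measure_integral => A mA _; exact: m2Q.
Qed.

End independence_blocks.

(** * The exponential law *)

Section exponential_law.
Context (R : realType).
Local Notation mu := (@lebesgue_measure R).
Local Notation E1 := (exponential_prob (1 : R)).
Local Open Scope ereal_scope.

Lemma measurable_lt (u : R) : measurable [set v : R | v < u]%R.
Proof.
suff -> : [set v : R | v < u]%R = `]-oo, u[%classic by [].
by apply/seteqP; split => v; rewrite /= in_itv.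
Qed.

Lemma exponential_pdf_exp (c v : R) : (-1 < c)%R ->
  (expR (- (c * `|v|)) * exponential_pdf 1 v =
   (1 + c)^-1 * exponential_pdf (1 + c) v)%R.
Proof.
move=> c1; have [v0|v0] := ltP v 0%R; first by rewrite !lt0_exponential_pdf// !mulr0.
rewrite !exponential_pdfE// ger0_norm// mul1r -expRD mulrA mulVf ?mul1r; last first.
  by rewrite gt_eqF// -ltrBlDl sub0r.
by congr expR; ring.
Qed.

Lemma exponential_prob_itvo (r u : R) : (0 <= r)%R -> (0 <= u)%R ->
  \int[mu]_(v in [set v | v < u]%R) (exponential_pdf r v)%:E =
  (1 - expR (- (r * u)))%R%:E.
Proof.
move=> r0 u0.
have mpdf (D : set R) : measurable_fun D (EFin \o exponential_pdf r).
  by apply/measurable_funTS/measurable_EFinP; exact: measurable_exponential_pdf.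
rewrite (_ : [set v | v < u]%R = `]-oo, u[%classic); last first.
  by apply/seteqP; split => v; rewrite /= in_itv.
transitivity (\int[mu]_(v in `[0%R, u[) (exponential_pdf r v)%:E).
  rewrite (_ : `[0%R, u[%classic = `]-oo, u[%classic `&` `[0%R, +oo[%classic); last first.
    apply/seteqP; split => v; rewrite /= !in_itv/= ?andbT.
      by move=> /andP[-> ->].
    by case=> -> ->.
  rewrite [RHS]integral_mkcondr; apply: eq_integral => v _.
  rewrite patchE; case: ifPn => //; rewrite notin_setE/= in_itv/= andbT => /negP.
  by rewrite -ltNge => v0; rewrite lt0_exponential_pdf.
rewrite integral_itv_bndo_bndc//.
move: u0; rewrite le_eqVlt => /predU1P[<-|u0].
  by rewrite set_itv1 integral_set1 mulr0 oppr0 expR0 subrr.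
by rewrite -/(exponential_prob r _) exponential_prob_itv0c// mulNr EFinB.
Qed.

Lemma integral_exponential_pdf_setC (A : set R) : measurable A ->
  \int[mu]_(v in A) (exponential_pdf 1 v)%:E +
  \int[mu]_(v in ~` A) (exponential_pdf 1 v)%:E = 1.
Proof.
move=> mA; rewrite -ge0_integral_setU ?setUv//.
- by rewrite integral_exponential_pdf.
- exact: measurableC.
- by apply/measurable_EFinP; exact: measurable_exponential_pdf.
- by move=> v _; rewrite lee_fin exponential_pdf_ge0.
- by rewrite disj_set2E setICr.
Qed.

Lemma exponential_prob_tail (u : R) : (0 <= u)%R ->
  \int[mu]_(v in [set v | u <= v]%R) (exponential_pdf 1 v)%:E = (expR (- u))%:E.
Proof.
move=> u0.
have mA : measurable [set v : R | v < u]%R.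
  exact: measurable_lt.
have := integral_exponential_pdf_setC mA; rewrite exponential_prob_itvo// mul1r.
rewrite (_ : ~` _ = [set v | u <= v]%R); last first.
  by apply/seteqP; split => v /=; rewrite leNgt => /negP.
case: (integral _ _ _) => [r| |]//; rewrite -EFinD => -[] rE.
by congr EFin; lra.
Qed.

Variable Q : {measure set R -> \bar R}.
Hypothesis QE : forall A : set R, measurable A -> Q A = E1 A.

Lemma ge0_integral_exponential (h : R -> \bar R) :
  measurable_fun setT h -> (forall x, 0 <= h x) ->
  \int[Q]_v h v = \int[mu]_v (h v * (exponential_pdf 1 v)%:E).
Proof.
move=> mh h0.
pose idT : R -> measurableTypeR R := idfun.
have midT : measurable_fun setT idT by move=> _ B mB; rewrite setTI.
transitivity (\int[pushforward Q idT]_v h v).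
  rewrite (ge0_integral_pushforward midT) ?preimage_setT //; exact: mh.
apply: ge0_integral_density => //.
- exact: measurable_exponential_pdf.
- by move=> x; exact: exponential_pdf_ge0.
Qed.

(** Damping by e^{- c v} turns the rate 1 exponential density into a multiple of
    the density of rate 1 + c. The absolute value spares the assumption that the
    variable is nonnegative everywhere, and not only almost surely. *)
Lemma laplace_exponential (c : R) : (-1 < c)%R ->
  \int[Q]_v (expR (- (c * `|v|)))%R%:E = ((1 + c)^-1)%R%:E.
Proof.
move=> c1; have c0 : (0 < 1 + c)%R by rewrite -ltrBlDl sub0r.
rewrite ge0_integral_exponential//; last first.
  apply/measurable_EFinP; apply: measurableT_comp => //.
  apply: measurableT_comp => //; apply: measurable_funM => //.
under eq_integral do rewrite -EFinM exponential_pdf_exp// EFinM.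
rewrite ge0_integralZl//.
- by rewrite integral_exponential_pdf// mule1.
- by apply/measurable_EFinP; exact: measurable_exponential_pdf.
- by move=> x _; rewrite lee_fin exponential_pdf_ge0// ltW.
- by rewrite lee_fin invr_ge0 ltW.
Qed.

(** The generating function of the number of points of a rate 1 Poisson process
    before time [u]. *)
Definition poisson_gf (z u : R) : R := (expR (- ((1 - z) * Num.max u 0)))%R.

Lemma measurable_poisson_gf z : measurable_fun setT (poisson_gf z).
Proof.
apply: measurableT_comp => //; apply: measurableT_comp => //.
by apply: measurable_funM => //; exact: measurable_maxr.
Qed.

(** Conditioning a Poisson process on its first point: if that point [v] is before
    [u] it contributes a factor [z], and the process starts afresh after [v]. *)
Lemma poisson_gf_renewal (z u : R) : (0 <= z)%R ->
  \int[Q]_v ((if v < u then z else 1) * poisson_gf z (u - v))%R%:E =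
  (poisson_gf z u)%:E.
Proof.
move=> z0.
have mlt : measurable_fun setT (fun v : R => v < u)%R.
  exact: measurable_fun_ltr.
have mset : measurable [set v : R | v < u]%R.
  exact: measurable_lt.
rewrite ge0_integral_exponential//; last 2 first.
- apply/measurable_EFinP; apply: measurable_funM.
    exact: measurable_fun_ifT.
  apply: measurableT_comp; first exact: measurable_poisson_gf.
  exact: measurable_funB.
- by move=> v; rewrite lee_fin mulr_ge0 ?expR_ge0//; case: ifP.
have [u0|u0] := leP u 0%R.
  transitivity (\int[mu]_v (exponential_pdf 1 v)%:E).
    apply: eq_integral => v _; have [v0|v0] := ltP v 0%R.
      by rewrite lt0_exponential_pdf// mule0.
    rewrite ltNge (le_trans u0)//= /poisson_gf max_r; last first.
      by rewrite subr_le0 (le_trans u0).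
    by rewrite mulr0 oppr0 expR0 mulr1 mul1e.
  by rewrite integral_exponential_pdf// /poisson_gf max_r// mulr0 oppr0 expR0.
rewrite -(setUv [set v : R | v < u]%R) ge0_integral_setU//=; last 4 first.
- exact: measurableC.
- rewrite setUv; apply: emeasurable_funM; last first.
    by apply/measurable_EFinP; exact: measurable_exponential_pdf.
  apply/measurable_EFinP; apply: measurable_funM.
    exact: measurable_fun_ifT.
  apply: measurableT_comp; first exact: measurable_poisson_gf.
  exact: measurable_funB.
- move=> v _; rewrite -EFinM lee_fin !mulr_ge0 ?expR_ge0 ?exponential_pdf_ge0//.
  by case: ifP.
- by rewrite disj_set2E setICr.
transitivity ((expR (- ((1 - z) * u)))%R%:E * (1 - expR (- (z * u)))%R%:E + (expR (- u))%:E).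
  congr (_ + _).
    rewrite -(exponential_prob_itvo z0 (ltW u0)) -ge0_integralZl//; last 2 first.
    - apply/measurable_EFinP/measurable_funTS; exact: measurable_exponential_pdf.
    - by move=> v _; rewrite lee_fin exponential_pdf_ge0.
    apply: eq_integral => v; rewrite inE/= => vu; rewrite vu -!EFinM; congr EFin.
    have [v0|v0] := ltP v 0%R; first by rewrite !lt0_exponential_pdf// !mulr0.
    rewrite !exponential_pdfE// mul1r /poisson_gf max_l ?subr_ge0 ?ltW//.
    rewrite -mulrA -expRD mulrCA; congr (_ * _)%R; rewrite -expRD.
    by congr expR; ring.
  rewrite -(exponential_prob_tail (ltW u0)).
  rewrite (_ : ~` _ = [set v | u <= v]%R); last first.
    by apply/seteqP; split => v /=; rewrite leNgt => /negP.
  apply: eq_integral => v; rewrite inE/= => uv.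
  rewrite ltNge uv/= /poisson_gf max_r ?subr_le0// mulr0 oppr0 expR0.
  by rewrite mulr1 mul1e.
rewrite -EFinM -EFinD; congr EFin; rewrite /poisson_gf max_l ?ltW//.
have -> : expR (- u) = (expR (- ((1 - z) * u)) * expR (- (z * u)))%R.
  by rewrite -expRD; congr expR; ring.
by ring.
Qed.

Lemma exponential_le0 : Q [set v | v <= 0]%R = 0.
Proof.
have -> : [set v : R | v <= 0]%R = `]-oo, 0%R]%classic.
  by apply/seteqP; split => v; rewrite /= in_itv.
rewrite QE// /exponential_prob.
rewrite -integral_itv_bndo_bndc; last first.
  by apply/measurable_EFinP/measurable_funTS; exact: measurable_exponential_pdf.
by apply: integral0_eq => v; rewrite /= in_itv/= => v0; rewrite lt0_exponential_pdf.
Qed.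

Lemma exponential_set1 a : Q [set a] = 0.
Proof. by rewrite QE// /exponential_prob integral_set1. Qed.

Lemma exponential_itv_gt0 a b : (0 <= a < b)%R -> 0 < Q [set v | a < v < b]%R.
Proof.
move=> /andP[a0 ab].
pose D : set R := [set v | a < v < b]%R.
have DE : D = `]a, b[%classic by apply/seteqP; split => v; rewrite /= in_itv.
have mD : measurable D by rewrite DE.
have mI c : measurable [set v : R | v < c]%R.
  exact: measurable_lt.
rewrite ltNge; apply/negP => QD.
have : Q [set v | v < b]%R <= Q [set v | v < a]%R.
  rewrite (_ : [set v | v < b]%R = [set v | v < a]%R `|` ([set a] `|` D)); last first.
    apply/seteqP; split => v /=.
      by rewrite /D/= => vb; rewrite vb andbT; case: (ltgtP v a) => ?; [left|right;right|right;left].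
    by case => [/lt_trans|[->//|/andP[]//]]; exact.
  rewrite (le_trans (measureU2 _ _ _))//; first exact: measurableU.
  rewrite -[leRHS]adde0 leeD2l//.
  rewrite (le_trans (measureU2 _ _ _))//.
  by rewrite [X in X + _](_ : _ = 0) ?add0e//; exact: exponential_set1.
rewrite !QE//= /exponential_prob !exponential_prob_itvo// ?(le_trans a0 (ltW ab))//.
rewrite lee_fin !mul1r lerD2l lerN2 ler_expR lerN2.
by rewrite leNgt ab.
Qed.

End exponential_law.

(** * Functions of independent exponential coordinates *)

Lemma measurable_pred d (T : measurableType d) (b : T -> bool) :
  measurable_fun setT b -> measurable [set x | b x].
Proof. by move=> mb; have := mb measurableT [set true] I; rewrite setTI. Qed.

Section exponential_coordinates.
Context d (Omega : measurableType d) (R : realType) (P : probability Omega R).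
Variables (I : choiceType) (X : I -> Omega -> R).
Hypothesis mX : forall i, measurable_fun setT (X i).
Hypothesis indX : mutually_independent P X.
Hypothesis expX : forall i (A : set R), measurable A ->
  P (X i @^-1` A) = exponential_prob 1 A.
Local Notation dep := (depends_on X).

Let Xm i : {mfun Omega >-> R} :=
  HB.pack (X i) (isMeasurableFun.Build _ _ _ _ _ (mX i)).
Let law i : probability R R := distribution P (Xm i).

Let lawE i (A : set R) : measurable A -> law i A = exponential_prob 1 A.
Proof. exact: expX. Qed.

Local Open Scope ereal_scope.

Lemma indep_laplace (K : set I) i0 (V c : Omega -> R) :
  ~ K i0 -> dep K V -> dep K c -> (forall w, (0 <= V w)%R) ->
  (forall w, (-1 < c w)%R) ->
  \int[P]_w (V w * expR (- (c w * `|X i0 w|)))%R%:E =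
  \int[P]_w (V w * (1 + c w)^-1)%R%:E.
Proof.
move=> Ki KV Kc V0 c0.
pose g' (z : (R * R) * R) := (Num.max z.1.1 0 * expR (- (z.1.2 * `|z.2|)))%R%:E.
have mg' : measurable_fun setT g'.
  apply/measurable_EFinP/measurable_funM.
    apply: measurable_maxr => //.
    by apply: measurableT_comp.
  apply: measurableT_comp => //; apply: measurableT_comp => //.
  apply: measurable_funM; first exact: measurableT_comp.
  by apply: measurableT_comp.
transitivity (\int[P]_w g' ((V w, c w), X i0 w)).
  by apply: eq_integral => w _; rewrite /g'/= max_l.
rewrite (@ge0_integral_indep_coord _ _ _ P _ X mX indX K i0 _ _ _ g' (law i0))//.
- apply: eq_integral => w _; rewrite /g'/= max_l//.
  under eq_integral do rewrite EFinM.
  rewrite ge0_integralZl//.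
  + by rewrite (laplace_exponential (@lawE i0)).
  + apply/measurable_EFinP; apply: measurableT_comp => //.
    apply: measurableT_comp => //; apply: measurable_funM => //.
  + by rewrite lee_fin.
- exact: measurable_fun_pair.
- by move=> z; rewrite lee_fin mulr_ge0 ?expR_ge0// le_max lexx orbT.
Qed.

Lemma indep_renewal (K : set I) i0 (V U : Omega -> R) (z : R) :
  ~ K i0 -> dep K V -> dep K U -> (forall w, (0 <= V w)%R) -> (0 <= z)%R ->
  \int[P]_w (V w * ((if X i0 w < U w then z else 1) *
                    poisson_gf z (U w - X i0 w)))%R%:E =
  \int[P]_w (V w * poisson_gf z (U w))%R%:E.
Proof.
move=> Ki KV KU V0 z0.
pose g' (t : (R * R) * R) :=
  (Num.max t.1.1 0 * ((if t.2 < t.1.2 then z else 1) *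
     poisson_gf z (t.1.2 - t.2)))%R%:E.
have mg' : measurable_fun setT g'.
  apply/measurable_EFinP/measurable_funM.
    apply: measurable_maxr => //.
    by apply: measurableT_comp.
  apply: measurable_funM.
    apply: measurable_fun_ifT => //.
    by apply: measurable_fun_ltr => //; apply: measurableT_comp.
  apply: measurableT_comp; first exact: measurable_poisson_gf.
  by apply: measurable_funB => //; apply: measurableT_comp.
transitivity (\int[P]_w g' ((V w, U w), X i0 w)).
  by apply: eq_integral => w _; rewrite /g'/= max_l.
rewrite (@ge0_integral_indep_coord _ _ _ P _ X mX indX K i0 _ _ _ g' (law i0))//.
- apply: eq_integral => w _; rewrite /g'/= max_l//.
  under eq_integral do rewrite EFinM.
  rewrite ge0_integralZl//.
  + by rewrite (poisson_gf_renewal (@lawE i0)).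
  + apply/measurable_EFinP/measurable_funM.
      by apply: measurable_fun_ifT => //; exact: measurable_fun_ltr.
    apply: measurableT_comp; first exact: measurable_poisson_gf.
    exact: measurable_funB.
  + by move=> v _; rewrite lee_fin mulr_ge0 ?expR_ge0//; case: ifP.
  + by rewrite lee_fin.
- exact: measurable_fun_pair.
- move=> t; rewrite lee_fin !mulr_ge0 ?expR_ge0//; last by case: ifP.
  by rewrite le_max lexx orbT.
Qed.

Lemma indep_neq (K : set I) i0 (Y : Omega -> R) :
  ~ K i0 -> dep K Y -> P [set w | X i0 w = Y w] = 0.
Proof.
move=> Ki KY.
have mY := depends_on_measurable mX KY.
pose g (z : R * R) : \bar R := (\1_[set z : R * R | z.2 = z.1] z)%:E.
have mD : measurable [set z : R * R | z.2 = z.1].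
  rewrite (_ : mkset _ = (fun z : R * R => (z.2 - z.1)%R) @^-1` [set 0%R]); last first.
    by apply/seteqP; split => z /=; [move=> ->; rewrite subrr|move/subr0_eq].
  rewrite -[X in measurable X]setTI; apply: measurable_funB => //.
have mg : measurable_fun setT g by apply/measurable_EFinP; exact: measurable_indic.
have mE : measurable [set w | X i0 w = Y w].
  rewrite (_ : mkset _ = (fun w => (X i0 w - Y w)%R) @^-1` [set 0%R]); last first.
    by apply/seteqP; split => z /=; [move=> ->; rewrite subrr|move/subr0_eq].
  rewrite -[X in measurable X]setTI; apply: measurable_funB => //.
transitivity (\int[P]_w g (Y w, X i0 w)).
  rewrite -[in LHS](setIT [set w | _]) -integral_indic//.
rewrite (@ge0_integral_indep_coord _ _ _ P _ X mX indX K i0 _ _ _ g (law i0))//.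
  apply: integral0_eq => w _; rewrite /g.
  rewrite (_ : (fun v => _) = (fun v => (\1_[set Y w] v)%:E)); last first.
    by apply/funext => v; rewrite !indicE; congr (_%:R%:E); apply/idP/idP; rewrite !inE.
  by rewrite integral_indic// setIT (exponential_set1 (@lawE i0)).
by move=> z; rewrite lee_fin.
Qed.

(** On the event [Y w <= s], the exponential variable has to exceed
    the positive number (e - Y) / f. *)
Lemma indep_jump_across (K : set I) i0 (Y : Omega -> R) (s e f : R) :
  ~ K i0 -> dep K Y -> (0 < f)%R -> (s < e)%R ->
  P [set w | Y w <= s /\ e <= Y w + f * X i0 w]%R =
  \int[P]_w ((Y w <= s)%R%:R * expR (- ((e - Y w) / f)))%R%:E.
Proof.
move=> Ki KY f0 se.
have mY := depends_on_measurable mX KY.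
pose S : set (R * R) := [set z | z.1 <= s /\ e <= z.1 + f * z.2]%R.
have mS : measurable S.
  apply: measurableI; apply: measurable_pred.
    by apply: measurable_fun_ler => //; exact: measurable_fst.
  apply: measurable_fun_ler => //; apply: measurable_funD => //.
  by apply: measurable_funM => //; exact: measurable_snd.
pose g (z : R * R) : \bar R := (\1_S z)%:E.
have mg : measurable_fun setT g by apply/measurable_EFinP; exact: measurable_indic.
have mE : measurable [set w | Y w <= s /\ e <= Y w + f * X i0 w]%R.
  rewrite (_ : mkset _ = (fun w => (Y w, X i0 w)) @^-1` S)//.
  by rewrite -[X in measurable X]setTI; apply: measurable_fun_pair.
transitivity (\int[P]_w g (Y w, X i0 w)).
  rewrite -[in LHS](setIT [set w | _]) -integral_indic//.
rewrite (@ge0_integral_indep_coord _ _ _ P _ X mX indX K i0 _ _ _ g (law i0))//.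
  apply: eq_integral => w _; rewrite /g.
  have [Ys|Ys] := leP (Y w) s; last first.
    rewrite mul0r; apply: integral0_eq => v _.
    rewrite indicE memNset// /S/=; apply/not_andP; left.
    by apply/negP; rewrite -ltNge.
  rewrite mul1r.
  rewrite -(exponential_prob_tail (u := ((e - Y w) / f)%R)); last first.
    by rewrite divr_ge0 ?ltW// subr_gt0 (le_lt_trans Ys).
  have mge c : measurable [set v : R | c <= v]%R.
    by apply: measurable_pred; exact: measurable_fun_ler.
  transitivity (law i0 [set v | (e - Y w) / f <= v]%R).
    rewrite (_ : (fun v => _) = (fun v => (\1_[set v | (e - Y w) / f <= v]%R v)%:E)); last first.
      apply/funext => v; rewrite !indicE; congr ((nat_of_bool _)%:R%:E).
      apply/idP/idP; rewrite !inE /S /= ler_pdivrMr// lerBlDl (mulrC v).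
        by case.
      by move=> ?; split.
    by rewrite integral_indic ?setIT//; exact: mge.
  by rewrite lawE//; exact: mge.
by move=> z; rewrite lee_fin.
Qed.

(** The probability that the event fails for m successive coordinates after the
    N-th is (1 - q)^m, where q is the probability of the event for one of them. *)
Lemma infinitely_often (k : nat -> I) (A : set R) : injective k ->
  measurable A -> 0 < exponential_prob 1 A ->
  {ae P, forall w, forall N, exists n, (N <= n)%N /\ A (X (k n) w)}.
Proof.
move=> kinj mA A0.
have Afin : exponential_prob 1 A \is a fin_num.
  by rewrite -(expX (k 0%N))// fin_num_measure// -[X in measurable X]setTI; exact: mX.
pose q : R := fine (exponential_prob 1 A).
have qE : q%:E = exponential_prob 1 A by rewrite fineK.
have q0 : (0 < q)%R by rewrite -lte_fin qE.
have q1 : (q <= 1)%R.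
  rewrite -lee_fin qE -(expX (k 0%N))// probability_le1//.
  by rewrite -[X in measurable X]setTI; exact: mX.
apply: ae_foralln => N.
pose B m := \bigcap_(n in `I_m) (X (k (N + n)%N) @^-1` (~` A)).
have BS m : B m.+1 = B m `&` (X (k (N + m)%N) @^-1` (~` A)).
  apply/seteqP; split => w.
    move=> H; split; last by apply: H => /=.
    by move=> n /= nm; apply: H => /=; rewrite (ltn_trans nm).
  by move=> [H1 H2] n /=; rewrite ltnS leq_eqVlt => /predU1P[->//|]; exact: H1.
have BK m : <<s cylinders X [set i | exists2 n, (n < N + m)%N & i = k n] >> (B m).
  elim: m => [|m IH].
    rewrite /B (_ : `I_0 = set0) ?bigcap_set0; last by apply/seteqP; split.
    by apply: sub_sigma_algebra; exact: cylindersT.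
  have mono m1 m2 : (m1 <= m2)%N -> cylinders X [set i | exists2 n, (n < N + m1)%N & i = k n] `<=`
      cylinders X [set i | exists2 n, (n < N + m2)%N & i = k n].
    move=> m12 A' [J [C [mC JK ->]]]; exists J, C; split => // i /JK [n nm ->].
    by exists n => //; rewrite (leq_trans nm)// leq_add2l.
  rewrite BS; apply: (@measurableI _ (g_sigma_algebraType (cylinders X _))).
    by apply: sub_smallest2r IH; [exact: smallest_sigma_algebra|exact: mono].
  have : dep [set i | exists2 n, (n < N + m.+1)%N & i = k n] (X (k (N + m)%N)).
    by apply: depends_on_coord; exists (N + m)%N => //; rewrite addnS.
  by move=> /(_ measurableT _ (measurableC mA)); rewrite setTI.
have mB m : measurable (B m).
  apply: fin_bigcap_measurable => // n _; rewrite -[X in measurable X]setTI.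
  by apply: mX => //; exact: measurableC.
have PB m : P (B m) = ((1 - q) ^+ m)%R%:E.
  elim: m => [|m IH].
    rewrite /B (_ : `I_0 = set0) ?bigcap_set0 ?probability_setT//.
    by apply/seteqP; split.
  rewrite BS (indep_coord mX indX (K := [set i | exists2 n, (n < N + m)%N & i = k n]))//.
  - rewrite IH preimage_setC probability_setC; last first.
      by rewrite -[X in measurable X]setTI; exact: mX.
    by rewrite expX// -qE -EFinB -EFinM exprSr.
  - by move=> [n nm] /kinj nE; rewrite -nE ltnn in nm.
  - exact: measurableC.
exists (\bigcap_m B m); split.
- exact: bigcapT_measurable.
- apply/eqP; rewrite eq_le measure_ge0 andbT.
  have cvg0 : ((1 - q) ^+ m)%R%:E @[m --> \oo] --> 0.
    apply: cvg_EFin; first by near=> m.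
    apply: cvg_expr; rewrite ger0_norm ?subr_ge0// ltrBlDr ltrDl//.
  rewrite -(cvg_lim _ cvg0)//; apply: lime_ge.
    by apply/cvg_ex; exists 0.
  apply: nearW => m; rewrite -PB le_measure ?inE//; first exact: bigcapT_measurable.
  exact: bigcap_inf.
- move=> w /= H m _ n /= nm An; apply: H.
  by exists (N + n)%N; split; rewrite ?leq_addr.
Unshelve. all: by end_near. Qed.

End exponential_coordinates.

(** * Event times of the sites *)

Lemma ae_forall_countType d (T : measurableType d) (R : realType)
    (mu : {measure set T -> \bar R}) (I : countType) (Q : I -> T -> Prop) :
  (forall i, {ae mu, forall w, Q i w}) -> {ae mu, forall w, forall i, Q i w}.
Proof.
move=> H; suff : {ae mu, forall w, forall n : nat, oapp (fun i => Q i w) True (choice.unpickle n)}.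
  by apply: filterS => w Hw i; have := Hw (choice.pickle i); rewrite choice.pickleK.
apply: ae_foralln => n; case: (choice.unpickle n) => [i|] /=; first exact: H.
by apply: aeW.
Qed.

Section drivers.
Context d (Omega : measurableType d) (R : realType) (P : probability Omega R).
Variables (theta T : nat -> nat -> {RV P >-> R}).
Hypothesis hD : K_drivers theta T.
Local Notation D := (driving_family (fun x i => theta x i : Omega -> R)
                                    (fun x i => T x i : Omega -> R)).
Local Notation dep := (depends_on D).

Lemma measurable_driving k : measurable_fun setT (D k).
Proof.
by case: k => -[x i] //=; case: i => [|i] //=; exact: measurable_funB.
Qed.
Let mD := measurable_driving.
Let Dm k : {mfun Omega >-> R} :=
  HB.pack (D k) (isMeasurableFun.Build _ _ _ _ _ (mD k)).
Let law k := distribution P (Dm k).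

Lemma driving_law k (A : set R) : measurable A ->
  P (D k @^-1` A) = exponential_prob 1 A.
Proof. by case: hD => + _; exact. Qed.

Lemma driving_independent : mutually_independent P D.
Proof. by case: hD. Qed.
Let iD := driving_independent.

Lemma clock_sum x i w : theta x i w = \sum_(j < i.+1) D (inl (x, j : nat)) w.
Proof.
elim: i => [|i IH]; first by rewrite big_ord_recl big_ord0 addr0.
by rewrite big_ord_recr/= -IH /= addrC subrK.
Qed.

Lemma dep_clock (K : set (nat * nat + nat * nat)) x i :
  (forall j, (j <= i)%N -> K (inl (x, j))) -> dep K (theta x i).
Proof.
move=> Kx; rewrite /depends_on (_ : (theta x i : Omega -> R) =
   (fun w => \sum_(j < i.+1) D (inl (x, j : nat)) w)); last first.
  by apply/funext => w; exact: clock_sum.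
apply: measurable_sum => j; apply: depends_on_coord; apply: Kx.
by rewrite -ltnS.
Qed.

Lemma dep_jump (K : set (nat * nat + nat * nat)) x i :
  K (inr (x, i)) -> dep K (T x i).
Proof. by move=> Kx; exact: (depends_on_coord (i := inr (x, i))). Qed.

Lemma ae_driving_gt0 : {ae P, forall w, forall k, 0 < D k w}.
Proof.
have H k : {ae P, forall w, 0 < D k w}.
  exists [set w | D k w <= 0]; split.
  - by apply: measurable_pred; exact: measurable_fun_ler.
  - exact: (exponential_le0 (Q := law k) (driving_law k)).
  - by move=> w /= /negP; rewrite -leNgt.
have H1 : {ae P, forall w, forall x i, 0 < D (inl (x, i)) w}.
  by apply: ae_foralln => x; apply: ae_foralln => i; exact: H.
have H2 : {ae P, forall w, forall x i, 0 < D (inr (x, i)) w}.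
  by apply: ae_foralln => x; apply: ae_foralln => i; exact: H.
by apply: filterS2 H1 H2 => w H1 H2 [[x i]|[x i]].
Qed.

Lemma clock_increasing w : (forall k, 0 < D k w) ->
  forall x i j, (i < j)%N -> theta x i w < theta x j w.
Proof.
move=> D0 x i j; elim: j => // j IH; rewrite ltnS leq_eqVlt.
have lt_step : theta x j w < theta x j.+1 w.
  by have := D0 (inl (x, j.+1)); rewrite /= subr_gt0.
by move=> /predU1P[->//|/IH/lt_trans]; exact.
Qed.

Lemma clock_gt0 w : (forall k, 0 < D k w) -> forall x i, 0 < theta x i w.
Proof.
move=> D0 x i; have th0 : 0 < theta x 0%N w by exact: (D0 (inl (x, 0%N))).
by case: i => // i; rewrite (lt_trans th0)//; exact: clock_increasing.
Qed.

(** Two event times of distinct sites coincide only if the first interarrival time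
    of one site equals a function of other coordinates. *)
Lemma ae_clock_neq : {ae P, forall w, forall x i y j,
  theta x i w = theta y j w -> x = y}.
Proof.
have H x i y j : {ae P, forall w, theta x i w = theta y j w -> x = y}.
  have [->|xy] := eqVneq x y; first by apply: aeW.
  pose Y w := theta y j w - \sum_(k < i) D (inl (x, k.+1)) w.
  pose K : set (nat * nat + nat * nat) := [set k | k != inl (x, 0%N)].
  have KY : dep K Y.
    apply: measurable_funB.
      by apply: dep_clock => k _ /=; apply/eqP => -[yx _]; rewrite yx eqxx in xy.
    by apply: measurable_sum => k; apply: depends_on_coord; apply/eqP.
  have := indep_neq mD iD driving_law (K := K) (i0 := inl (x, 0%N)) _ KY.
  move=> PE; exists [set w | D (inl (x, 0%N)) w = Y w]; split.
  - rewrite (_ : mkset _ = [set w | D (inl (x, 0%N)) w == Y w]); last first.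
      by apply/seteqP; split => w /eqP.
    apply: measurable_pred; apply: measurable_fun_eqr => //.
    exact: (depends_on_measurable mD KY).
  - by apply: PE => /=; apply/negP; rewrite negbK.
  - move=> w /= Hw; apply: contrapT => Hneq; apply: Hw => E; exfalso; apply: Hneq.
    by rewrite /Y -E (clock_sum x i w) big_ord_recl; exact: (esym (addrK _ _)).
apply: ae_foralln => x; apply: ae_foralln => i; apply: ae_foralln => y.
by apply: ae_foralln => j; exact: H.
Qed.

Let mgt1 : measurable [set v : R | 1 < v].
Proof. by apply: measurable_pred; exact: measurable_fun_ltr. Qed.

Let exp_gt1 : (0 < exponential_prob (1 : R) [set v : R | 1 < v]%R)%E.
Proof.
have m12 : measurable [set v : R | 1 < v < 2%:R].
  by apply: measurable_pred; apply: measurable_and; exact: measurable_fun_ltr.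
pose k0 : nat * nat + nat * nat := inl (0%N, 0%N).
have H12 : (0 < law k0 [set v | 1 < v < 2%:R]%R)%E.
  by apply: (exponential_itv_gt0 (Q := law k0) (driving_law k0)); rewrite ler01 ltr1n.
rewrite -(driving_law k0 mgt1) (lt_le_trans H12)//.
apply: (@le_measure _ _ _ (law k0)); rewrite ?inE//.
by move=> v /= /andP[].
Qed.

Lemma ae_clock_unbounded :
  {ae P, forall w, forall x (r : R), exists i, r < theta x i w}.
Proof.
apply: ae_foralln => x.
have H := infinitely_often mD iD driving_law (k := fun i => inl (x, i)) _ mgt1 exp_gt1.
have {}H : {ae P, forall w N, exists n, (N <= n)%N /\ 1 < D (inl (x, n)) w}.
  by apply: H => i j [].
apply: filterS2 H ae_driving_gt0 => w H D0 r.
have big (m : nat) : exists i, m%:R <= theta x i w.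
  elim: m => [|m [i mi]]; first by exists 0%N; rewrite ltW// clock_gt0.
  have [n [iN n1]] := H i.+1.
  exists n; case: n iN n1 => // n iN n1.
  have -> : theta x n.+1 w = theta x n w + D (inl (x, n.+1)) w by rewrite /= addrC subrK.
  rewrite -natr1 lerD ?(ltW n1)// (le_trans mi)//.
  move: iN; rewrite ltnS leq_eqVlt => /predU1P[->//|iN].
  by rewrite ltW// clock_increasing.
have [i ri] := big (Num.bound `|r|).
by exists i; rewrite (lt_le_trans _ ri)// (le_lt_trans (ler_norm r))// archi_boundP.
Qed.

Lemma ae_jump_gt1 : {ae P, forall w, forall N, exists n, (N <= n)%N /\ 1 < T 0%N n w}.
Proof.
have H := infinitely_often mD iD driving_law (k := fun i => inr (0%N, i)) _ mgt1 exp_gt1.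
by apply: H => i j [].
Qed.

(** It is enough to treat rational intervals, and the first events of the sites
    are independent variables charging each of them. *)
Lemma ae_clock_dense : {ae P, forall w, forall (a b : R), 0 <= a < b ->
  forall N, exists x, (N <= x)%N /\ a < theta x 0%N w < b}.
Proof.
have H (p q : rat) : {ae P, forall w, (0 <= (ratr p : R) < ratr q) ->
    forall N, exists x, (N <= x)%N /\ (ratr p < theta x 0%N w < ratr q)}.
  have [pq|] := boolP (0 <= (ratr p : R) < ratr q); last by move=> _; apply: aeW.
  have mS : measurable [set v : R | ratr p < v < ratr q].
    apply: measurable_pred; apply: measurable_and; exact: measurable_fun_ltr.
  have S0 : (0 < exponential_prob (1:R) [set v : R | ratr p < v < ratr q]%R)%E.
    rewrite -(driving_law (inl (0%N, 0%N)) mS).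
    exact: (exponential_itv_gt0 (Q := law (inl (0%N, 0%N))) (driving_law _) pq).
  have H := infinitely_often mD iD driving_law (k := fun x => inl (x, 0%N)) _ mS S0.
  have {}H : {ae P, forall w N, exists n, (N <= n)%N /\
      [set v : R | ratr p < v < ratr q] (D (inl (n, 0%N)) w)}.
    by apply: H => i j [].
  by apply: filterS H => w H _.
have {}H : {ae P, forall w, forall p q : rat, (0 <= (ratr p : R) < ratr q) ->
    forall N, exists x, (N <= x)%N /\ (ratr p < theta x 0%N w < ratr q)}.
  by apply: ae_forall_countType => p; apply: ae_forall_countType => q; exact: H.
apply: filterS H => w H a b /andP[a0 ab] N.
have [p] := rat_in_itvoo ab; rewrite in_itv/= => /andP[ap pb].
have [q] := rat_in_itvoo pb; rewrite in_itv/= => /andP[pq qb].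
have [x [Nx /andP[px xq]]] : exists x, (N <= x)%N /\ (ratr p < theta x 0%N w < ratr q).
  by apply: H; rewrite pq (le_trans a0 (ltW ap)).
by exists x; split => //; rewrite (lt_trans ap px) (lt_trans xq qb).
Qed.

End drivers.

(** * Removing one site from the clock *)

Lemma nneseries_EFin_cvg (R : realType) (a : nat -> R) :
  (forall n, 0 <= a n) -> (\sum_(n <oo) (a n)%:E < +oo)%E ->
  \sum_(0 <= n < m) a n @[m --> \oo] --> fine (\sum_(n <oo) (a n)%:E)%E.
Proof.
move=> a0 afin; set S := (\sum_(n <oo) _)%E.
have fs : S \is a fin_num.
  by rewrite ge0_fin_numE// nneseries_ge0// => n _ _; rewrite lee_fin.
have /fine_cvg : (\sum_(0 <= n < m) (a n)%:E)%E @[m --> \oo] --> (fine S)%:E.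
  by rewrite fineK//; apply: is_cvg_nneseries => n _ _; rewrite lee_fin.
by under [X in X @ _ --> _ -> _]eq_fun do rewrite /= sumEFin.
Qed.

Lemma bounded_convergence d (Omega : measurableType d) (R : realType)
    (P : probability Omega R) (f_ : nat -> Omega -> R) (f : Omega -> R) :
  (forall n, measurable_fun setT (f_ n)) -> measurable_fun setT f ->
  (forall n w, `|f_ n w| <= 1) ->
  {ae P, forall w, f_ ^~ w @ \oo --> f w} ->
  (\int[P]_w (f_ n w)%:E @[n --> \oo] --> \int[P]_w (f w)%:E)%E.
Proof.
move=> mf_ mf f1 f_f.
have [] := @dominated_convergence _ _ _ P setT measurableT
  (fun n w => (f_ n w)%:E) (fun w => (f w)%:E) (cst 1%E).
- by move=> n; exact/measurable_EFinP.
- exact/measurable_EFinP.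
- by apply: filterS f_f => w f_f _; apply: cvg_EFin => //; near=> n.
- by apply/integrableP; split => //; rewrite integral_cst//= normr1 mul1e probability_setT ltry.
- by apply: aeW => w n _; rewrite lee_fin.
- by [].
Unshelve. all: by end_near. Qed.

Lemma poisson_gf_le1 (R : realType) (z u : R) : z <= 1 -> 0 <= poisson_gf z u <= 1.
Proof.
move=> z1; rewrite expR_ge0/= -[leRHS]expR0 ler_expR oppr_le0 mulr_ge0 ?subr_ge0//.
by rewrite le_max lexx orbT.
Qed.

Lemma inv1D_le1 (R : realType) (c : R) : 0 <= c -> (1 + c)^-1 <= 1.
Proof. by move=> c0; rewrite invf_le1 ?lerDl// ltr_pwDl. Qed.

Section site_laplace.
Context d (Omega : measurableType d) (R : realType) (P : probability Omega R).
Variables (theta T : nat -> nat -> {RV P >-> R}).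
Hypothesis hD : K_drivers theta T.
Local Notation D := (driving_family (fun x i => theta x i : Omega -> R)
                                    (fun x i => T x i : Omega -> R)).
Local Notation dep := (depends_on D).
Let mD := @measurable_driving _ _ _ _ theta T.
Let iD := driving_independent hD.
Let lawD := driving_law hD.

(** The negative coefficients allowed here give exponential moments. *)
Lemma joint_laplace (s : seq (nat * nat + nat * nat)) (c : nat * nat + nat * nat -> R) :
  uniq s -> (forall k, -1 < c k) ->
  (\int[P]_w (expR (- \sum_(k <- s) c k * `|D k w|))%:E =
   (\prod_(k <- s) (1 + c k)^-1)%:E)%E.
Proof.
move=> + c1; elim: s => [_|k s IH /= /andP[ks us]].
  under eq_integral do rewrite big_nil oppr0 expR0.
  rewrite big_nil integral_cst// mul1e.
  exact: probability_setT.
under eq_integral do rewrite big_cons opprD addrC expRD.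
pose K : set (nat * nat + nat * nat) := [set j | j != k].
rewrite (indep_laplace mD iD lawD (K := K) (i0 := k)
  (V := fun w => expR (- \sum_(j <- s) c j * `|D j w|)) (c := fun=> c k))//.
- under eq_integral do rewrite mulrC EFinM.
  rewrite ge0_integralZl//.
  + by rewrite IH// big_cons.
  + apply/measurable_EFinP; apply: measurableT_comp => //.
    apply: measurableT_comp => //; apply: measurable_sum => j.
    by apply: measurable_funM => //; apply: measurableT_comp.
  + by rewrite lee_fin invr_ge0 ltW// -ltrBlDl sub0r.
- by apply/negP; rewrite negbK.
- apply: measurableT_comp => //; apply: measurableT_comp => //.
  rewrite [X in measurable_fun _ X](_ : _ = (fun w => \sum_(j <- s) (if j != k then c j * `|D j w| else 0))); last first.
    apply/funext => w; apply: eq_big_seq => j js.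
    by case: eqP => // jk; rewrite -jk js in ks.
  apply: measurable_sum => j; case: (eqVneq j k) => jk /=; first exact: measurable_cst.
  apply: measurable_funM => //; apply: measurableT_comp => //.
  by apply: depends_on_coord.
- exact: measurable_cst.
Qed.

(** The event time preceding the m-th one, with time 0 before the first event. *)
Definition event_before x m (w : Omega) : R := if m is j.+1 then theta x j w else 0.

(** e^{- c S} where S is the sum of the first [m] variables [T x j] whose event
    occurs before time [Y]. *)
Definition damping (c : R) x (Y : Omega -> R) m w :=
  expR (- (c * \sum_(0 <= j < m) (if theta x j w < Y w then `|T x j w| else 0))).

Lemma dep_damping K c x Y m : dep K Y ->
  (forall j, (j < m)%N -> K (inl (x, j)) /\ K (inr (x, j))) ->
  dep K (damping c x Y m).
Proof.
move=> KY Kx; apply: measurableT_comp => //; apply: measurableT_comp => //.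
apply: measurable_funM => //.
rewrite [X in measurable_fun _ X](_ : _ = (fun w =>
    \sum_(j < m) (if theta x j w < Y w then `|T x j w| else 0))); last first.
  by apply/funext => w; rewrite big_mkord.
apply: measurable_sum => j; have [Kl Kr] := Kx j (ltn_ord j).
apply: measurable_fun_ifT.
- apply: measurable_fun_ltr => //; apply: dep_clock => i ij.
  by have [] := Kx i (leq_ltn_trans ij (ltn_ord j)).
- by apply: measurableT_comp => //; exact: dep_jump.
- exact: measurable_cst.
Qed.

Lemma dep_event_before K x m : (forall j, (j < m)%N -> K (inl (x, j))) ->
  dep K (event_before x m).
Proof.
case: m => [|m] Kx; first exact: measurable_cst.
by apply: dep_clock => j jm; apply: Kx.
Qed.

Section one_site.
Variables (K : set (nat * nat + nat * nat)) (x : nat) (c : R) (V Y : Omega -> R).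
Hypotheses (Kx : forall i, ~ K (inl (x, i)) /\ ~ K (inr (x, i))).
Hypotheses (KV : dep K V) (KY : dep K Y) (c0 : 0 <= c).
Hypothesis V01 : forall w, 0 <= V w <= 1.
Let z := (1 + c)^-1.
Let z0 : 0 <= z. Proof. by rewrite invr_ge0 addr_ge0. Qed.
Let V0 w : 0 <= V w. Proof. by have /andP[] := V01 w. Qed.

(** Given the first [m] events of site [x], the next event before [Y] contributes
    a factor of mean z = 1 / (1 + c) through [T x m], and the remaining ones form
    a Poisson process started afresh. Reading one more event therefore leaves the
    expectation unchanged. *)
Lemma damping_martingale m :
  (\int[P]_w (V w * damping c x Y m w *
     poisson_gf z (Y w - event_before x m w))%:E =
   \int[P]_w (V w * poisson_gf z (Y w))%:E)%E.
Proof.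
elim: m => [|m IH].
  apply: eq_integral => w _; rewrite /damping big_nil mulr0 oppr0 expR0 mulr1.
  by rewrite /event_before addr0.
rewrite -IH.
pose Kr : set (nat * nat + nat * nat) := [set k | k != inr (x, m)].
pose Kl : set (nat * nat + nat * nat) := [set k | k != inl (x, m)].
have KKr : K `<=` Kr by move=> k Kk; apply/eqP => E; have [_] := Kx m; rewrite -E.
have KKl : K `<=` Kl by move=> k Kk; apply/eqP => E; have [+ _] := Kx m; rewrite -E.
pose V' w := V w * damping c x Y m w * poisson_gf z (Y w - theta x m w).
pose c' w := if theta x m w < Y w then c else 0.
(* First integrate out the exponential T x m, then the interarrival time of the
   m-th event. *)
transitivity (\int[P]_w (V' w * expR (- (c' w * `|D (inr (x, m)) w|)))%:E)%E.
  apply: eq_integral => w _; rewrite /V' /event_before; congr EFin.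
  suff -> : damping c x Y m.+1 w =
      damping c x Y m w * expR (- (c' w * `|D (inr (x, m)) w|)) by rewrite /=; ring.
  rewrite /damping big_nat_recr//= mulrDr opprD expRD; congr (_ * expR (- _)).
  by rewrite /c'; case: (theta x m w < Y w); rewrite ?mulr0 ?mul0r.
have Kth : dep Kr (theta x m) by apply: dep_clock => j _; apply/eqP.
rewrite (indep_laplace mD iD lawD (K := Kr)).
- pose U w := Y w - event_before x m w.
  rewrite -[RHS](indep_renewal mD iD lawD (K := Kl) (i0 := inl (x, m))
    (V := fun w => V w * damping c x Y m w) (U := U))//.
  + apply: eq_integral => w _; rewrite /V' -!mulrA; congr (_ * (_ * _))%:E.
    have -> : D (inl (x, m)) w = theta x m w - event_before x m w.
      by rewrite /event_before/=; case: (m) => [|j] /=; rewrite ?subr0.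
    rewrite /U ltrD2r mulrC /c'; congr (_ * poisson_gf _ _); last by ring.
    by case: (theta x m w < Y w); rewrite ?addr0 ?invr1.
  + by apply/negP; rewrite negbK.
  + apply: measurable_funM; first exact: (depends_onS KKl).
    apply: dep_damping; first exact: (depends_onS KKl).
    by move=> j jm; split; apply/eqP => // -[jE]; rewrite jE ltnn in jm.
  + apply: measurable_funB; first exact: (depends_onS KKl).
    by apply: dep_event_before => j jm; apply/eqP => -[jE]; rewrite jE ltnn in jm.
  + by move=> w; rewrite mulr_ge0 ?expR_ge0.
- by apply/negP; rewrite negbK.
- apply: measurable_funM.
    apply: measurable_funM; first exact: (depends_onS KKr).
    apply: dep_damping; first exact: (depends_onS KKr).
    by move=> j jm; split; apply/eqP => // -[jE]; rewrite jE ltnn in jm.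
  apply: measurableT_comp; first exact: measurable_poisson_gf.
  by apply: measurable_funB => //; exact: (depends_onS KKr).
- apply: measurable_fun_ifT => //; apply: measurable_fun_ltr => //.
  exact: (depends_onS KKr).
- by move=> w; rewrite !mulr_ge0 ?expR_ge0.
- by move=> w; rewrite /c'; case: ifP => _; rewrite ?(lt_le_trans _ c0)// ltrN10.
Qed.

Lemma event_before_pos w : (forall r, exists i, r < theta x i w) ->
  (forall k, 0 < D k w) -> \forall m \near \oo, Y w <= event_before x m w.
Proof.
move=> unb D0; have [i Yi] := unb (Y w).
exists i.+1 => // m /= im; rewrite (le_trans (ltW Yi))//.
case: m im => // m; rewrite /= ltnS leq_eqVlt => /predU1P[->//|im].
by apply: ltW; apply: (clock_increasing D0).
Qed.

Lemma damping_sum_ge0 m w :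
  0 <= \sum_(0 <= j < m) (if theta x j w < Y w then `|T x j w| else 0).
Proof. by apply: sumr_ge0 => j _; case: ifP. Qed.

Lemma damping_le1 m w : 0 <= damping c x Y m w <= 1.
Proof.
by rewrite expR_ge0/= -expR0 ler_expR oppr_le0 mulr_ge0// damping_sum_ge0.
Qed.

Lemma damping_nonincreasing w : nonincreasing_seq (damping c x Y ^~ w).
Proof.
apply/nonincreasing_seqP => m; rewrite ler_expR lerN2 ler_wpM2l//.
by rewrite big_nat_recr//= lerDl; case: ifP.
Qed.

Definition full_damping w := limn (damping c x Y ^~ w).

Lemma full_damping_cvg w : damping c x Y ^~ w @ \oo --> full_damping w.
Proof.
apply: nonincreasing_is_cvgn; first exact: damping_nonincreasing.
by exists 0 => _ [m _ <-]; have /andP[] := damping_le1 m w.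
Qed.

Lemma full_damping_le1 w : 0 <= full_damping w <= 1.
Proof.
have cv := @full_damping_cvg w; apply/andP; split.
  by apply: limr_ge; [exact: cvgP cv|apply: nearW => m; have /andP[] := damping_le1 m w].
by apply: limr_le; [exact: cvgP cv|apply: nearW => m; have /andP[] := damping_le1 m w].
Qed.

Lemma dep_full_damping K' : dep K' Y ->
  (forall j, K' (inl (x, j)) /\ K' (inr (x, j))) -> dep K' full_damping.
Proof.
move=> KY' K'x; apply: measurable_fun_cvg => [m|w _]; last exact: full_damping_cvg.
by apply: dep_damping => // j _.
Qed.

(** The limit m -> oo of [damping_martingale]: the last factor there becomes 1 as
    soon as the m-th event is after [Y]. *)
Lemma full_damping_laplace :
  (\int[P]_w (V w * full_damping w)%:E =
   \int[P]_w (V w * poisson_gf z (Y w))%:E)%E.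
Proof.
have mV : measurable_fun setT V by exact: depends_on_measurable KV.
have mY : measurable_fun setT Y by exact: depends_on_measurable KY.
have mdamp m : measurable_fun setT (damping c x Y m).
  apply: (depends_on_measurable mD (K := setT)).
  by apply: dep_damping => //; exact: depends_onS KY.
pose f_ m w := V w * damping c x Y m w * poisson_gf z (Y w - event_before x m w).
have mf_ m : measurable_fun setT (f_ m).
  apply: measurable_funM; first exact: measurable_funM.
  apply: measurableT_comp; first exact: measurable_poisson_gf.
  apply: measurable_funB => //.
  by case: m => [|m]; [exact: measurable_cst|exact: measurable_funPT].
have mf : measurable_fun setT (fun w => V w * full_damping w).
  apply: measurable_funM => //.
  by apply: measurable_fun_cvg => [m|w _]; [exact: mdamp|exact: full_damping_cvg].
have gf1 u : 0 <= poisson_gf z u <= 1 by exact/poisson_gf_le1/inv1D_le1.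
have cvg_int : (\int[P]_w (f_ m w)%:E @[m --> \oo] --> \int[P]_w (V w * full_damping w)%:E)%E.
  apply: bounded_convergence => //.
  - move=> m w; rewrite ger0_norm; last first.
      by rewrite !mulr_ge0// ?expR_ge0.
    have /andP[v0 v1] := V01 w; have /andP[d0 d1] := damping_le1 m w.
    have /andP[g0 g1] := gf1 (Y w - event_before x m w).
    by rewrite !mulr_ile1// mulr_ge0.
  - apply: filterS2 (ae_driving_gt0 hD) (ae_clock_unbounded hD) => w D0 unb.
    rewrite -[V w * _]mulr1; apply: cvgM.
      by apply: cvgM; [exact: cvg_cst|exact: full_damping_cvg].
    apply: cvg_near_cst; near=> m.
    rewrite /poisson_gf max_r ?mulr0 ?oppr0 ?expR0// subr_le0.
    by near: m; apply: event_before_pos.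
rewrite -(cvg_lim _ cvg_int)//.
under eq_fun do rewrite damping_martingale.
by apply: lim_cst.
Unshelve. all: by end_near. Qed.

End one_site.

(** Induction on the number of sites, each being integrated out while the others
    are put into the weight [V]. *)
Lemma other_sites_laplace (K : set (nat * nat + nat * nat)) x (Y : Omega -> R)
    (c : nat -> R) n :
  (forall y i, y != x -> ~ K (inl (y, i)) /\ ~ K (inr (y, i))) ->
  dep K Y -> (forall y, 0 <= c y) ->
  forall V : Omega -> R, dep K V -> (forall w, 0 <= V w <= 1) ->
  (\int[P]_w (V w * \prod_(0 <= y < n | y != x) full_damping y (c y) Y w)%:E =
   \int[P]_w (V w * \prod_(0 <= y < n | y != x) poisson_gf (1 + c y)^-1 (Y w))%:E)%E.
Proof.
move=> Kx KY c0; elim: n => [|n IH] V KV V01.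
  by apply: eq_integral => w _; rewrite !big_nil.
have cut (F : nat -> R) : \prod_(0 <= y < n.+1 | y != x) F y =
    \prod_(0 <= y < n | y != x) F y * (if n != x then F n else 1).
  by rewrite big_mkcond big_nat_recr//= -big_mkcond.
under eq_integral do rewrite cut.
under [RHS]eq_integral do rewrite cut.
have [nx|nx] /= := eqVneq n x.
  under eq_integral do rewrite mulr1.
  by under [RHS]eq_integral do rewrite mulr1; exact: IH.
pose Kn : set (nat * nat + nat * nat) :=
  K `|` [set k | exists y i, [/\ (y < n)%N & k = inl (y, i) \/ k = inr (y, i)]].
pose V' w := V w * \prod_(0 <= y < n | y != x) full_damping y (c y) Y w.
have gf1 y u : 0 <= poisson_gf (1 + c y)^-1 u <= 1.
  exact/poisson_gf_le1/inv1D_le1.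
have prod1 w : 0 <= \prod_(0 <= y < n | y != x) full_damping y (c y) Y w <= 1.
  elim/big_ind : _ => [|a b /andP[a0 a1] /andP[b0 b1]|y _]; first by rewrite ler01 lexx.
    by rewrite mulr_ge0 ?mulr_ile1.
  exact: full_damping_le1.
transitivity (\int[P]_w (V' w * full_damping n (c n) Y w)%:E)%E.
  by apply: eq_integral => w _; rewrite /V' mulrA.
rewrite (full_damping_laplace (K := Kn))//.
- transitivity (\int[P]_w ((V w * poisson_gf (1 + c n)^-1 (Y w)) *
     \prod_(0 <= y < n | y != x) full_damping y (c y) Y w)%:E)%E.
    by apply: eq_integral => w _; rewrite /V' mulrAC.
  rewrite IH.
  + by apply: eq_integral => w _; rewrite -mulrA [_ * poisson_gf _ _]mulrC.
  + apply: measurable_funM => //; apply: measurableT_comp => //.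
    exact: measurable_poisson_gf.
  + move=> w; have /andP[v0 v1] := V01 w; have /andP[g0 g1] := gf1 n (Y w).
    by rewrite mulr_ge0 ?mulr_ile1.
- by move=> i; have [K1 K2] := Kx n i nx; split => -[//|[y [j [yn [E|E]]]]];
    case: E => // yE _; rewrite yE ltnn in yn.
- apply: measurable_funM; first by apply: depends_onS KV; left.
  rewrite [X in measurable_fun _ X](_ : _ = fun w =>
      \prod_(y < n) (if (y : nat) != x then full_damping y (c y) Y w else 1)); last first.
    by apply/funext => w; rewrite big_mkcond big_mkord.
  apply: measurable_prod => y _; case: (eqVneq (y : nat) x) => yx /=.
    exact: measurable_cst.
  apply: dep_full_damping => //; first by apply: depends_onS KY; left.
  by move=> j; split; right; exists (y : nat), j; split => //; [left|right].
- by apply: depends_onS KY; left.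
- move=> w; have /andP[v0 v1] := V01 w; have /andP[g0 g1] := prod1 w.
  by rewrite mulr_ge0 ?mulr_ile1.
Qed.

End site_laplace.

(** * Laplace transform of the clock before an event *)

Definition jumps_before (R : realType) (f : nat -> R) (th T : nat -> nat -> R)
    (r : R) (y : nat) : \bar R :=
  (\sum_(j <oo) (if th y j < r then f y * `|T y j| else 0)%:E)%E.

(** The left limit at [r] of the clock of the K-process. It is defined through
    series and with absolute values so as to be nonnegative and measurable for
    all realizations. *)
Definition pre_clock (R : realType) (f : nat -> R) (th T : nat -> nat -> R)
    (r : R) : \bar R :=
  (\sum_(y <oo) jumps_before f th T r y)%E.

Section pre_clock_law.
Context d (Omega : measurableType d) (R : realType) (P : probability Omega R).
Variables (theta T : nat -> nat -> {RV P >-> R}).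
Hypothesis hD : K_drivers theta T.
Local Notation D := (driving_family (fun x i => theta x i : Omega -> R)
                                    (fun x i => T x i : Omega -> R)).
Local Notation dep := (depends_on D).
Let mD := @measurable_driving _ _ _ _ theta T.
Let iD := driving_independent hD.
Let lawD := driving_law hD.
Variable f : nat -> R.
Hypothesis f0 : forall x, 0 < f x.

Local Notation path X w := (fun x i => X x i w).

Lemma jumps_before_ge0 th T' r y : (0 <= jumps_before f th T' r y)%E.
Proof.
apply: nneseries_ge0 => j _ _; rewrite lee_fin; case: ifP => // _.
by rewrite mulr_ge0// ltW.
Qed.

Lemma pre_clock_ge0 th T' r : (0 <= pre_clock f th T' r)%E.
Proof. by apply: nneseries_ge0 => y _ _; exact: jumps_before_ge0. Qed.

Lemma pre_clock_le th T' r r' : r <= r' -> (pre_clock f th T' r <= pre_clock f th T' r')%E.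
Proof.
move=> rr'; apply: lee_nneseries => [y _ _|y _]; first exact: jumps_before_ge0.
apply: lee_nneseries => [j _ _|j _]; rewrite lee_fin.
  by case: ifP => // _; rewrite mulr_ge0// ltW.
case: ifPn => [jr|_]; first by rewrite (lt_le_trans jr).
by case: ifP => // _; rewrite mulr_ge0// ltW.
Qed.

(** The jump at the event [theta x i] is not counted strictly before that event,
    so that [T x i] does not enter. *)
Lemma dep_pre_clock (K : set (nat * nat + nat * nat)) x i (Y : Omega -> R) :
  (forall k, k != inr (x, i) -> K k) -> dep K Y ->
  (forall w, ~~ (theta x i w < Y w)) ->
  dep K (fun w => pre_clock f (path theta w) (path T w) (Y w)).
Proof.
move=> KK KY Yle.
apply: ge0_emeasurable_sum => [y w _ _|y _]; first exact: jumps_before_ge0.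
apply: ge0_emeasurable_sum => [j w _ _|j _].
  by rewrite lee_fin; case: ifP => // _; rewrite mulr_ge0// ltW.
apply/measurable_EFinP.
have [[-> ->]|yj] := eqVneq (y, j) (x, i).
  rewrite (_ : (fun w => _) = cst 0); first exact: measurable_cst.
  by apply/funext => w; rewrite (negbTE (Yle w)).
apply: measurable_fun_ifT.
- by apply: measurable_fun_ltr => //; apply: dep_clock => k _; apply: KK.
- apply: measurable_funM; first exact: measurable_cst.
  apply: measurableT_comp => //; apply: dep_jump; apply: KK.
  by apply: contra yj => /eqP[-> ->].
- exact: measurable_cst.
Qed.

(** If theta_j < r then 1 <= e^{r - theta_j}, while T <= 2 e^{T / 2}; the
    expectation of e^{- theta_j + T / 2} is 2^{- (j + 1)} * 2. *)
Lemma expected_jump y j (r : R) :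
  (\int[P]_w (if theta y j w < r then f y * `|T y j w| else 0)%:E <=
   (f y * expR r * 4 / (2 ^ j.+1)%:R)%:E)%E.
Proof.
pose s : seq (nat * nat + nat * nat) :=
  inr (y, j) :: [seq inl (y, k) | k <- iota 0 j.+1].
pose c (k : nat * nat + nat * nat) : R := if k is inl _ then 1 else - 2^-1.
have us : uniq s.
  rewrite cons_uniq map_inj_uniq ?iota_uniq ?andbT; last by move=> a b [].
  by apply/mapP => -[].
have c1 k : - 1 < c k by case: k => _ /=; lra.
have E := joint_laplace hD us c1.
apply: (@le_trans _ _ ((f y * expR r * 2)%:E *
    \int[P]_w (expR (- \sum_(k <- s) c k * `|D k w|))%:E)%E).
  rewrite -ge0_integralZl//; last 2 first.
  - apply/measurable_EFinP; apply: measurableT_comp => //.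
    apply: measurableT_comp => //; apply: measurable_sum => k.
    by apply: measurable_funM => //; apply: measurableT_comp.
  - by rewrite lee_fin !mulr_ge0// ?expR_ge0// ltW.
  apply: ae_ge0_le_integral => //.
  - by move=> w _; rewrite lee_fin; case: ifP => // _; rewrite mulr_ge0// ltW.
  - apply/measurable_EFinP; apply: measurable_fun_ifT => //.
    + exact: measurable_fun_ltr.
    + by apply: measurable_funM => //; apply: measurableT_comp.
  - by move=> w _; rewrite -EFinM lee_fin !mulr_ge0// ?expR_ge0// ltW.
  - apply: emeasurable_funM => //; apply/measurable_EFinP.
    apply: measurableT_comp => //.
    apply: measurableT_comp => //; apply: measurable_sum => k.
    by apply: measurable_funM => //; apply: measurableT_comp.
  apply: filterS (ae_driving_gt0 hD) => w D0 _; rewrite -EFinM lee_fin.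
  have -> : \sum_(k <- s) c k * `|D k w| = theta y j w - 2^-1 * `|T y j w|.
    rewrite big_cons addrC [c (inr _)]/= mulNr; congr (_ - _).
    rewrite big_map (clock_sum theta T y j w) -[iota 0 j.+1]/(index_iota 0 j.+1) big_mkord.
    by apply: eq_bigr => k _; rewrite mul1r ger0_norm// ltW// D0.
  case: ifPn => [tr|_]; last by rewrite !mulr_ge0// ?expR_ge0// ltW.
  rewrite -!mulrA ler_pM2l// opprB expRD.
  have T1 : `|T y j w| <= 2 * expR (2^-1 * `|T y j w|).
    by have := expR_ge1Dx (2^-1 * `|T y j w|); lra.
  rewrite (le_trans T1)// mulrCA ler_pM2l// mulrCA ler_peMr ?expR_ge0//.
  by rewrite -expRD -[leLHS]expR0 ler_expR subr_ge0 ltW.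
rewrite E -EFinM lee_fin big_cons big_map -[iota 0 j.+1]/(index_iota 0 j.+1).
rewrite big_mkord /c.
have -> : (1 - 2^-1)^-1 = 2 :> R by field.
rewrite prodr_const card_ord.
rewrite natrX -exprVn -!mulrA.
by rewrite (_ : 2 * (2 * _) = 4 * (2^-1 ^+ j.+1)) //; ring.
Qed.

(** The expected clock at time n is at most 4 e^n times the sum of [f]. *)
Lemma ae_pre_clock_finite : (\sum_(x <oo) (f x)%:E < +oo)%E ->
  {ae P, forall w, forall r, (pre_clock f (path theta w) (path T w) r < +oo)%E}.
Proof.
move=> sf.
have H (n : nat) : {ae P, forall w, (pre_clock f (path theta w) (path T w) n%:R < +oo)%E}.
  have mj y j : measurable_fun setT (fun w =>
      (if theta y j w < n%:R then f y * `|T y j w| else 0)%:E).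
    apply/measurable_EFinP; apply: measurable_fun_ifT => //.
    + exact: measurable_fun_ltr.
    + by apply: measurable_funM => //; apply: measurableT_comp.
  have j0 y j w : (0 <= (if theta y j w < n%:R then f y * `|T y j w| else 0)%:E)%E.
    by rewrite lee_fin; case: ifP => // _; rewrite mulr_ge0// ltW.
  have ip : P.-integrable setT (fun w => pre_clock f (path theta w) (path T w) n%:R).
    apply/integrableP; split.
      apply: ge0_emeasurable_sum => [y w _ _|y _]; first exact: jumps_before_ge0.
      exact: ge0_emeasurable_sum.
    under eq_integral do rewrite gee0_abs ?pre_clock_ge0//.
    rewrite integral_nneseries//; last 2 first.
    - by move=> y; exact: ge0_emeasurable_sum.
    - by move=> y w _; exact: jumps_before_ge0.
    apply: (@le_lt_trans _ _ (\sum_(y <oo) ((expR n%:R * 4)%:E * (f y)%:E))%E).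
      apply: lee_nneseries => [y _ _|y _].
        by apply: integral_ge0 => w _; exact: jumps_before_ge0.
      rewrite integral_nneseries//.
      apply: (@le_trans _ _ (\sum_(j <oo) ((f y * expR n%:R * 4) / (2 ^ j.+1)%:R)%:E)%E).
        apply: lee_nneseries => [j _ _|j _]; first by apply: integral_ge0 => w _.
        exact: expected_jump.
      rewrite -EFinM.
      have -> : expR n%:R * 4 * f y = f y * expR n%:R * 4 by ring.
      by apply: epsilon_trick0; rewrite !mulr_ge0// ?expR_ge0// ltW.
    rewrite nneseriesZl; last by move=> y _; rewrite lee_fin ltW.
    by rewrite lte_mul_pinfty// lee_fin mulr_ge0// expR_ge0.
  apply: filterS (integrable_ae measurableT ip) => w /(_ I).
  by rewrite ge0_fin_numE// pre_clock_ge0.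
have {}H := ae_foralln H.
apply: filterS H => w H r; apply: le_lt_trans (H (Num.bound `|r|)).
by apply: pre_clock_le; rewrite (le_trans (ler_norm r))// ltW// archi_boundP.
Qed.

Lemma full_damping_jumps lam y (Y : Omega -> R) w : 0 <= lam ->
  (jumps_before f (path theta w) (path T w) (Y w) y < +oo)%E ->
  full_damping theta T y (lam * f y) Y w =
  expR (- (lam * fine (jumps_before f (path theta w) (path T w) (Y w) y))).
Proof.
move=> lam0 Sfin.
pose a j := if theta y j w < Y w then f y * `|T y j w| else 0.
have a0 j : 0 <= a j by rewrite /a; case: ifP => // _; rewrite mulr_ge0// ltW.
have cva := nneseries_EFin_cvg a0 Sfin.
apply: cvg_lim => //.
have -> : damping theta T (lam * f y) y Y ^~ w =
    (fun m => expR (- (lam * \sum_(0 <= j < m) a j))).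
  apply/funext => m; rewrite /damping -mulrA; congr (expR (- (_ * _))).
  rewrite mulr_sumr; apply: eq_bigr => j _; rewrite /a.
  by case: ifP; rewrite ?mulr0.
apply: continuous_cvg; first exact: continuous_expR.
by apply: cvgN; apply: cvgM => //; exact: cvg_cst.
Qed.

Lemma jumps_before_own x i w : (forall k, 0 < D k w) ->
  jumps_before f (path theta w) (path T w) (theta x i w) x =
  (\sum_(0 <= j < i) f x * `|T x j w|)%:E.
Proof.
move=> D0; rewrite /jumps_before.
have lt_clock j : (theta x j w < theta x i w) = (j < i)%N.
  apply/idP/idP; last exact: (clock_increasing D0).
  apply: contraTT; rewrite -leqNgt -leNgt leq_eqVlt => /predU1P[->//|ij].
  by apply: ltW; exact: (clock_increasing D0).
apply/cvg_lim => //; apply: cvg_near_cst; exists i => // m /= im.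
rewrite sumEFin; congr EFin.
rewrite (big_cat_nat (leq0n i) im)/=.
rewrite [X in _ + X](_ : _ = 0) ?addr0.
  by rewrite !big_nat; apply: eq_bigr => j /andP[_ ji]; rewrite lt_clock ji.
rewrite big_nat big1// => j /andP[ij _].
by rewrite lt_clock ltnNge ij.
Qed.

Lemma prod_poisson_gf (c : nat -> R) x n u :
  \prod_(0 <= y < n | y != x) poisson_gf (1 + c y)^-1 u =
  expR (- ((\sum_(0 <= y < n | y != x) (1 - (1 + c y)^-1)) * Num.max u 0)).
Proof.
elim: n => [|n IH]; first by rewrite !big_nil mul0r oppr0 expR0.
rewrite big_mkcond big_nat_recr//= -big_mkcond IH.
rewrite [in RHS]big_mkcond big_nat_recr//= -big_mkcond mulrDl opprD expRD.
by congr (_ * _); case: ifP => _; rewrite ?mul0r ?oppr0 ?expR0.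
Qed.

(** Before the i-th event of site x, the jumps of x itself give the factors
    1 / (1 + lam f x). Given theta x i, the other sites give e^{- C theta x i},
    where C sums their exponents; theta x i being a sum of i + 1 exponential
    variables, this has expectation (1 + C)^{- (i + 1)}. *)
Lemma pre_clock_laplace x i lam C : 0 <= lam ->
  (\sum_(y <oo) (f y)%:E < +oo)%E ->
  \sum_(0 <= y < n | y != x) (1 - (1 + lam * f y)^-1) @[n --> \oo] --> C ->
  (\int[P]_w (expR (- (lam *
       fine (pre_clock f (path theta w) (path T w) (theta x i w)))))%:E =
   ((1 + lam * f x)^-1 ^+ i * (1 + C)^-1 ^+ i.+1)%:E)%E.
Proof.
move=> lam0 sf cvC.
pose c y := lam * f y.
have c0 y : 0 <= c y by rewrite mulr_ge0// ltW.
pose Y : Omega -> R := theta x i.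
pose V w := expR (- (c x * \sum_(0 <= j < i) `|T x j w|)).
pose C_ n := \sum_(0 <= y < n | y != x) (1 - (1 + c y)^-1).
have C0 n : 0 <= C_ n.
  by apply: sumr_ge0 => y _; rewrite subr_ge0 inv1D_le1.
pose K : set (nat * nat + nat * nat) := [set k | exists j, k = inl (x, j) \/ k = inr (x, j)].
have KY : dep K Y by apply: dep_clock => j _; exists j; left.
have KV : dep K V.
  apply: measurableT_comp => //; apply: measurableT_comp => //.
  apply: measurable_funM; first exact: measurable_cst.
  rewrite [X in measurable_fun _ X](_ : _ = fun w => \sum_(j < i) `|T x j w|); last first.
    by apply/funext => w; rewrite big_mkord.
  apply: measurable_sum => j; apply: measurableT_comp => //.
  by apply: dep_jump; exists (j : nat); right.
have V01 w : 0 <= V w <= 1.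
  rewrite expR_ge0/= -[leRHS]expR0 ler_expR oppr_le0 mulr_ge0//.
  by apply: sumr_ge0.
have K_other y j : y != x -> ~ K (inl (y, j)) /\ ~ K (inr (y, j)).
  by move=> yx; split => -[k [|]] // [yE _]; rewrite yE eqxx in yx.
pose g n w := V w * \prod_(0 <= y < n | y != x) full_damping theta T y (c y) Y w.
have g01 n w : `|g n w| <= 1.
  have /andP[p0 p1] : 0 <= \prod_(0 <= y < n | y != x) full_damping theta T y (c y) Y w <= 1.
    elim/big_ind : _ => [|a b /andP[a0 a1] /andP[b0 b1]|y _]; first by rewrite ler01 lexx.
      by rewrite mulr_ge0 ?mulr_ile1.
    exact: full_damping_le1.
  by have /andP[v0 v1] := V01 w; rewrite ger0_norm ?mulr_ge0 ?mulr_ile1.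
have mpre : measurable_fun setT (fun w =>
    fine (pre_clock f (path theta w) (path T w) (theta x i w))).
  apply: measurableT_comp => //; apply: (depends_on_measurable mD (K := setT)).
  apply: (dep_pre_clock (x := x) (i := i)) => //.
    by apply: dep_clock.
  by move=> w; rewrite ltxx.
have lim1 : (\int[P]_w (g n w)%:E @[n --> \oo] --> \int[P]_w (expR (- (lam *
       fine (pre_clock f (path theta w) (path T w) (theta x i w)))))%:E)%E.
  apply: bounded_convergence => //.
  - move=> n; apply: (depends_on_measurable mD (K := setT)).
    apply: measurable_funM; first by apply: depends_onS KV.
    rewrite [X in measurable_fun _ X](_ : _ = fun w =>
      \prod_(y < n) (if (y : nat) != x then full_damping theta T y (c y) Y w else 1)); last first.
      by apply/funext => w; rewrite big_mkcond big_mkord.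
    apply: measurable_prod => y _; case: (eqVneq (y : nat) x) => yx /=.
      exact: measurable_cst.
    by apply: dep_full_damping => //; apply: depends_onS KY.
  - by apply: measurableT_comp => //; apply: measurableT_comp => //; exact: measurable_funM.
  apply: filterS2 (ae_driving_gt0 hD) (ae_pre_clock_finite sf) => w D0 /(_ (Y w)) fin.
  pose S y := jumps_before f (path theta w) (path T w) (Y w) y.
  have Sfin y : (S y < +oo)%E.
    apply: le_lt_trans fin; rewrite /pre_clock.
    apply: le_trans (@nneseries_lim_ge _ _ xpredT 0%N y.+1 _); last first.
      by move=> ? _ _; exact: jumps_before_ge0.
    rewrite big_nat_recr//= leeDr// sume_ge0// => ? _; exact: jumps_before_ge0.
  have SE y : S y = (fine (S y))%:E by rewrite fineK// ge0_fin_numE// jumps_before_ge0.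
  have cvS : \sum_(0 <= y < n) fine (S y) @[n --> \oo] -->
      fine (pre_clock f (path theta w) (path T w) (Y w)).
    rewrite /pre_clock; under eq_eseriesr do rewrite -/(S _) SE.
    apply: nneseries_EFin_cvg.
      by move=> y; rewrite fine_ge0// jumps_before_ge0.
    by under eq_eseriesr do rewrite -SE.
  have : expR (- (lam * \sum_(0 <= y < n) fine (S y))) @[n --> \oo] -->
      expR (- (lam * fine (pre_clock f (path theta w) (path T w) (Y w)))).
    apply: continuous_cvg; first exact: continuous_expR.
    by apply: cvgN; apply: cvgM => //; exact: cvg_cst.
  apply: cvg_trans; apply: near_eq_cvg; exists x.+1 => // n /= xn.
  (* For n > x the partial sum of the clock splits into the jumps of x, which are
     collected in V, and those of the other sites. *)
  rewrite /g (bigD1_seq x) ?mem_index_iota ?iota_uniq//= mulrDr opprD expRD.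
  congr (_ * _).
    rewrite /S jumps_before_own//= /V /c -mulrA; congr (expR (- (_ * _))).
    by rewrite mulr_sumr.
  rewrite mulr_sumr -sumrN.
  rewrite (@big_morph _ _ (@expR R) 1 *%R 0 +%R) ?expR0//; last exact: expRD.
  apply: eq_bigr => y yx.
  by rewrite full_damping_jumps.
have intg n : (\int[P]_w (g n w)%:E = ((1 + lam * f x)^-1 ^+ i * (1 + C_ n)^-1 ^+ i.+1)%:E)%E.
  rewrite (other_sites_laplace hD n K_other KY c0 KV V01).
  pose s : seq (nat * nat + nat * nat) :=
    [seq inr (x, j) | j <- iota 0 i] ++ [seq inl (x, j) | j <- iota 0 i.+1].
  pose c' (k : nat * nat + nat * nat) : R := if k is inl _ then C_ n else c x.
  have us : uniq s.
    rewrite cat_uniq !map_inj_uniq ?iota_uniq ?andbT ?andTb; [|by move=> a b []..].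
    by apply/hasPn => _ /mapP[j _ ->]; apply/mapP => -[].
  have c1 k : - 1 < c' k by case: k => _ /=; rewrite (lt_le_trans (ltrN10 _)).
  transitivity (\int[P]_w (expR (- \sum_(k <- s) c' k * `|D k w|))%:E)%E.
    have mC : measurable_fun setT (fun w => expR (- \sum_(k <- s) c' k * `|D k w|)).
      apply: measurableT_comp => //; apply: measurableT_comp => //.
      apply: measurable_sum => k.
      by apply: measurable_funM => //; apply: measurableT_comp.
    have mV : measurable_fun setT V by exact: depends_on_measurable KV.
    apply: ge0_ae_eq_integral => //.
    - apply/measurable_EFinP; apply: measurable_funM => //.
      under eq_fun do rewrite prod_poisson_gf.
      apply: measurableT_comp => //; apply: measurableT_comp => //.
      by apply: measurable_funM => //; exact: measurable_maxr.
    - exact/measurable_EFinP.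
    - move=> w _; rewrite lee_fin mulr_ge0//; first by have /andP[] := V01 w.
      by rewrite prod_poisson_gf expR_ge0.
    apply: filterS (ae_driving_gt0 hD) => w D0 _; congr EFin.
    have E1 : \sum_(j <- iota 0 i) c' (inr (x, j)) * `|D (inr (x, j)) w| =
        c x * \sum_(0 <= j < i) `|T x j w|.
      by rewrite mulr_sumr /index_iota subn0.
    have E2 : \sum_(j <- iota 0 i.+1) c' (inl (x, j)) * `|D (inl (x, j)) w| =
        C_ n * Num.max (Y w) 0.
      rewrite max_l; last by apply: ltW; exact: (clock_gt0 D0).
      rewrite /Y (clock_sum theta T x i w) -[iota 0 i.+1]/(index_iota 0 i.+1).
      rewrite big_mkord mulr_sumr.
      by apply: eq_bigr => k _; rewrite ger0_norm// ltW// D0.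
    by rewrite prod_poisson_gf /V -expRD -opprD big_cat !big_map E1 E2.
  rewrite (joint_laplace hD us c1) big_cat !big_map; congr (_ * _)%:E.
    have -> : iota 0 i = index_iota 0 i by rewrite /index_iota subn0.
    by have := prodr_const_nat 0 i (1 + c x)^-1; rewrite subn0.
  by have := prodr_const_nat 0 i.+1 (1 + C_ n)^-1; rewrite subn0.
have lim2 : (\int[P]_w (g n w)%:E @[n --> \oo] -->
    ((1 + lam * f x)^-1 ^+ i * (1 + C)^-1 ^+ i.+1)%:E)%E.
  under eq_fun do rewrite intg.
  apply: cvg_EFin; first by near=> n.
  apply: cvgM; first exact: cvg_cst.
  have Cge0 : 0 <= C.
    rewrite -(cvg_lim _ cvC)//; apply: limr_ge; first exact: cvgP cvC.
    by apply: nearW => n; exact: C0.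
  apply: (@cvg_comp _ _ _ (fun n => (1 + C_ n)^-1) (fun v : R => v ^+ i.+1) _ _ _ _
    (@exprn_continuous R i.+1 _)).
  apply: cvgV; first by rewrite gt_eqF// ltr_pwDl.
  by apply: cvgD => //; exact: cvg_cst.
by rewrite -(cvg_lim _ lim1)// -(cvg_lim _ lim2).
Unshelve. all: by end_near. Qed.

End pre_clock_law.

(** * Paths of the K-process *)

Section good_path.
Context (R : realType) (f : nat -> R) (th T : nat -> nat -> R).
Hypothesis f0 : forall x, 0 < f x.
Hypothesis th0 : forall x i, 0 < th x i.
Hypothesis T0 : forall x i, 0 < T x i.
Hypothesis th_incr : forall x i j, (i < j)%N -> th x i < th x j.
Hypothesis th_site : forall x i y j, th x i = th y j -> x = y.
Hypothesis th_unbounded : forall x r, exists i, r < th x i.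
Hypothesis T_gt1 : forall N, exists n, (N <= n)%N /\ 1 < T 0%N n.
Hypothesis th_dense : forall a b, 0 <= a < b ->
  forall N, exists x, (N <= x)%N /\ a < th x 0%N < b.
Hypothesis pre_fin : forall r, (pre_clock f th T r < +oo)%E.

Local Notation weight k := (f k.1 * T k.1 k.2).
Local Notation pre := (pre_clock f th T).
Local Notation clock := (K_clock f th T).

Let weight_gt0 (k : nat * nat) : 0 < weight k. Proof. by rewrite mulr_gt0. Qed.
Let weight_ge0 (k : nat * nat) : (0 <= (weight k)%:E)%E.
Proof. by rewrite lee_fin ltW. Qed.

Let th_inj (k k' : nat * nat) : th k.1 k.2 = th k'.1 k'.2 -> k = k'.
Proof.
case: k k' => [x i] [y j] /= E; have xy := th_site E; rewrite -{}xy in E *.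
by case: (ltngtP i j) => [ij|ij|->//]; have := th_incr x ij; rewrite E ltxx.
Qed.

Lemma pre_clockE r :
  pre r = (\esum_(k in [set k : nat * nat | (th k.1 k.2 < r)%R]) (weight k)%:E)%E.
Proof.
rewrite [RHS]esum_mkcond /pre_clock nneseries_esumT; last first.
  by move=> y; exact: jumps_before_ge0.
under eq_esum => y _.
  rewrite /jumps_before nneseries_esumT; last first.
    by move=> j; rewrite lee_fin; case: ifP => // _; rewrite mulr_ge0// ltW.
  over.
rewrite esum_esum; last first.
  by move=> y j _ _; rewrite lee_fin; case: ifP => // _; rewrite mulr_ge0// ltW.
rewrite (_ : setT `*`` _ = setT); last by apply/seteqP; split => -[].
apply: eq_esum => -[y j] _ /=; rewrite gtr0_norm//.
by case: ifPn => yj; [rewrite mem_set|rewrite memNset//; exact/negP].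
Qed.

Lemma clockE r :
  clock r = (\esum_(k in [set k : nat * nat | (th k.1 k.2 <= r)%R]) (weight k)%:E)%E.
Proof.
rewrite /K_clock (_ : [set k : nat * nat | (0 <= th k.1 k.2 <= r)%R] =
  [set k : nat * nat | (th k.1 k.2 <= r)%R])//.
by apply/seteqP; split => k /= => [/andP[]//|->]; rewrite ltW.
Qed.

Lemma esum_sub (A B : set (nat * nat)) : A `<=` B ->
  (\esum_(k in A) (weight k)%:E <= \esum_(k in B) (weight k)%:E)%E.
Proof.
move=> AB; apply: ge_ereal_sup => _ [F [finF FA] <-].
by apply: ereal_sup_ubound; exists F => //; split => //; exact: subset_trans AB.
Qed.

Lemma clock_le r r' : r <= r' -> (clock r <= clock r')%E.
Proof.
by move=> rr'; rewrite !clockE; apply: esum_sub => k /= /le_trans; exact.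
Qed.

Lemma clock_le_pre r r' : r < r' -> (clock r <= pre r')%E.
Proof.
by move=> rr'; rewrite clockE pre_clockE; apply: esum_sub => k /= /le_lt_trans; exact.
Qed.

Lemma pre_le_clock r : (pre r <= clock r)%E.
Proof. by rewrite clockE pre_clockE; apply: esum_sub => k /= /ltW. Qed.

Lemma clock_fin r : clock r \is a fin_num.
Proof.
rewrite ge0_fin_numE; last by rewrite clockE; apply: esum_ge0.
have rr : r < r + 1 by rewrite ltrDl.
exact: le_lt_trans (clock_le_pre rr) (pre_fin _).
Qed.

Lemma pre_fin_num r : pre r \is a fin_num.
Proof. by rewrite ge0_fin_numE// pre_clock_ge0. Qed.

Lemma clock_event k : clock (th k.1 k.2) = (pre (th k.1 k.2) + (weight k)%:E)%E.
Proof.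
rewrite clockE pre_clockE (esumID [set k])// addeC; congr (_ + _)%E.
  congr (esum _ _); apply/seteqP; split => j /=.
    move=> [jk nE]; rewrite lt_neqAle jk andbT.
    by apply/eqP => /th_inj.
  by move=> jk; split; [exact: ltW|move=> E; rewrite E ltxx in jk].
rewrite (_ : _ `&` _ = [set k]) ?esum_set1//.
by apply/seteqP; split => [j [_ ->//]|j ->]; split => /=.
Qed.

Lemma clock_lt_pre_event k : (pre (th k.1 k.2) < clock (th k.1 k.2))%E.
Proof.
by rewrite clock_event lteDl ?pre_fin_num// lte_fin.
Qed.

(** The jumps in (r, r + 1] have a finite sum, so that all but finitely many of
    them add up to less than the available margin; those finitely many are
    avoided by stopping before the first of them. *)
Lemma clock_right_continuous r (e : R) : (clock r < e%:E)%E ->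
  exists2 r', r < r' & (clock r' < e%:E)%E.
Proof.
move=> re.
pose A := [set k : nat * nat | (r < th k.1 k.2 <= r + 1)%R].
have split_clock r' : r <= r' -> clock r' = (clock r +
    \esum_(k in [set k : nat * nat | (r < th k.1 k.2 <= r')%R]) (weight k)%:E)%E.
  move=> rr'; rewrite !clockE (esumID [set k : nat * nat | (th k.1 k.2 <= r)%R])//.
  congr (_ + _)%E; congr (esum _ _); apply/seteqP; split => k /=.
  + by case.
  + by move=> kr; split => //; rewrite (le_trans kr).
  + by move=> [kr' /negP]; rewrite -ltNge => ->.
  + by move=> /andP[rk kr']; split => //; apply/negP; rewrite -ltNge.
pose e' := e - fine (clock r).
have e'0 : 0 < e' by rewrite subr_gt0 -lte_fin fineK// clock_fin.
pose S := (\esum_(k in A) (weight k)%:E)%E.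
have Sfin : S \is a fin_num.
  rewrite ge0_fin_numE ?esum_ge0//; apply: (@le_lt_trans _ _ (clock (r + 1))).
    by rewrite clockE; apply: esum_sub => k /= /andP[].
  by rewrite -ge0_fin_numE ?clock_fin// clockE esum_ge0.
have [_ [F [finF FA] <-] SF] := ub_ereal_sup_adherent e'0 Sfin.
have [r' [rr' r'1] r'F] : exists2 r', r < r' /\ r' <= r + 1 &
    forall k, F k -> r' < th k.1 k.2.
  have /finite_seqP[l Fl] := finF.
  have : forall k, k \in l -> r < th k.1 k.2.
    move=> k kl; have /FA : F k by rewrite Fl.
    by move=> /andP[].
  rewrite Fl; elim: l {Fl} => [_|k l IH lr].
    by exists (r + 1); rewrite ?ltrDl.
  have [|r' [rr' r'1] r'l] := IH; first by move=> j jl; apply: lr; rewrite inE jl orbT.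
  have rk : r < th k.1 k.2 by apply: lr; rewrite mem_head.
  exists (Num.min r' ((r + th k.1 k.2) / 2)).
    by rewrite lt_min rr' /= ge_min r'1; split => //; lra.
  move=> j /=; rewrite inE => /predU1P[->|jl]; rewrite gt_min.
    by apply/orP; right; lra.
  by rewrite r'l.
exists r' => //; rewrite split_clock; last exact: ltW.
rewrite -(fineK (clock_fin r)) -lteBrDl// -EFinB -/e'.
apply: (@le_lt_trans _ _ (\esum_(k in A `&` ~` F) (weight k)%:E)%E).
  apply: esum_sub => k /= /andP[rk kr']; split; first by rewrite /A/= rk (le_trans kr').
  by move=> /r'F; rewrite ltNge kr'.
have SE : S = (\sum_(k \in F) (weight k)%:E + \esum_(k in A `&` ~` F) (weight k)%:E)%E.
  rewrite /S (esumID F)// (setIidr FA) esum_fset//.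
move: SF Sfin; rewrite -[ereal_sup _]/S SE fsbig_finite//= sumEFin.
case: (\esum_(k in _) _)%E => [x| |]//= + _.
by rewrite -!EFinD !lte_fin; lra.
Qed.

Lemma pre_le_lub r (s : R) : 0 <= s ->
  (forall r', 0 <= r' < r -> (clock r' <= s%:E)%E) -> (pre r <= s%:E)%E.
Proof.
move=> s0 H; rewrite pre_clockE; have [r0|r0] := leP r 0.
  rewrite (_ : mkset _ = set0) ?esum_set0 ?lee_fin//.
  by apply/seteqP; split => // k /= kr; have := lt_le_trans (lt_trans (th0 _ _) kr) r0; rewrite ltxx.
apply: ge_ereal_sup => _ [F [finF FA] <-].
have [r' r'0 r'F] : exists2 r', 0 <= r' < r & forall k, F k -> th k.1 k.2 <= r'.
  have /finite_seqP[l Fl] := finF.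
  have : forall k, k \in l -> th k.1 k.2 < r.
    by move=> k kl; apply: FA; rewrite Fl.
  rewrite Fl; elim: l {Fl} => [_|k l IH lr].
    by exists 0; rewrite ?lexx.
  have [|r' /andP[r'0 r'r] r'l] := IH; first by move=> j jl; apply: lr; rewrite inE jl orbT.
  have kr : th k.1 k.2 < r by apply: lr; rewrite mem_head.
  exists (Num.max r' (th k.1 k.2)).
    by rewrite le_max r'0/= gt_max r'r.
  move=> j /=; rewrite inE => /predU1P[->|jl]; rewrite le_max ?lexx ?orbT//.
  by rewrite r'l.
apply: le_trans (H _ r'0); rewrite clockE; apply: esum_ge; exists F => //.
Qed.

Lemma clock_unbounded (M : R) : exists2 r, 0 <= r & (M%:E < clock r)%E.
Proof.
have H (N : nat) : exists2 r, 0 <= r & ((N%:R * f 0%N)%:E <= clock r)%E.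
  elim: N => [|N [r r0 IH]].
    by exists 0 => //; rewrite mul0r clockE esum_ge0.
  have [i ri] := th_unbounded 0%N r; have [n [iN n1]] := T_gt1 i.
  have rn : r < th 0%N n.
    rewrite (lt_le_trans ri)//; move: iN; rewrite leq_eqVlt => /predU1P[->//|iN].
    by rewrite ltW// th_incr.
  exists (th 0%N n); first exact: ltW.
  rewrite (clock_event (0%N, n)) -natr1 mulrDl mul1r EFinD leeD//.
    exact: le_trans IH (clock_le_pre rn).
  by rewrite lee_fin /= ler_peMr// ltW.
have [r r0 Hr] := H (Num.bound (`|M| / f 0%N)).
exists r => //; apply: lt_le_trans Hr; rewrite lte_fin.
rewrite (le_lt_trans (ler_norm M))// -ltr_pdivrMr// archi_boundP//.
by rewrite divr_ge0// ltW.
Qed.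

(** The inverse of the clock equals the event time throughout the interval that
    the clock jumps across there. *)
Lemma K_process_event k (t : R) : (pre (th k.1 k.2) <= t%:E)%E ->
  (t%:E < clock (th k.1 k.2))%E -> K_process f th T t = Some k.1.
Proof.
move=> pt tc; have -> : K_process f th T t = visited_site th (th k.1 k.2).
  congr (visited_site th _).
  apply/eqP; rewrite eq_le; apply/andP; split.
    apply: ge_inf; first by exists 0 => r [].
    by split => //; exact: ltW.
  apply: lb_le_inf; first by exists (th k.1 k.2); split => //; exact: ltW.
  move=> r [r0 tr]; rewrite leNgt; apply/negP => rk.
  by have := lt_le_trans tr (le_trans (clock_le_pre rk) pt); rewrite ltxx.
rewrite /visited_site; case: xgetP => [site _ [x [i [E ->]]]|H].
  by rewrite (th_site E).
by exfalso; apply: (H (Some k.1)); exists k.1, k.2.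
Qed.

(** Sites of arbitrarily large index have their first event between [r1] and [r2],
    and are visited at clock times between [s] and [e]. *)
Lemma visits_two_sites (s e r1 r2 : R) : 0 <= r1 < r2 -> (s%:E < clock r1)%E ->
  (clock r2 < e%:E)%E -> ~ no_jump_within (K_process f th T) s e.
Proof.
move=> r12 sr1 r2e nj.
have visit N : exists2 x, (N <= x)%N & exists2 u, s < u < e & K_process f th T u = Some x.
  have [x [Nx /andP[r1x xr2]]] := th_dense r12 N.
  exists x => //; exists (fine (pre (th x 0%N))).
    rewrite -!lte_fin fineK ?pre_fin_num//.
    rewrite (lt_le_trans sr1 (clock_le_pre r1x))/=.
    exact: le_lt_trans (le_trans (pre_le_clock _) (clock_le (ltW xr2))) r2e.
  apply: (@K_process_event (x, 0%N)); rewrite fineK ?pre_fin_num//.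
  exact: (clock_lt_pre_event (x, 0%N)).
have [x _ [u su Xu]] := visit 0%N.
have [y xy [v sv Xv]] := visit x.+1.
have := nj u v su sv; rewrite Xu Xv => -[E].
by rewrite E ltnn in xy.
Qed.

(** If the path is constant, let [r0] be the time at which the clock passes the
    middle of the interval. By [visits_two_sites] the clock cannot take values
    strictly between [s] and [e] on a nontrivial time interval on either side of
    [r0], hence it jumps across the whole of [s, e] at [r0]. *)
Lemma no_jump_withinP (s e : R) : 0 <= s -> s < e ->
  no_jump_within (K_process f th T) s e <->
  exists k : nat * nat, fine (pre (th k.1 k.2)) <= s /\
                        e <= fine (pre (th k.1 k.2)) + weight k.
Proof.
move=> s0 se; split; last first.
  move=> [k [ps ep]] u v /andP[su ue] /andP[sv ve].
  have H t : s < t -> t < e -> K_process f th T t = Some k.1.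
    move=> st te; apply: K_process_event.
      by rewrite -[leLHS]fineK ?pre_fin_num// lee_fin (le_trans ps)// ltW.
    rewrite clock_event -[X in (X + _)%E]fineK ?pre_fin_num// -EFinD lte_fin.
    exact: lt_le_trans ep.
  by rewrite !H.
move=> nj.
pose m := (s + e) / 2; have sm : s < m by rewrite /m; lra.
have me : m < e by rewrite /m; lra.
pose S := [set r | 0 <= r /\ (m%:E < clock r)%E].
have S0 : S !=set0 by have [r] := clock_unbounded m; exists r.
have Slb : has_lbound S by exists 0 => r [].
pose r0 := inf S.
have r0_ge0 : 0 <= r0 by apply: lb_le_inf => // r [].
have above r : r0 < r -> (m%:E < clock r)%E.
  move=> r0r; have [r' [_ mr'] r'r] : exists2 r', S r' & r' < r.
    have := inf_adherent _ (conj S0 Slb); move=> /(_ (r - r0)).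
    by rewrite subr_gt0 => /(_ r0r)[r' Sr']; rewrite -/r0 addrC subrK; exists r'.
  exact: lt_le_trans mr' (clock_le (ltW r'r)).
have below r : 0 <= r < r0 -> (clock r <= m%:E)%E.
  move=> /andP[r_ge0 rr0]; rewrite leNgt; apply/negP => mr.
  have : r0 <= r by apply: ge_inf.
  by rewrite leNgt rr0.
have pre_s : (pre r0 <= s%:E)%E.
  apply: pre_le_lub => // r /andP[r_ge0 rr0]; rewrite leNgt; apply/negP => sr.
  pose r2 := (r + r0) / 2.
  apply: (@visits_two_sites s e r r2 _ sr _ nj); first by rewrite r_ge0/= /r2; lra.
  apply: le_lt_trans (below r2 _) _; last by rewrite lte_fin.
  by rewrite /r2; lra.
have clock_e : (e%:E <= clock r0)%E.
  rewrite leNgt; apply/negP => /clock_right_continuous[r2 r02 r2e].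
  pose r1 := (r0 + r2) / 2.
  apply: (@visits_two_sites s e r1 r2 _ _ r2e nj); first by rewrite /r1; lra.
  apply: lt_trans (above r1 _); first by rewrite lte_fin.
  by rewrite /r1; lra.
(* Otherwise the clock would be continuous at r0. *)
have [k kr0] : exists k : nat * nat, th k.1 k.2 = r0.
  apply: contrapT => nk.
  have : (clock r0 <= pre r0)%E.
    rewrite clockE pre_clockE; apply: esum_sub => k /=.
    rewrite le_eqVlt => /predU1P[E|//].
    by exfalso; apply: nk; exists k.
  move=> /(le_trans clock_e)/le_trans/(_ pre_s); rewrite lee_fin.
  by rewrite leNgt se.
exists k; rewrite kr0; split.
  by rewrite -lee_fin fineK ?pre_fin_num.
by rewrite -lee_fin EFinD fineK ?pre_fin_num// -kr0 -clock_event kr0.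
Qed.

Lemma jump_across_unique (s e : R) (k k' : nat * nat) : s < e ->
  fine (pre (th k.1 k.2)) <= s /\ e <= fine (pre (th k.1 k.2)) + weight k ->
  fine (pre (th k'.1 k'.2)) <= s /\ e <= fine (pre (th k'.1 k'.2)) + weight k' ->
  k = k'.
Proof.
move=> se; wlog lt_kk' : k k' / th k.1 k.2 <= th k'.1 k'.2.
  move=> H Hk Hk'; have [kk'|k'k] := leP (th k.1 k.2) (th k'.1 k'.2); first exact: H.
  by apply/esym; apply: H => //; exact: ltW.
move=> [_ ek] [sk' _]; apply: th_inj; apply/eqP; rewrite eq_le lt_kk' /= leNgt.
apply/negP => kk'; have := clock_le_pre kk'.
rewrite clock_event -(fineK (pre_fin_num (th k.1 k.2))) -(fineK (pre_fin_num (th k'.1 k'.2))).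
by rewrite -EFinD lee_fin => /(le_trans ek)/le_trans/(_ sk'); rewrite leNgt se.
Qed.

End good_path.

(** * The probability of no jump *)

Section no_jump_law.
Context d (Omega : measurableType d) (R : realType) (P : probability Omega R).
Variables (theta T : nat -> nat -> {RV P >-> R}).
Hypothesis hD : K_drivers theta T.
Local Notation D := (driving_family (fun x i => theta x i : Omega -> R)
                                    (fun x i => T x i : Omega -> R)).
Let mD := @measurable_driving _ _ _ _ theta T.
Variable f : nat -> R.
Hypothesis f0 : forall x, 0 < f x.
Hypothesis sf : (\sum_(x <oo) (f x)%:E < +oo)%E.
Local Notation path X w := (fun x i => X x i w).

Definition pre_jump x i (w : Omega) : R :=
  fine (pre_clock f (path theta w) (path T w) (theta x i w)).

Definition jump_across (s e : R) x i : set Omega :=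
  [set w | pre_jump x i w <= s /\ e <= pre_jump x i w + f x * T x i w].

Lemma measurable_pre_jump x i : measurable_fun setT (pre_jump x i).
Proof.
apply: measurableT_comp => //; apply: (depends_on_measurable mD (K := setT)).
by apply: (dep_pre_clock f0 (x := x) (i := i)) => //;
  [exact: dep_clock|move=> w; rewrite ltxx].
Qed.

Lemma jump_across_prob s e x i : s < e ->
  (P (jump_across s e x i) =
   \int[P]_w ((pre_jump x i w <= s)%R%:R * expR (- ((e - pre_jump x i w) / f x)))%:E)%E.
Proof.
move=> se; pose K : set (nat * nat + nat * nat) := [set k | k != inr (x, i)].
apply: (indep_jump_across mD (driving_independent hD) (driving_law hD)
  (K := K) (i0 := inr (x, i))) => //.
- by apply/negP; rewrite negbK.
- apply: measurableT_comp => //.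
  apply: (dep_pre_clock f0 (x := x) (i := i)) => //; last by move=> w; rewrite ltxx.
  by apply: dep_clock => j _; apply/eqP.
Qed.

Lemma measurable_jump_across s e x i : measurable (jump_across s e x i).
Proof.
apply: measurableI; apply: measurable_pred; apply: measurable_fun_ler => //.
  exact: measurable_pre_jump.
by apply: measurable_funD; [exact: measurable_pre_jump|exact: measurable_funM].
Qed.

(** Up to a null set, the event of no jump is the disjoint union over x and i of
    the events that the jump at [theta x i] covers the interval. The outer
    measure is compared with the measure of this union from both sides. *)
Lemma no_jump_probabilityE (s t : R) : 0 <= s -> 0 < t ->
  (no_jump_probability theta T f s t =
   \sum_(x <oo) \sum_(i <oo) \int[P]_w ((pre_jump x i w <= s)%R%:R *
     expR (- ((s + t - pre_jump x i w) / f x)))%:E)%E.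
Proof.
move=> s0 t0; set e := s + t; have se : s < e by rewrite ltrDl.
pose X w := K_process f (path theta w) (path T w).
pose J := [set w | no_jump_within (X w) s e].
pose A x i := jump_across s e x i.
have mA x i : measurable (A x i) by exact: measurable_jump_across.
have [N [mN PN good]] : {ae P, forall w,
   (J w <-> exists k : nat * nat, A k.1 k.2 w) /\
   (forall k k' : nat * nat, A k.1 k.2 w -> A k'.1 k'.2 w -> k = k')}.
  near=> w.
  have D0 : forall k, 0 < D k w by near: w; exact: (ae_driving_gt0 hD).
  have neq : forall x i y j, theta x i w = theta y j w -> x = y.
    by near: w; exact: (ae_clock_neq hD).
  have unb : forall x (r : R), exists i, r < theta x i w.
    by near: w; exact: (ae_clock_unbounded hD).
  have gt1 : forall N, exists n, (N <= n)%N /\ 1 < T 0%N n w.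
    by near: w; exact: (ae_jump_gt1 hD).
  have dense : forall a b : R, 0 <= a < b ->
      forall N, exists x, (N <= x)%N /\ a < theta x 0%N w < b.
    by near: w; exact: (ae_clock_dense hD).
  have fin : forall r, (pre_clock f (path theta w) (path T w) r < +oo)%E.
    by near: w; exact: (ae_pre_clock_finite hD f0 sf).
  have th0 x i : 0 < theta x i w by exact: (clock_gt0 D0).
  have T0 x i : 0 < T x i w by exact: (D0 (inr (x, i))).
  have inc x i j : (i < j)%N -> theta x i w < theta x j w by exact: (clock_increasing D0).
  split; first exact: (no_jump_withinP f0 th0 T0 inc neq unb gt1 dense fin s0 se).
  by move=> k k'; exact: (jump_across_unique f0 th0 T0 inc neq fin se).
pose B x i := A x i `\` N.
have mB x i : measurable (B x i) by exact: measurableD.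
have gN w : ~ N w -> (J w <-> exists k : nat * nat, A k.1 k.2 w) /\
   (forall k k' : nat * nat, A k.1 k.2 w -> A k'.1 k'.2 w -> k = k').
  by move=> Nw; apply: contrapT => /good.
have PB x i : P (B x i) = P (A x i).
  rewrite [RHS](measureDI P (mA x i) mN) [X in (_ + X)%E](_ : _ = 0%E) ?adde0//.
  by apply: (subset_measure0 _ mN) => //; exact: measurableI.
pose U := \bigcup_x \bigcup_i B x i.
have mU : measurable U.
  by apply: bigcupT_measurable => x; exact: bigcupT_measurable.
have PU : P U = (\sum_(x <oo) \sum_(i <oo) P (B x i))%E.
  rewrite /U measure_bigcup//.
  - rewrite (eq_eseriesl (Q := xpredT)); last by move=> n; rewrite in_setT.
    apply: eq_eseriesr => x _; rewrite measure_bigcup//.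
      by rewrite (eq_eseriesl (Q := xpredT))// => n; rewrite in_setT.
    apply/trivIsetP => i j _ _ ij; apply/seteqP; split => // w [[Ai Nw] [Aj _]].
    have [_ /(_ (x, i) (x, j) Ai Aj)[E]] := gN _ Nw.
    by rewrite E eqxx in ij.
  - by move=> x _; exact: bigcupT_measurable.
  - apply/trivIsetP => x y _ _ xy; apply/seteqP; split => // w [[i _ [Ai Nw]] [j _ [Aj _]]].
    have [_ /(_ (x, i) (y, j) Ai Aj)[E _]] := gN _ Nw.
    by rewrite E eqxx in xy.
have -> : no_jump_probability theta T f s t = P U.
  rewrite -[LHS]/(mu_ext P J); apply/eqP; rewrite eq_le; apply/andP; split.
    apply: (@le_trans _ _ (mu_ext P (U `|` N))).
      apply: le_mu_ext => w Jw; have [Nw|Nw] := pselect (N w); [by right|left].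
      have [[/(_ Jw)[k Ak] _] _] := gN _ Nw.
      by exists k.1 => //; exists k.2.
    rewrite measurable_mu_extE; last exact: measurableU.
    rewrite (le_trans (measureU2 _ _ _))// -[leRHS]adde0 leeD2l//.
    by move/eqP: PN; rewrite eq_le => /andP[].
  rewrite -(measurable_mu_extE P mU); apply: le_mu_ext.
  move=> w [x _ [i _ [Ai Nw]]]; have [[_ J'] _] := gN _ Nw.
  by apply: J'; exists (x, i).
rewrite PU; apply: eq_eseriesr => x _; apply: eq_eseriesr => i _.
by rewrite PB /A jump_across_prob.
Unshelve. all: by end_near. Qed.

End no_jump_law.

(** * Polynomial approximation *)

Section bernstein.
Context (R : realType).

Lemma uniform_continuity01 (h : R -> R) (e : R) : continuous h -> 0 < e ->
  exists2 d, 0 < d & forall x y, 0 <= x <= 1 -> `|x - y| < d -> `|h x - h y| < e.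
Proof.
move=> ch e0.
have cov : near_covering (`[0%R, 1%R]%classic : set R).
  by apply/compact_near_coveringP; exact: segment_compact.
pose P (d x : R) := forall y, `|x - y| < d -> `|h x - h y| < e.
have H : \forall d \near (0 : R)^'+, `[0%R, 1%R]%classic `<=` P d.
  apply: cov => x _.
  have e2 : 0 < e / 2 by rewrite divr_gt0.
  have [d /= d0 hd] : \forall z \near x, `|h x - h z| < e / 2.
    by have /cvgrPdist_lt/(_ _ e2) := ch x.
  exists (ball x (d / 2), [set r | 0 < r < d / 2]) => /=.
    split; first by apply: nbhsx_ballx; rewrite divr_gt0.
    near=> r => /=; apply/andP; split; first by near: r; exact: nbhs_right_gt.
    by near: r; apply: nbhs_right_lt; rewrite divr_gt0.
  move=> [x' r] /= [xx' /andP[r0 rd]] y x'y.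
  have xx'1 : `|x - x'| < d by apply: lt_trans xx' _; rewrite ltr_pdivrMr// mulr2n mulrDr mulr1 ltrDl.
  have xy : `|x - y| < d.
    rewrite (_ : x - y = (x - x') + (x' - y)); last by ring.
    by rewrite (le_lt_trans (ler_normD _ _))// (splitr d) ltrD// (lt_trans x'y).
  have H1 := hd x' xx'1; have H2 := hd y xy.
  rewrite (_ : h x' - h y = (h x' - h x) + (h x - h y)); last by ring.
  by rewrite (le_lt_trans (ler_normD _ _))// (splitr e) ltrD// distrC.
near (0 : R)^'+ => d.
exists d => // x y x01 xy.
have /(_ x) : `[0%R, 1%R]%classic `<=` P d by near: d.
by rewrite /= in_itv/= x01; apply.
Unshelve. all: by end_near. Qed.

(** The Bernstein polynomial of [phi]: the expectation of [phi] at a binomial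
    variable with parameters [n] and 'X, obtained by conditioning on the first
    trial. *)
Fixpoint bernstein (n : nat) (phi : nat -> R) : {poly R} :=
  if n is m.+1 then
    'X * bernstein m (fun k => phi k.+1) + (1 - 'X) * bernstein m phi
  else (phi 0%N)%:P.

Lemma bernsteinS m phi x : (bernstein m.+1 phi).[x] =
  x * (bernstein m (fun k => phi k.+1)).[x] + (1 - x) * (bernstein m phi).[x].
Proof. by rewrite /= !hornerE. Qed.

Lemma bernstein_le n phi psi x : 0 <= x <= 1 ->
  (forall k, (k <= n)%N -> phi k <= psi k) ->
  (bernstein n phi).[x] <= (bernstein n psi).[x].
Proof.
move=> /andP[x0 x1]; elim: n phi psi => [|n IH] phi psi H.
  by rewrite /= !hornerE; exact: H.
rewrite !bernsteinS lerD// ler_wpM2l ?subr_ge0//; apply: IH => k kn.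
  by apply: H; rewrite ltnS.
by apply: H; rewrite (leq_trans kn).
Qed.

(** The variance of the binomial law, in the form that Chebyshev's argument
    needs. *)
Lemma bernstein_second_moment n c a b x :
  (bernstein n (fun k => a + b * (k%:R + c) ^+ 2)).[x] =
  a + b * ((n%:R * x + c) ^+ 2 + n%:R * x * (1 - x)).
Proof.
elim: n c => [|n IH] c; first by rewrite /= !hornerE; ring.
rewrite bernsteinS IH.
have -> : (fun k => a + b * (k.+1%:R + c) ^+ 2) =
    (fun k => a + b * (k%:R + (c + 1)) ^+ 2).
  by apply/funext => k; rewrite -natr1; congr (_ + _ * _ ^+ 2); ring.
by rewrite IH -natr1; ring.
Qed.

(** Bernstein's proof: the distance between phi k and h x is at most e / 2 when
    k / n is close to x, and at most a multiple of (k - n x)^2 / n^2 otherwise. *)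
Lemma weierstrass01 (h : R -> R) (e : R) : continuous h -> 0 < e ->
  exists p : {poly R}, forall x, 0 <= x <= 1 -> `|h x - p.[x]| <= e.
Proof.
move=> ch e0.
have e20 : 0 < e / 2 by rewrite divr_gt0.
have [d d0 hd] := uniform_continuity01 ch e20.
have [M M0 hM] : exists2 M, 0 < M & forall x, 0 <= x <= 1 -> `|h x| <= M.
  have cn : {within `[0, 1], continuous (fun x => `|h x|)}.
    by apply: continuous_subspaceT => x; apply: cvg_norm; exact: ch.
  have [c _ hc] := EVT_max ler01 cn.
  exists (`|h c| + 1) => [|x x01]; first by rewrite ltr_wpDl.
  by rewrite (le_trans (hc _ _)) ?in_itv// lerDl.
have [n nb n0] : exists2 n, 2 * M / (d ^+ 2 * (e / 2)) <= n%:R & 0 < (n%:R : R).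
  exists (Num.bound (2 * M / (d ^+ 2 * (e / 2)))).+1; last by rewrite ltr0n.
  rewrite ltW// (lt_trans (archi_boundP _))//; last by rewrite ltr_nat.
  by rewrite divr_ge0 ?mulr_ge0 ?sqr_ge0 ?ltW.
pose phi k := h (k%:R / n%:R).
exists (bernstein n phi) => x x01; have /andP[x0 x1] := x01.
pose b := 2 * M / (n%:R ^+ 2 * d ^+ 2).
have b0 : 0 <= b by rewrite divr_ge0// mulr_ge0// ?sqr_ge0// ltW.
have key k : (k <= n)%N -> `|phi k - h x| <= e / 2 + b * (k%:R - n%:R * x) ^+ 2.
  move=> kn.
  have k01 : 0 <= (k%:R / n%:R : R) <= 1.
    by rewrite divr_ge0//= ler_pdivrMr// mul1r ler_nat.
  have [xk|kx] := ltP `|x - k%:R / n%:R| d.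
    by rewrite distrC (le_trans (ltW (hd _ _ x01 xk)))// lerDl mulr_ge0// sqr_ge0.
  rewrite (le_trans (ler_normB _ _))// (@le_trans _ _ (2 * M))//.
    by have := hM _ x01; have := hM _ k01; rewrite /phi; lra.
  apply: (@le_trans _ _ (b * (k%:R - n%:R * x) ^+ 2)); last by rewrite lerDr ltW.
  have -> : k%:R - n%:R * x = n%:R * (k%:R / n%:R - x) by field; rewrite gt_eqF.
  have -> : b * (n%:R * (k%:R / n%:R - x)) ^+ 2 =
      2 * M * ((x - k%:R / n%:R) ^+ 2 / d ^+ 2).
    by rewrite /b; field; rewrite !gt_eqF.
  rewrite ler_peMr ?mulr_ge0 ?(ltW M0)// ler_pdivlMr ?exprn_gt0// mul1r.
  by rewrite -[leRHS]real_normK ?num_real// lerXn2r ?nnegrE// ltW.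
have bn : b * (n%:R * x * (1 - x)) <= e / 2.
  have x_1x : x * (1 - x) <= 1 by rewrite mulr_ile1 ?subr_ge0// lerBlDr lerDl.
  apply: (@le_trans _ _ (b * n%:R)).
    by rewrite ler_wpM2l// -mulrA ler_piMr// ltW.
  have -> : b * n%:R = 2 * M / (d ^+ 2 * (e / 2)) / n%:R * (e / 2).
    by rewrite /b; field; rewrite !gt_eqF.
  by rewrite ler_piMl ?(ltW e20)// ler_pdivrMr// mul1r.
have up : (bernstein n phi).[x] <= h x + e.
  have := @bernstein_second_moment n (- (n%:R * x)) (h x + e / 2) b x.
  rewrite subrr expr0n/= add0r => E.
  apply: (@le_trans _ _ (h x + e / 2 + b * (n%:R * x * (1 - x)))); last by lra.
  rewrite -E; apply: bernstein_le => // k kn.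
  by have := key k kn; rewrite ler_norml => /andP[_]; lra.
have lo : h x - e <= (bernstein n phi).[x].
  have := @bernstein_second_moment n (- (n%:R * x)) (h x - e / 2) (- b) x.
  rewrite subrr expr0n/= add0r => E.
  apply: (@le_trans _ _ (h x - e / 2 + - b * (n%:R * x * (1 - x)))); first by lra.
  rewrite -E; apply: bernstein_le => // k kn.
  by have := key k kn; rewrite ler_norml => /andP[+ _]; lra.
by rewrite ler_norml; apply/andP; split; lra.
Qed.

End bernstein.

(** * Convergence of positive functionals *)

Section positive_functionals.
Context (R : realType).

Definition test_fun (h : R -> R) : Prop :=
  measurable_fun setT h /\ exists M, forall v, 0 <= v <= 1 -> `|h v| <= M.

(** The properties of integration against a finite measure on [0, 1] that the
    method of moments uses. *)
Definition positive_functional (L : (R -> R) -> R) : Prop :=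
  [/\ forall a h g, test_fun h -> test_fun g ->
        L (fun v => a * h v + g v) = a * L h + L g,
      forall h g, test_fun h -> test_fun g ->
        (forall v, 0 <= v <= 1 -> h v <= g v) -> L h <= L g &
      forall (h_ : nat -> R -> R) h M, (forall n, test_fun (h_ n)) -> test_fun h ->
        (forall n v, 0 <= v <= 1 -> `|h_ n v| <= M) ->
        (forall v, 0 <= v <= 1 -> h_ ^~ v @ \oo --> h v) ->
        L (h_ n) @[n --> \oo] --> L h].

Lemma test_fun_lin a h g : test_fun h -> test_fun g ->
  test_fun (fun v => a * h v + g v).
Proof.
move=> [mh [M hM]] [mg [N gN]]; split.
  by apply: measurable_funD => //; exact: measurable_funM.
exists (`|a| * M + N) => v v01; rewrite (le_trans (ler_normD _ _))// lerD ?gN//.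
by rewrite normrM ler_wpM2l// hM.
Qed.

Lemma test_fun_continuous h : continuous h -> test_fun h.
Proof.
move=> ch; split; first exact: continuous_measurable_fun.
have cn : {within `[0, 1], continuous (fun x => `|h x|)}.
  by apply: continuous_subspaceT => x; apply: cvg_norm; exact: ch.
have [c _ hc] := EVT_max ler01 cn.
by exists `|h c| => x x01; rewrite hc ?in_itv.
Qed.

Lemma continuous_horner (p : {poly R}) : continuous (fun v => p.[v]).
Proof.
elim/poly_ind: p => [|p c IH] v.
  by under eq_fun do rewrite horner0; exact: cvg_cst.
under eq_fun do rewrite !hornerE.
apply: cvgD; last exact: cvg_cst.
by apply: cvgM; [exact: IH|exact: cvg_id].
Qed.

Lemma test_fun_horner (p : {poly R}) : test_fun (fun v => p.[v]).
Proof. by apply: test_fun_continuous; exact: continuous_horner. Qed.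

Lemma test_fun_exp k : test_fun (fun v => v ^+ k).
Proof. by apply: test_fun_continuous; exact: exprn_continuous. Qed.

Section one_functional.
Variable L : (R -> R) -> R.
Hypothesis pL : positive_functional L.

Lemma positive_functionalZ a h : test_fun h -> L (fun v => a * h v) = a * L h.
Proof.
move=> th; case: pL => lin _ _.
have t0 : test_fun (fun=> 0 : R) by apply: test_fun_continuous => v; exact: cvg_cst.
have L0 : L (fun=> 0) = 0.
  by have := lin 1 _ _ t0 t0; rewrite !mul1r addr0; lra.
have := lin a _ _ th t0; rewrite L0 addr0.
by under eq_fun do rewrite addr0.
Qed.

Lemma positive_functional_horner (p : {poly R}) :
  L (fun v => p.[v]) = \sum_(k < size p) p`_k * L (fun v => v ^+ k).
Proof.
have -> : (fun v => p.[v]) = (fun v => \sum_(k < size p) p`_k * v ^+ k).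
  by apply/funext => v; rewrite horner_coef.
elim: (size p) => [|n IH].
  rewrite big_ord0; have := positive_functionalZ 0 (test_fun_exp 0).
  rewrite mul0r; apply: etrans; congr (L _).
  by apply/funext => v; rewrite big_ord0 mul0r.
rewrite big_ord_recr/= -IH addrC; case: pL => lin _ _.
rewrite -lin; first by congr (L _); apply/funext => v; rewrite big_ord_recr/= addrC.
  exact: test_fun_exp.
rewrite (_ : (fun v => _) = (fun v => (\poly_(k < n) p`_k).[v])); last first.
  by apply/funext => v; rewrite horner_poly.
exact: test_fun_horner.
Qed.

Lemma positive_functional_dist h g e : test_fun h -> test_fun g ->
  (forall v, 0 <= v <= 1 -> `|h v - g v| <= e) ->
  `|L h - L g| <= e * L (fun=> 1).
Proof.
move=> th tg hg; case: pL => lin mono _.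
have t1 : test_fun (fun=> 1 : R) by apply: test_fun_continuous => v; exact: cvg_cst.
have U1 : L h <= e * L (fun=> 1) + L g.
  rewrite -lin//; apply: mono => //; first exact: test_fun_lin.
  by move=> v /hg; rewrite mulr1 ler_norml => /andP[_]; lra.
have U2 : L g <= e * L (fun=> 1) + L h.
  rewrite -lin//; apply: mono => //; first exact: test_fun_lin.
  by move=> v /hg; rewrite mulr1 ler_norml => /andP[+ _]; lra.
by rewrite ler_norml; apply/andP; split; lra.
Qed.

End one_functional.

Section moments.
Context (I : Type) (F : set_system I) {FF : ProperFilter F}.
Variables (L_ : I -> (R -> R) -> R) (L : (R -> R) -> R).
Hypothesis pL_ : forall i, positive_functional (L_ i).
Hypothesis pL : positive_functional L.
Hypothesis moments : forall k, L_ i (fun v => v ^+ k) @[i --> F] --> L (fun v => v ^+ k).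

(** Moments control polynomials, and by positivity a uniform approximation of [h]
    by polynomials on [0, 1] controls the functionals at [h]. *)
Lemma moment_cvg h : continuous h -> L_ i h @[i --> F] --> L h.
Proof.
move=> ch; have th := test_fun_continuous ch.
have cvgp (p : {poly R}) : L_ i (fun v => p.[v]) @[i --> F] --> L (fun v => p.[v]).
  under eq_fun do rewrite (positive_functional_horner (pL_ _)).
  rewrite (positive_functional_horner pL).
  apply: cvg_big => [|k _]; first exact: add_continuous.
  by apply: cvgM; [exact: cvg_cst|exact: moments].
have cvg1 : L_ i (fun=> 1) @[i --> F] --> L (fun=> 1).
  have := @moments 0; rewrite (_ : (fun v : R => v ^+ 0) = fun=> 1)//.
pose M := L (fun=> 1) + 1.
have t1 : test_fun (fun=> 1 : R) by apply: test_fun_continuous => v; exact: cvg_cst.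
have L1 : 0 <= L (fun=> 1).
  case: (pL) => _ mono _; have := positive_functionalZ pL 0 t1.
  rewrite [0 * L _]mul0r => E; rewrite -[leLHS]E; apply: mono => //.
  by apply: test_fun_continuous => v; exact: cvg_cst.
have M0 : 0 < M by rewrite ltr_wpDl.
apply/cvgrPdist_le => e e0.
have e3 : 0 < e / 3 / M by rewrite !divr_gt0.
have [p hp] := weierstrass01 ch e3.
have tp := test_fun_horner p.
have small x : x <= M -> e / 3 / M * x <= e / 3.
  by move=> xM; rewrite mulrAC ler_pdivrMr// ler_wpM2l// divr_ge0// ltW.
near=> i.
have N1 : L_ i (fun=> 1) <= M.
  near: i; have /cvgrPdist_le/(_ _ ltr01) := cvg1.
  by apply: filterS => i; rewrite ler_norml /M => /andP[+ _]; lra.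
have N2 : `|L (fun v => p.[v]) - L_ i (fun v => p.[v])| <= e / 3.
  by near: i; have /cvgrPdist_le := cvgp p; apply; rewrite divr_gt0.
have D1 : `|L h - L (fun v => p.[v])| <= e / 3.
  apply: le_trans (positive_functional_dist pL th tp hp) _.
  by apply: small; rewrite /M lerDl.
have D2 : `|L_ i h - L_ i (fun v => p.[v])| <= e / 3.
  apply: le_trans (positive_functional_dist (pL_ i) th tp hp) _.
  exact: small.
move: N2 D1 D2; rewrite !ler_norml => /andP[a1 a2] /andP[b1 b2] /andP[c1 c2].
by apply/andP; split; lra.
Unshelve. all: by end_near. Qed.

End moments.

Definition clamp01 (v : R) : R := Num.min (Num.max v 0) 1.

Lemma continuous_clamp01 : continuous clamp01.
Proof.
move=> v; apply: (@continuous_min _ _ (fun v : R => Num.max v 0) (fun=> 1)).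
  by apply: (@continuous_max _ _ id (fun=> 0)); [exact: cvg_id|exact: cvg_cst].
exact: cvg_cst.
Qed.

Lemma clamp01_ge0 v : 0 <= clamp01 v.
Proof. by rewrite /clamp01 le_min ler01 le_max lexx orbT. Qed.

Lemma clamp01_le1 v : clamp01 v <= 1.
Proof. by rewrite /clamp01 ge_min lexx orbT. Qed.

Lemma clamp01_ge1 v : 1 <= v -> clamp01 v = 1.
Proof. by move=> v1; rewrite /clamp01 max_l ?(le_trans ler01)// min_r. Qed.

Lemma clamp01_le0 v : v <= 0 -> clamp01 v = 0.
Proof. by move=> v0; rewrite /clamp01 max_r// min_l. Qed.

(** Continuous functions that squeeze the indicator of `[v0, +oo[. *)
Definition upper_ramp (v0 : R) (n : nat) (v : R) : R := clamp01 (1 + n%:R * (v - v0)).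
Definition lower_ramp (v0 : R) (n : nat) (v : R) : R := clamp01 (n%:R * (v - v0)).

Lemma continuous_upper_ramp v0 n : continuous (upper_ramp v0 n).
Proof.
move=> v; apply: (continuous_comp (f := fun v => 1 + n%:R * (v - v0))).
  apply: cvgD; first exact: cvg_cst.
  apply: cvgM; first exact: cvg_cst.
  by apply: cvgB; [exact: cvg_id|exact: cvg_cst].
exact: continuous_clamp01.
Qed.

Lemma continuous_lower_ramp v0 n : continuous (lower_ramp v0 n).
Proof.
move=> v; apply: (continuous_comp (f := fun v => n%:R * (v - v0))).
  apply: cvgM; first exact: cvg_cst.
  by apply: cvgB; [exact: cvg_id|exact: cvg_cst].
exact: continuous_clamp01.
Qed.

Lemma upper_ramp_cvg v0 v : upper_ramp v0 n v @[n --> \oo] --> ((v0 <= v)%R%:R : R).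
Proof.
have [v0v|vv0] := leP v0 v.
  apply: cvg_near_cst; apply: nearW => n; apply: clamp01_ge1.
  by rewrite lerDl mulr_ge0// subr_ge0.
apply: cvg_near_cst; exists (Num.bound (v0 - v)^-1) => // n /= hn.
apply: clamp01_le0; rewrite -[v - v0]opprB mulrN subr_le0.
rewrite -ler_pdivrMr ?subr_gt0// mul1r.
apply: ltW; apply: lt_le_trans (archi_boundP _) _; last by rewrite ler_nat.
by rewrite invr_ge0 subr_ge0 ltW.
Qed.

Lemma lower_ramp_cvg v0 v : lower_ramp v0 n v @[n --> \oo] --> ((v0 < v)%R%:R : R).
Proof.
have [vv0|v0v] := leP v v0.
  apply: cvg_near_cst; apply: nearW => n; apply: clamp01_le0.
  by rewrite mulr_ge0_le0// subr_le0.
apply: cvg_near_cst; exists (Num.bound (v - v0)^-1) => // n /= hn.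
apply: clamp01_ge1; rewrite -ler_pdivrMr ?subr_gt0// mul1r.
apply: ltW; apply: lt_le_trans (archi_boundP _) _; last by rewrite ler_nat.
by rewrite invr_ge0 subr_ge0 ltW.
Qed.

Section jump.
Variables (G : R -> R) (v0 : R).
Hypothesis cG : continuous G.
Hypothesis G0 : forall v, 0 <= G v.

Let g v : R := (v0 <= v)%R%:R * G v.
Let up n v := upper_ramp v0 n v * G v.
Let lo n v := lower_ramp v0 n v * G v.

Let cup n : continuous (up n).
Proof. by move=> v; apply: cvgM; [exact: continuous_upper_ramp|exact: cG]. Qed.
Let clo n : continuous (lo n).
Proof. by move=> v; apply: cvgM; [exact: continuous_lower_ramp|exact: cG]. Qed.

Lemma test_fun_jump : test_fun g.
Proof.
have [mG [M GM]] := test_fun_continuous cG; split.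
  apply: measurable_funM => //.
  rewrite [X in measurable_fun _ X](_ : _ = fun v : R => if v0 <= v then 1 else 0); last first.
    by apply/funext => v; case: (v0 <= v).
  by apply: measurable_fun_ifT => //; exact: measurable_fun_ler.
exists M => v v01; apply: le_trans (GM _ v01).
by rewrite /g; case: (v0 <= v); rewrite ?mul1r// mul0r normr0.
Qed.

Lemma upper_ramp_functional_cvg L : positive_functional L ->
  L (up n) @[n --> \oo] --> L g.
Proof.
move=> [_ _ conv]; have [_ [M GM]] := test_fun_continuous cG.
apply: (conv up g M).
- by move=> n; exact: test_fun_continuous.
- exact: test_fun_jump.
- move=> n v v01; apply: le_trans (GM _ v01).
  by rewrite normrM ger0_norm ?clamp01_ge0// ler_piMl// clamp01_le1.
- by move=> v _; apply: cvgM; [exact: upper_ramp_cvg|exact: cvg_cst].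
Qed.

(** The functionals agree on the continuous functions [up n], which converge
    boundedly to [g]. *)
Lemma moment_unique_jump L L' : positive_functional L -> positive_functional L' ->
  (forall k, L (fun v => v ^+ k) = L' (fun v => v ^+ k)) -> L g = L' g.
Proof.
move=> pL pL' LL'.
have E n : L (up n) = L' (up n).
  have cL : L (up n) @[i --> \oo] --> L' (up n).
    by apply: (@moment_cvg nat \oo _ (fun=> L)) => // k; rewrite LL'; exact: cvg_cst.
  by rewrite -(cvg_lim _ cL)// lim_cst.
have c1 := upper_ramp_functional_cvg pL.
have c2 := upper_ramp_functional_cvg pL'.
rewrite -(cvg_lim _ c1)// -(cvg_lim _ c2)//; congr (limn _).
by apply/funext => n; exact: E.
Qed.

(** As in the portmanteau theorem: the two continuous ramps squeeze the function
    with a jump, and the limit does not charge the place of the jump. *)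
Lemma moment_cvg_jump (I : Type) (F : set_system I) {FF : ProperFilter F}
    (L_ : I -> (R -> R) -> R) L :
  (forall i, positive_functional (L_ i)) -> positive_functional L ->
  (forall k, L_ i (fun v => v ^+ k) @[i --> F] --> L (fun v => v ^+ k)) ->
  L (fun v => (v == v0)%:R) = 0 -> L_ i g @[i --> F] --> L g.
Proof.
move=> pL_ pL mom L0; have [lin mono conv] := pL.
have [mG [M GM]] := test_fun_continuous cG.
pose g' v : R := (v0 < v)%R%:R * G v.
have tdirac : test_fun (fun v => (v == v0)%:R : R).
  split.
    rewrite [X in measurable_fun _ X](_ : _ = fun v : R => if v == v0 then 1 else 0); last first.
      by apply/funext => v; case: (v == v0).
    by apply: measurable_fun_ifT => //; exact: measurable_fun_eqr.
  by exists 1 => v _; case: (v == v0); rewrite ?normr1// normr0.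
have tg := test_fun_jump.
have tg' : test_fun g'.
  split.
    apply: measurable_funM => //.
    rewrite [X in measurable_fun _ X](_ : _ = fun v : R => if v0 < v then 1 else 0); last first.
      by apply/funext => v; case: (v0 < v).
    by apply: measurable_fun_ifT => //; exact: measurable_fun_ltr.
  exists M => v v01; apply: le_trans (GM _ v01).
  by rewrite /g'; case: (v0 < v); rewrite ?mul1r// mul0r normr0.
have gg' : L g' = L g.
  have -> : g = (fun v => G v0 * (v == v0)%:R + g' v).
    apply/funext => v; rewrite /g /g'; case: (ltgtP v0 v) => [v0v|vv0|->].
    - by rewrite mulr0 add0r.
    - by rewrite mulr0 add0r.
    - by rewrite mulr1 mul0r addr0 mul1r.
  by rewrite lin// L0 mulr0 add0r.
have clo_g : L (lo n) @[n --> \oo] --> L g.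
  rewrite -gg'; apply: (conv lo g' M) => //.
  - by move=> n; exact: test_fun_continuous.
  - move=> n v v01; apply: le_trans (GM _ v01).
    by rewrite normrM ger0_norm ?clamp01_ge0// ler_piMl// clamp01_le1.
  - by move=> v _; apply: cvgM; [exact: lower_ramp_cvg|exact: cvg_cst].
have cup_g := upper_ramp_functional_cvg pL.
apply/cvgrPdist_le => e e0.
have e2 : 0 < e / 2 by rewrite divr_gt0.
near \oo => n.
have Hup : L (up n) <= L g + e / 2.
  near: n; have /cvgrPdist_le/(_ _ e2) := cup_g.
  by apply: filterS => n; rewrite ler_norml => /andP[+ _]; lra.
have Hlo : L g - e / 2 <= L (lo n).
  near: n; have /cvgrPdist_le/(_ _ e2) := clo_g.
  by apply: filterS => n; rewrite ler_norml => /andP[_]; lra.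
have Cup : L_ i (up n) @[i --> F] --> L (up n) by exact: (moment_cvg pL_ pL mom).
have Clo : L_ i (lo n) @[i --> F] --> L (lo n) by exact: (moment_cvg pL_ pL mom).
near=> i.
have Hup_i : L_ i (up n) <= L (up n) + e / 2.
  near: i; have /cvgrPdist_le/(_ _ e2) := Cup.
  by apply: filterS => i; rewrite ler_norml => /andP[+ _]; lra.
have Hlo_i : L (lo n) - e / 2 <= L_ i (lo n).
  near: i; have /cvgrPdist_le/(_ _ e2) := Clo.
  by apply: filterS => i; rewrite ler_norml => /andP[_]; lra.
have [_ mono_i _] := pL_ i.
have U1 : L_ i g <= L_ i (up n).
  apply: mono_i => //; first exact: test_fun_continuous.
  move=> v _; rewrite ler_wpM2r//; have [v0v|_] := leP v0 v; last by rewrite clamp01_ge0.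
  by rewrite /upper_ramp clamp01_ge1// lerDl mulr_ge0// subr_ge0.
have U2 : L_ i (lo n) <= L_ i g.
  apply: mono_i => //; first exact: test_fun_continuous.
  move=> v _; rewrite ler_wpM2r//; have [_|vv0] := leP v0 v; first by rewrite clamp01_le1.
  by rewrite /lower_ramp clamp01_le0// mulr_ge0_le0// subr_le0 ltW.
by rewrite ler_norml; apply/andP; split; lra.
Unshelve. all: by end_near. Qed.

End jump.

Section weighted_integral.
Context d (T : measurableType d) (mu : {measure set T -> \bar R}) (D : set T).
Hypothesis mD : measurable D.
Variables (w X : T -> R).
Hypothesis mw : measurable_fun D w.
Hypothesis w0 : forall x, D x -> 0 <= w x.
Hypothesis iw : mu.-integrable D (EFin \o w).
Hypothesis mX : measurable_fun D X.
Hypothesis X01 : forall x, D x -> 0 <= X x <= 1.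

(** Integration against the image under [X] of the measure with density [w]. *)
Definition weighted_integral (h : R -> R) : R :=
  \int[mu]_(x in D) (w x * h (X x)).

Lemma weighted_measurable h : test_fun h ->
  measurable_fun D (fun x => w x * h (X x)).
Proof.
by move=> [mh _]; apply: measurable_funM => //; exact: measurableT_comp.
Qed.

Lemma weighted_integrable h : test_fun h ->
  mu.-integrable D (EFin \o (fun x => w x * h (X x))).
Proof.
move=> th; have [mh [M hM]] := th.
apply: (@le_integrable _ _ _ _ _ mD _ (fun x => (M%:E * (w x)%:E)%E)).
- by apply/measurable_EFinP; exact: weighted_measurable.
- move=> x Dx /=; rewrite lee_fin normrM [leRHS]normrM mulrC.
  by rewrite ler_wpM2r// (le_trans (hM _ (X01 Dx)))// ler_norm.
- exact: integrableZl.
Qed.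

Lemma weighted_integralE h : test_fun h ->
  ((weighted_integral h)%:E = \int[mu]_(x in D) (w x * h (X x))%:E)%E.
Proof.
by move=> th; rewrite fineK//; apply: integrable_fin_num => //; exact: weighted_integrable.
Qed.

Lemma weighted_integral_positive : positive_functional weighted_integral.
Proof.
split.
- move=> a h g th tg; rewrite /weighted_integral.
  rewrite (_ : (fun x => _) = (fun x => a * (w x * h (X x)) + w x * g (X x))); last first.
    by apply/funext => x; ring.
  rewrite RintegralD//.
  + by rewrite RintegralZl//; exact: weighted_integrable.
  + exact: (integrableZl mD a (weighted_integrable th)).
  + exact: weighted_integrable.
- move=> h g th tg hg; apply: le_Rintegral => //.
  + exact: weighted_integrable.
  + exact: weighted_integrable.
  + by move=> x Dx; rewrite ler_wpM2l ?w0// hg// X01.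
- move=> h_ h M th_ th hM hc.
  have [] := @dominated_convergence _ _ _ mu D mD
    (fun n x => (w x * h_ n (X x))%:E) (fun x => (w x * h (X x))%:E)
    (fun x => (M%:E * (w x)%:E)%E).
  + by move=> n; apply/measurable_EFinP; exact: weighted_measurable.
  + by apply/measurable_EFinP; exact: weighted_measurable.
  + apply: aeW => x Dx; apply: cvg_EFin; first by near=> n.
    by apply: cvgM; [exact: cvg_cst|apply: hc; exact: X01].
  + exact: integrableZl.
  + apply: aeW => x n Dx; rewrite /= lee_fin normrM mulrC.
    by rewrite (ger0_norm (w0 Dx)) ler_wpM2r ?w0// hM// X01.
  by move=> _ _; rewrite -weighted_integralE// => /fine_cvg.
Unshelve. all: by end_near. Qed.

End weighted_integral.

End positive_functionals.

(** * Gamma integrals *)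

Section scaling.
Context (R : realType).
Local Notation mu := (@lebesgue_measure R).
Local Open Scope ereal_scope.

Let measurable_scale (c : R) :
  measurable_fun setT (fun u : measurableTypeR R => (c * u)%R : measurableTypeR R).
Proof. exact: measurable_funM. Qed.

Let scaled (c : {nonneg R}) : {measure set (measurableTypeR R) -> \bar R} :=
  mscale c (measure_function_pushforward__canonical__measure_function_Measure
    mu (measurable_scale c%:num)).

(** Lebesgue measure is characterized by its values on intervals. *)
Lemma lebesgue_measure_scale (c : R) (c0 : (0 < c)%R) (A : set R) : measurable A ->
  mu A = scaled (NngNum (ltW c0)) A.
Proof.
move=> mA; apply: lebesgue_measure_unique => // X [[a b] /= ab <-].
rewrite /scaled /mscale /= /pushforward.
have -> : (fun u => c * u)%R @^-1` `]a, b] = `](a / c)%R, (b / c)%R]%classic.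
  by apply/seteqP; split => u /=; rewrite !in_itv/= ltr_pdivrMr// ler_pdivlMr// ![(u * c)%R]mulrC.
rewrite !lebesgue_measure_itv/= !lte_fin ltr_pM2r ?invr_gt0//.
case: ifPn => _; last by rewrite mule0.
by rewrite -!EFinD -EFinM; congr EFin; field; rewrite gt_eqF.
Qed.

Lemma ge0_integral_scale (c : R) (f : R -> \bar R) : (0 < c)%R ->
  measurable_fun setT f -> (forall u, 0 <= f u) ->
  \int[mu]_u f (c * u)%R = (c^-1)%:E * \int[mu]_u f u.
Proof.
move=> c0 mf f0.
rewrite [in RHS](eq_measure_integral (scaled (NngNum (ltW c0)))); last first.
  by move=> A mA _; exact: lebesgue_measure_scale.
rewrite ge0_integral_mscale// ge0_integral_pushforward//.
by rewrite muleA -EFinM /= mulVf ?gt_eqF// mul1e.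
Qed.

Lemma ge0_integral_scale_pos (c : R) (f : R -> \bar R) : (0 < c)%R ->
  measurable_fun (`]0%R, +oo[%classic : set R) f -> (forall u, (0 < u)%R -> 0 <= f u) ->
  \int[mu]_(u in `]0%R, +oo[) f (c * u)%R =
  (c^-1)%:E * \int[mu]_(u in `]0%R, +oo[) f u.
Proof.
move=> c0 mf f0; rewrite [in RHS]integral_mkcond -ge0_integral_scale//.
- rewrite [LHS]integral_mkcond; apply: eq_integral => u _; rewrite !patchE.
  by rewrite !mem_setE !in_itv/= !andbT pmulr_rgt0.
- by apply/(measurable_restrictT f) => //; exact: measurable_itv.
- move=> u; rewrite patchE; case: ifPn => //; rewrite inE/= in_itv/= andbT.
  exact: f0.
Qed.

End scaling.

Section gamma.
Context (R : realType).
Local Notation mu := (@lebesgue_measure R).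
Local Notation pos := (`]0%R, +oo[%classic : set R).
Local Open Scope ereal_scope.

Lemma continuous_powR (a u : R) : (0 < u)%R -> {for u, continuous (fun x => x `^ a)%R}.
Proof.
move=> u0; apply: differentiable_continuous; apply/derivable1_diffP.
by apply: derivable_powR; rewrite in_itv/= u0.
Qed.

Lemma integral_powR01 (k : R) : (0 < k)%R ->
  \int[mu]_(u in `]0%R, 1%R]) (u `^ (k - 1))%:E = (k^-1)%:E.
Proof.
move=> k0.
pose F n : set R := `[n.+1%:R^-1%R, 1%R]%classic.
have UF : \bigcup_n F n = `]0%R, 1%R]%classic.
  apply/seteqP; split => u /=.
    move=> [n _]; rewrite /F/= !in_itv/= => /andP[nu ->]; rewrite andbT.
    by rewrite (lt_le_trans _ nu)// invr_gt0.
  rewrite in_itv/= => /andP[u0 u1]; exists (Num.bound u^-1) => //=.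
    rewrite /F/= in_itv/= u1 andbT invf_ple ?posrE//.
  by rewrite (le_trans (ltW (archi_boundP _))) ?ler_nat// invr_ge0 ltW.
have cv : \int[mu]_(u in F n) (u `^ (k - 1))%:E @[n --> \oo] -->
    \int[mu]_(u in `]0%R, 1%R]) (u `^ (k - 1))%:E.
  rewrite -UF; apply: ge0_nondecreasing_set_cvg_integral.
  - apply/nondecreasing_seqP => n; rewrite subsetEset => u; rewrite /F/= !in_itv/=.
    move=> /andP[nu ->]; rewrite andbT (le_trans _ nu)// lef_pV2 ?posrE//.
    by rewrite ler_nat.
  - by move=> n; exact: measurable_itv.
  - by move=> n; apply/measurable_EFinP; apply: measurable_funTS; exact: measurable_powR.
  - by move=> n u _; rewrite lee_fin powR_ge0.
have val n : \int[mu]_(u in F n.+1) (u `^ (k - 1))%:E =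
    (k^-1 - k^-1 * n.+2%:R^-1 `^ k)%:E.
  have n1 : (n.+2%:R^-1 < 1 :> R)%R by rewrite invf_lt1// ltr1n.
  have np : (0 < n.+2%:R^-1 :> R)%R by rewrite invr_gt0.
  rewrite /F (@continuous_FTC2 _ (fun u => u `^ (k - 1))%R (fun u => k^-1 * u `^ k)%R)//.
  - by rewrite powR1 mulr1 EFinB.
  - apply: continuous_in_subspaceT => u; rewrite inE/= in_itv/= => /andP[nu _].
    by apply: continuous_powR; exact: lt_le_trans nu.
  - have cF u : (0 < u)%R -> {for u, continuous (fun u => k^-1 * u `^ k)%R}.
      by move=> u0; apply: cvgM; [exact: cvg_cst|exact: continuous_powR].
    split.
    + move=> u; rewrite in_itv/= => /andP[nu _].
      have u0 := lt_trans np nu.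
      apply: derivableM => //.
      by apply: derivable_powR; rewrite in_itv/= u0.
    + by apply: cvg_at_right_filter; exact: cF.
    + by apply: cvg_at_left_filter; exact: cF.
  - move=> u; rewrite in_itv/= => /andP[nu _]; have u0 := lt_trans np nu.
    have D := is_derive1_powR k u0.
    rewrite derive1E deriveZ; last exact: ex_derive.
    by rewrite derive_val /GRing.scale/= mulrA mulVf ?gt_eqF// mul1r.
have cv2 : (k^-1 - k^-1 * n.+2%:R^-1 `^ k)%R%:E @[n --> \oo] --> (k^-1)%:E.
  apply: cvg_EFin; first by near=> n.
  rewrite -[X in _ --> X]subr0; apply: cvgB; first exact: cvg_cst.
  rewrite -(mulr0 (k^-1)%R); apply: cvgM; first exact: cvg_cst.
  have /cvg_at_rightP := @powR_cvg0 R k k0; apply; split => [n|].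
    by rewrite invr_gt0.
  have := @cvg_harmonic R; rewrite -cvg_shiftS; exact.
rewrite -(cvg_lim _ cv)//; apply/cvg_lim => //.
by rewrite -cvg_shiftS; under eq_fun do rewrite val.
Unshelve. all: by end_near. Qed.

Lemma integral_expR (c : R) : (0 < c)%R ->
  \int[mu]_(u in pos) (expR (- (c * u)))%:E = (c^-1)%:E.
Proof.
move=> c0.
have := integral_exponential_pdf c0.
have -> : \int[mu]_x (exponential_pdf c x)%:E =
    \int[mu]_(x in pos) (c%:E * (expR (- (c * x)))%:E).
  rewrite integral_itv_obnd_cbnd; last first.
    apply: emeasurable_funM => //; apply/measurable_EFinP.
    by apply: measurableT_comp => //; apply: measurableT_comp => //.
  rewrite [RHS]integral_mkcond; apply: eq_integral => x _.
  rewrite patchE mem_setE in_itv/= andbT; case: leP => x0.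
    by rewrite exponential_pdfE// EFinM mulNr.
  by rewrite lt0_exponential_pdf.
rewrite ge0_integralZl//.
- set I := integral _ _ _; have : 0 <= I by apply: integral_ge0 => x _; rewrite lee_fin expR_ge0.
  case: I => [r| |]//=.
    by move=> _ [] rE; congr EFin; apply: (mulfI (lt0r_neq0 c0)); rewrite rE divff ?lt0r_neq0.
  by rewrite gt0_muley ?lte_fin.
- apply/measurable_EFinP; apply: measurableT_comp => //; exact: measurableT_comp.
- by rewrite lee_fin ltW.
Qed.

(** Euler's Gamma function, as an extended real number. *)
Definition gammaE (k : R) : \bar R :=
  \int[mu]_(u in pos) (u `^ (k - 1) * expR (- u))%:E.

Lemma measurable_gamma_integrand (k c : R) (D : set R) :
  measurable_fun D (fun u : R => (u `^ (k - 1) * expR (- (c * u)))%:E).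
Proof.
apply/measurable_EFinP; apply: measurable_funTS; apply: measurable_funM.
  exact: measurable_powR.
by apply: measurableT_comp => //; apply: measurableT_comp => //; exact: measurable_funM.
Qed.

(** The integrand is at most u^{k - 1} on (0, 1] and, as k <= 2, at most
    u e^{- u} <= 2 e^{- u / 2} beyond. *)
Lemma gammaE_lty (k : R) : (0 < k <= 2)%R -> gammaE k < +oo.
Proof.
move=> /andP[k0 k2].
have m1 (D : set R) : measurable_fun D (fun u : R => (u `^ (k - 1))%:E).
  by apply/measurable_EFinP; apply: measurable_funTS; exact: measurable_powR.
have m2 (D : set R) : measurable_fun D (fun u : R => (2 * expR (- (2^-1 * u)))%:E).
  apply/measurable_EFinP; apply: measurable_funTS; apply: measurable_funM => //.
  by apply: measurableT_comp => //; apply: measurableT_comp => //; exact: measurable_funM.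
have m3 (D : set R) : measurable_fun D (fun u : R => (u `^ (k - 1) * expR (- u))%:E).
  have := @measurable_gamma_integrand k 1 D.
  by under eq_fun do rewrite mul1r.
have posE : pos = `]0%R, 1%R]%classic `|` `]1%R, +oo[%classic.
  apply/seteqP; split => u /=; rewrite !in_itv/= ?andbT.
    by move=> u0; rewrite u0; case: (leP u 1%R); [left|right].
  by move=> [/andP[]//|]; exact: lt_trans.
rewrite /gammaE posE ge0_integral_setU//=; first last.
- rewrite disj_set2E; apply/eqP; rewrite -subset0 => u/=.
  by rewrite !in_itv/= andbT => -[/andP[_ u1] /(le_lt_trans u1)]; rewrite ltxx.
- by move=> u _; rewrite lee_fin mulr_ge0 ?powR_ge0 ?expR_ge0.
- exact: m3.
rewrite lte_add_pinfty//.
  apply: (@le_lt_trans _ _ (\int[mu]_(u in `]0%R, 1%R]) (u `^ (k - 1))%:E)).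
    apply: ge0_le_integral => //.
    - by move=> u _; rewrite lee_fin mulr_ge0 ?powR_ge0 ?expR_ge0.
    - exact: m3.
    - exact: m1.
    - move=> u; rewrite /= in_itv/= => /andP[u0 _]; rewrite lee_fin.
      by rewrite ler_piMr ?powR_ge0// -expR0 ler_expR oppr_le0 ltW.
  by rewrite integral_powR01// ltry.
apply: (@le_lt_trans _ _ (\int[mu]_(u in pos) (2 * expR (- (2^-1 * u)))%:E)).
  apply: (@le_trans _ _ (\int[mu]_(u in `]1%R, +oo[) (2 * expR (- (2^-1 * u)))%:E)).
    apply: ge0_le_integral => //.
    - by move=> u _; rewrite lee_fin mulr_ge0 ?powR_ge0 ?expR_ge0.
    - exact: m3.
    - exact: m2.
    - move=> u; rewrite /= in_itv/= andbT => u1; rewrite lee_fin.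
      have uk : (u `^ (k - 1) <= u)%R by apply: ler1_powR; [exact: ltW|lra].
      apply: (@le_trans _ _ (u * expR (- u))%R); first by rewrite ler_wpM2r ?expR_ge0.
      have -> : expR (- u) = (expR (- (2^-1 * u)) * expR (- (2^-1 * u)))%R.
        by rewrite -expRD; congr expR; lra.
      rewrite mulrA ler_wpM2r ?expR_ge0// -ler_pdivlMr ?expR_gt0//.
      rewrite -expRN opprK; have := expR_ge1Dx (2^-1 * u)%R; lra.
  apply: ge0_subset_integral => //.
  - exact: m2.
  - by move=> u /=; rewrite !in_itv/= !andbT; exact: lt_trans.
under eq_integral do rewrite EFinM.
rewrite ge0_integralZl//.
- by rewrite integral_expR// -EFinM ltry.
- apply/measurable_EFinP; apply: measurable_funTS.
  by apply: measurableT_comp => //; apply: measurableT_comp => //; exact: measurable_funM.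
Qed.

Lemma gammaE_ge0 k : 0 <= gammaE k.
Proof. by apply: integral_ge0 => u _; rewrite lee_fin mulr_ge0 ?powR_ge0 ?expR_ge0. Qed.

Lemma gammaE_gt0 (k : R) : (0 < k)%R -> 0 < gammaE k.
Proof.
move=> k0; pose J : set R := `[1%R, 2%R]%classic.
have mg (D : set R) : measurable_fun D (fun u : R => (u `^ (k - 1) * expR (- u))%:E).
  have := @measurable_gamma_integrand k 1 D.
  by under eq_fun do rewrite mul1r.
apply: (@lt_le_trans _ _ (\int[mu]_(u in J) (2^-1 * expR (- 2))%:E)).
  have mJ : mu J = 1%E by rewrite lebesgue_measure_itv/= lte_fin ltr1n/= -EFinB; congr EFin; ring.
  have -> : \int[mu]_(u in J) (2^-1 * expR (- 2))%:E = (2^-1 * expR (- 2))%:E * mu J.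
    by apply: integral_cst; exact: measurable_itv.
  rewrite mJ mule1 lte_fin.
  by rewrite !mulr_gt0 ?expR_gt0//; lra.
apply: (@le_trans _ _ (\int[mu]_(u in J) (u `^ (k - 1) * expR (- u))%:E)).
  apply: ge0_le_integral => //.
  - exact: measurable_itv.
  - exact: mg.
  - move=> u; rewrite /J/= in_itv/= => /andP[u1 u2]; rewrite lee_fin.
    apply: ler_pM; rewrite ?expR_ge0//; last by rewrite ler_expR lerN2.
    have u0 : (0 < u)%R by exact: lt_le_trans u1.
    apply: (@le_trans _ _ (u `^ (-1))%R).
      by rewrite powR_inv1 ?(ltW u0)// lef_pV2 ?posrE.
    by apply: ler_powR => //; lra.
apply: ge0_subset_integral => //.
- exact: measurable_itv.
- exact: mg.
- by move=> u _; rewrite lee_fin mulr_ge0 ?powR_ge0 ?expR_ge0.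
- by move=> u; rewrite /J/= !in_itv/= andbT => /andP[u1 _]; exact: lt_le_trans u1.
Qed.

Lemma gammaE_scale (k c : R) : (0 < c)%R ->
  \int[mu]_(u in pos) (u `^ (k - 1) * expR (- (c * u)))%:E =
  (c `^ (- k))%:E * gammaE k.
Proof.
move=> c0.
pose g u : \bar R := (u `^ (k - 1) * expR (- u))%:E.
have mg : measurable_fun pos g.
  have := @measurable_gamma_integrand k 1 pos.
  by congr measurable_fun; apply/funext => u; rewrite /g mul1r.
have E := @ge0_integral_scale_pos _ c g c0 mg.
transitivity (\int[mu]_(u in pos) ((c `^ (1 - k))%:E * g (c * u)%R)).
  apply: eq_integral => u; rewrite inE/= in_itv/= andbT => u0.
  have cc : (c `^ (1 - k) * c `^ (k - 1) = 1)%R.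
    rewrite -powRD; last by rewrite (gt_eqF c0) implybT.
    by rewrite (_ : 1 - k + (k - 1) = 0)%R ?powRr0//; ring.
  by rewrite /g -EFinM powRM ?(ltW c0) ?(ltW u0)// !mulrA cc mul1r.
rewrite ge0_integralZl//; last 3 first.
- apply/measurable_EFinP; apply: measurable_funTS; apply: measurable_funM.
    apply: (measurableT_comp (f := fun x : R => (x `^ (k - 1))%R)).
      exact: measurable_powR.
    exact: measurable_funM.
  by apply: measurableT_comp => //; apply: measurableT_comp => //.
- by move=> u _; rewrite lee_fin mulr_ge0 ?powR_ge0 ?expR_ge0.
- by rewrite lee_fin powR_ge0.
rewrite E; last by move=> u _; rewrite lee_fin mulr_ge0 ?powR_ge0 ?expR_ge0.
rewrite muleA -EFinM; congr (_%:E * _).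
rewrite -(powR_inv1 (ltW c0)) -powRD; last by rewrite (gt_eqF c0) implybT.
by congr (_ `^ _)%R; ring.
Qed.

End gamma.

(** * Abelian averages *)

Section abelian.
Context (R : realType).
Local Notation mu := (@lebesgue_measure R).
Local Notation pos := (`]0%R, +oo[%classic : set R).
Local Open Scope ereal_scope.

(** [g a] = K a^k + o(a^k) where a^k is large, that is at infinity if [k] is
    positive and at 0 if [k] is negative. The additive constant makes the bound
    uniform over all [a], so that it survives averaging. *)
Definition power_like (g : R -> \bar R) (K k : R) : Prop :=
  forall e : R, (0 < e)%R -> exists2 D : R, (0 <= D)%R &
    forall a : R, (0 < a)%R ->
      (K * a `^ k)%:E <= g a + (e * a `^ k + D)%:E /\
      g a <= ((K + e) * a `^ k + D)%:E.

Definition exp_average (g : R -> \bar R) (l : R) : \bar R :=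
  \int[mu]_(b in pos) ((expR (- b))%:E * g (l * b)%R).

Lemma exp_average_power (k A D l : R) : (-1 < k <= 1)%R -> (0 <= A)%R ->
  (0 <= D)%R -> (0 < l)%R ->
  exp_average (fun a => (A * a `^ k + D)%:E) l =
  (A * fine (gammaE (k + 1)) * l `^ k + D)%:E.
Proof.
move=> /andP[k1 k2] A0 D0 l0.
have gfin : gammaE (k + 1)%R = (fine (gammaE (k + 1)%R))%:E.
  rewrite fineK// ge0_fin_numE ?gammaE_ge0//; apply: gammaE_lty; lra.
have m1 : measurable_fun pos (fun b : R => (expR (- b) * b `^ k)%:E).
  apply/measurable_EFinP; apply: measurable_funTS; apply: measurable_funM.
    exact: measurableT_comp.
  exact: measurable_powR.
have m2 : measurable_fun pos (fun b : R => (expR (- b))%:E).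
  by apply/measurable_EFinP; apply: measurable_funTS; exact: measurableT_comp.
rewrite /exp_average.
transitivity (\int[mu]_(b in pos) ((A * l `^ k)%:E * (expR (- b) * b `^ k)%:E +
    D%:E * (expR (- b))%:E)).
  apply: eq_integral => b; rewrite inE/= in_itv/= andbT => b0.
  rewrite -!EFinM -EFinD powRM ?(ltW l0) ?(ltW b0)//; congr EFin; ring.
rewrite ge0_integralD//; last 4 first.
- by move=> b _; rewrite -EFinM lee_fin !mulr_ge0 ?powR_ge0 ?expR_ge0.
- exact: measurable_funeM.
- by move=> b _; rewrite -EFinM lee_fin mulr_ge0 ?expR_ge0.
- exact: measurable_funeM.
rewrite !ge0_integralZl//; last 2 first.
- by move=> b _; rewrite lee_fin mulr_ge0 ?powR_ge0 ?expR_ge0.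
- by rewrite lee_fin mulr_ge0// powR_ge0.
have -> : \int[mu]_(b in pos) (expR (- b) * b `^ k)%:E = gammaE (k + 1)%R.
  by apply: eq_integral => b _; rewrite addrK mulrC.
have -> : \int[mu]_(b in pos) (expR (- b))%:E = 1.
  have := integral_expR (@ltr01 R); rewrite invr1 => <-.
  by apply: eq_integral => b _; rewrite mul1r.
by rewrite gfin -!EFinM mulr1 -EFinD; congr EFin; ring.
Qed.

Lemma power_like_exp_average (g : R -> \bar R) (K k : R) : (-1 < k <= 1)%R ->
  (0 <= K)%R -> measurable_fun pos g -> (forall a, 0 <= g a) -> power_like g K k ->
  power_like (exp_average g) (K * fine (gammaE (k + 1))) k.
Proof.
move=> k12 K0 mg g0 gK e e0; have /andP[k1 k2] := k12.
have kp : (0 < k + 1)%R by lra.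
have G0 : (0 < fine (gammaE (k + 1)%R))%R.
  by rewrite fine_gt0// gammaE_gt0//= gammaE_lty//; lra.
set G := fine _ in G0 *.
have [D D0 DE] := gK (e / G)%R (divr_gt0 e0 G0).
have eG : (0 <= e / G)%R by rewrite divr_ge0// ltW.
exists D => // l l0.
have lbpos (b : R) : pos b -> (0 < l * b)%R.
  by rewrite /= in_itv/= andbT; exact: mulr_gt0.
have ml (h : R -> \bar R) : measurable_fun pos h ->
    measurable_fun pos (fun b => (expR (- b))%:E * h (l * b)%R).
  move=> mh; apply: emeasurable_funM.
    by apply/measurable_EFinP; apply: measurable_funTS; exact: measurableT_comp.
  apply: (@measurable_comp _ _ _ _ _ _ pos) => //.
  by move=> _ [b /lbpos lb <-]; rewrite /= in_itv/= lb.
have mp A : measurable_fun pos (fun a : R => (A * a `^ k + D)%:E).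
  apply/measurable_EFinP; apply: measurable_funTS; apply: measurable_funD => //.
  by apply: measurable_funM => //; exact: measurable_powR.
have ex0 (b : R) : 0 <= (expR (- b))%:E by rewrite lee_fin expR_ge0.
split.
- have -> : (K * G * l `^ k)%:E = exp_average (fun a => (K * a `^ k + 0)%:E) l.
    by rewrite exp_average_power ?addr0.
  have -> : (e * l `^ k + D)%:E =
      exp_average (fun a => (e / G * a `^ k + D)%:E) l.
    by rewrite exp_average_power// -/G; congr EFin; field; rewrite gt_eqF.
  rewrite /exp_average -ge0_integralD//; first last.
  + exact: (ml (fun a => (e / G * a `^ k + D)%:E)).
  + by move=> b _; rewrite mule_ge0// lee_fin addr_ge0// mulr_ge0// powR_ge0.
  + exact: ml.
  + by move=> b _; rewrite mule_ge0.
  apply: ge0_le_integral => //.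
  + by move=> b _; rewrite mule_ge0// lee_fin addr0 mulr_ge0// powR_ge0.
  + apply: (ml (fun a => (K * a `^ k + 0)%:E)).
    apply/measurable_EFinP; apply: measurable_funTS; apply: measurable_funD => //.
    by apply: measurable_funM => //; exact: measurable_powR.
  + by apply: emeasurable_funD; [exact: ml|exact: (ml (fun a => (e / G * a `^ k + D)%:E))].
  + move=> b /lbpos lb; rewrite -ge0_muleDr//; last first.
      by rewrite lee_fin addr_ge0// mulr_ge0// powR_ge0.
    by apply: lee_wpmul2l => //; rewrite addr0; have [] := DE _ lb.
- have -> : ((K * G + e) * l `^ k + D)%:E =
      exp_average (fun a => ((K + e / G) * a `^ k + D)%:E) l.
    rewrite exp_average_power//; last by rewrite addr_ge0.
    by rewrite -/G; congr EFin; field; rewrite gt_eqF.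
  apply: ge0_le_integral => //.
  + by move=> b _; rewrite mule_ge0.
  + exact: ml.
  + exact: (ml (fun a => ((K + e / G) * a `^ k + D)%:E)).
  + by move=> b /lbpos lb; apply: lee_wpmul2l => //; have [] := DE _ lb.
Qed.

Section transforms.
Variable tau : nat -> R.
Hypothesis tau0 : forall x, (0 < tau x)%R.

Definition counting_function (a : R) : \bar R :=
  \sum_(x <oo) ((tau x <= a)%R%:R)%:E.

Definition laplace_series (y : R) : \bar R :=
  \sum_(x <oo) (expR (- (y * tau x)))%:E.

Definition stieltjes_series (l : R) : \bar R :=
  \sum_(x <oo) ((1 + l * tau x)^-1)%:E.

Lemma measurable_counting_function : measurable_fun setT counting_function.
Proof.
apply: ge0_emeasurable_sum => [k a _ _|k _]; first by rewrite lee_fin.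
apply/measurable_EFinP; apply: measurableT_comp => //.
exact: measurable_fun_ler.
Qed.

Lemma measurable_laplace_series : measurable_fun setT laplace_series.
Proof.
apply: ge0_emeasurable_sum => [k a _ _|k _]; first by rewrite lee_fin expR_ge0.
apply/measurable_EFinP; apply: measurableT_comp => //; apply: measurableT_comp => //.
exact: measurable_funM.
Qed.

(** The integral of e^{- b} over b >= tau / l is e^{- tau / l}. *)
Lemma exp_average_counting (l : R) : (0 < l)%R ->
  exp_average counting_function l = laplace_series l^-1%R.
Proof.
move=> l0; rewrite /exp_average.
have mi x : measurable_fun pos (fun b => ((tau x <= l * b)%R%:R)%:E : \bar R).
  apply/measurable_EFinP; apply: measurable_funTS; apply: measurableT_comp => //.
  by apply: measurable_fun_ler => //; exact: measurable_funM.
under eq_integral => b _ do rewrite /counting_function -nneseriesZl//.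
rewrite integral_nneseries//; last first.
  move=> x; apply: emeasurable_funM; last exact: mi.
  by apply/measurable_EFinP; apply: measurable_funTS; exact: measurableT_comp.
apply: eq_eseriesr => x _.
have u0 : (0 <= l^-1 * tau x)%R by rewrite mulr_ge0 ?invr_ge0 ?(ltW l0) ?(ltW (tau0 x)).
rewrite -(exponential_prob_tail u0).
rewrite [LHS]integral_mkcond [RHS]integral_mkcond; apply: eq_integral => b _.
rewrite !patchE; have -> : (b \in [set v | l^-1 * tau x <= v]%R) = (l^-1 * tau x <= b)%R.
  by apply/idP/idP; rewrite inE.
rewrite mem_setE in_itv/= andbT ler_pdivrMl//.
have [tb|tb] := leP (tau x) (l * b)%R; last by rewrite mule0; case: ifP.
have b0 : (0 < b)%R by rewrite -(pmulr_rgt0 _ l0) (lt_le_trans _ tb).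
by rewrite b0 mule1 exponential_pdfE ?(ltW b0)// mul1r mulN1r.
Qed.

Lemma exp_average_laplace (l : R) : (0 < l)%R ->
  exp_average laplace_series l = stieltjes_series l.
Proof.
move=> l0; rewrite /exp_average.
have me (c : R) : measurable_fun pos (fun b => (expR (- (c * b)))%:E).
  apply/measurable_EFinP; apply: measurable_funTS; apply: measurableT_comp => //.
  by apply: measurableT_comp => //; exact: measurable_funM.
under eq_integral => b _ do rewrite /laplace_series -nneseriesZl//.
have E x b : (expR (- b))%:E * (expR (- (l * b * tau x)))%:E =
    (expR (- ((1 + l * tau x) * b)))%:E.
  by rewrite -EFinM -expRD; congr (expR _)%:E; ring.
rewrite integral_nneseries//; last first.
  move=> x; apply: (eq_measurable_fun (fun b : R => (expR (- ((1 + l * tau x) * b)))%:E)).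
    by move=> b _; rewrite E.
  exact: me.
apply: eq_eseriesr => x _.
under eq_integral => b _ do rewrite E.
by rewrite integral_expR// addr_gt0// mulr_gt0.
Qed.

Lemma power_like_laplace (K k : R) : (0 < k < 1)%R -> (0 <= K)%R ->
  power_like counting_function K k ->
  power_like laplace_series (K * fine (gammaE (1 + k))) (- k).
Proof.
move=> /andP[k0 k1] K0 MK e e0.
have kk : (-1 < k <= 1)%R by rewrite (ltW k1) andbT; lra.
have c0 a : 0 <= counting_function a by apply: nneseries_ge0 => x _ _; rewrite lee_fin.
have [D D0 DE] := power_like_exp_average kk K0
    (measurable_funTS measurable_counting_function) c0 MK e0.
exists D => // a a0.
have := DE a^-1%R; rewrite invr_gt0 a0 exp_average_counting ?invr_gt0// invrK => /(_ isT).
by rewrite -(powR_inv1 (ltW a0)) -powRrM mulN1r [(k + 1)%R]addrC.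
Qed.

Lemma power_like_stieltjes (K k : R) : (0 < k < 1)%R -> (0 <= K)%R ->
  power_like laplace_series K (- k) ->
  power_like stieltjes_series (K * fine (gammaE (1 - k))) (- k).
Proof.
move=> /andP[k0 k1] K0 MK e e0.
have kk : (-1 < - k <= 1)%R by apply/andP; split; lra.
have c0 a : 0 <= laplace_series a.
  by apply: nneseries_ge0 => x _ _; rewrite lee_fin expR_ge0.
have [D D0 DE] := power_like_exp_average kk K0
    (measurable_funTS measurable_laplace_series) c0 MK e0.
exists D; [exact: D0|move=> a a0].
by rewrite -(exp_average_laplace a0) [(1 - k)%R]addrC; exact: DE.
Qed.

End transforms.

End abelian.

(** * Estimates for the cosecant *)

Section sine.
Context (R : realType).
Implicit Types x y : R.

Lemma sin_mvt y : 0 < y -> exists2 c, 0 < c < y & sin y = cos c * y.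
Proof.
move=> y0; have [|c] := @MVT R sin cos 0 y y0 (fun x _ => is_derive_sin x).
  by apply: continuous_subspaceT; exact: continuous_sin.
by rewrite in_itv/= => c0y; rewrite sin0 !subr0; exists c.
Qed.

Lemma sin_le y : 0 <= y -> sin y <= y.
Proof.
rewrite le_eqVlt => /predU1P[<-|y0]; first by rewrite sin0.
by have [c _ ->] := sin_mvt y0; rewrite ler_piMl ?cos_le1// ltW.
Qed.

Lemma sin_ge_cos y : 0 <= y <= pi -> y * cos y <= sin y.
Proof.
move=> /andP[]; rewrite le_eqVlt => /predU1P[<-|y0] ypi.
  by rewrite mul0r sin0.
have [c /andP[c0 cy] ->] := sin_mvt y0; rewrite mulrC ler_pM2r// ltW//.
by rewrite ltr_cos// in_itv/= ?ypi ?(ltW y0)// (ltW c0) (le_trans (ltW cy)).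
Qed.

Lemma sin_double y : sin y = 2 * sin (y / 2) * cos (y / 2).
Proof.
have {1}-> : y = (y / 2) *+ 2 by rewrite -mulr_natr divfK.
by rewrite sin_mulr2n -mulr_natl; ring.
Qed.

Lemma cos_double y : cos y = 1 - 2 * sin (y / 2) ^+ 2.
Proof.
have {1}-> : y = (y / 2) *+ 2 by rewrite -mulr_natr divfK.
by rewrite cos_mulr2n cos2sin2 -mulr_natl; ring.
Qed.

(** By [sin_ge_cos] at y / 2, sin y = 2 sin(y / 2) cos(y / 2) is at least
    y cos^2(y / 2), which is at least y / 2. *)
Lemma sin_ge_half y : 0 <= y <= pi / 2 -> y / 2 <= sin y.
Proof.
move=> /andP[y0 ypi]; have pi0 := @pi_gt0 R.
have c0 : 0 <= cos y by apply: cos_ge0_pihalf; rewrite ypi andbT; lra.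
have ch : 0 <= cos (y / 2) by apply: cos_ge0_pihalf; apply/andP; split; lra.
have := @sin_ge_cos (y / 2); rewrite divr_ge0//= => /(_ _) sc.
have {}sc : y / 2 * cos (y / 2) <= sin (y / 2) by apply: sc; lra.
have c2 : 1 <= 2 * cos (y / 2) ^+ 2.
  by have := cos_double y; rewrite sin2cos2; lra.
rewrite sin_double; apply: (@le_trans _ _ (2 * (y / 2 * cos (y / 2)) * cos (y / 2))).
  have -> : 2 * (y / 2 * cos (y / 2)) * cos (y / 2) =
    y / 2 * (2 * cos (y / 2) ^+ 2) by ring.
  by rewrite ler_peMr// divr_ge0.
by rewrite ler_wpM2r// ler_wpM2l.
Qed.

Lemma cos_ge_square y : 0 <= y -> 1 - cos y <= y ^+ 2 / 2.
Proof.
move=> y0; rewrite cos_double; have yh : 0 <= y / 2 by rewrite divr_ge0.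
suff : sin (y / 2) ^+ 2 <= (y / 2) ^+ 2 by lra.
rewrite -[leLHS]real_normK ?num_real// ler_sqr ?nnegrE// ler_norml.
rewrite (sin_le yh) andbT; have [hp|hp] := leP (y / 2) pi.
  by rewrite (@le_trans _ _ 0)// ?oppr_le0// sin_ge0_pi// yh.
rewrite (@le_trans _ _ (-1)) ?sin_geN1// lerN2 (le_trans _ (ltW hp))//.
by have := @pi_ge2 R; lra.
Qed.

(** By the mean value theorem it suffices to bound the derivative
    (sin^2 c - c^2 cos c) / (c^2 sin^2 c). Since c cos c <= sin c <= c and
    1 - cos c <= c^2 / 2, the numerator is at most c^4 / 2 in absolute value, and
    the denominator is at least c^4 / 4. *)
Lemma cosecant_lipschitz x y : 0 < x -> x <= y -> y <= pi / 2 ->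
  `|((sin y)^-1 - y^-1) - ((sin x)^-1 - x^-1)| <= 2 * (y - x).
Proof.
move=> x0; rewrite le_eqVlt => /predU1P[<-|xy] ypi; first by rewrite !subrr normr0 mulr0.
have sin0' c : 0 < c -> c <= y -> 0 < sin c.
  move=> c0 cy; have : c / 2 <= sin c.
    by apply: sin_ge_half; rewrite ltW//= (le_trans cy).
  by apply: lt_le_trans; rewrite divr_gt0.
have dG c : x <= c -> c <= y -> is_derive c 1 (fun z => (sin z)^-1 - z^-1)
    (- (sin c) ^- 2 * cos c + c ^- 2).
  move=> xc cy; have c0 := lt_le_trans x0 xc; have s0 := sin0' c c0 cy.
  have D1 : is_derive c 1 (fun z : R => (sin z)^-1) (- (sin c) ^- 2 *: cos c).
    by apply: is_deriveV; rewrite gt_eqF.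
  have D2 : is_derive c 1 (fun z : R => z^-1) (- c ^- 2 *: 1).
    by apply: (@is_deriveV _ (fun z => z)); rewrite gt_eqF.
  apply: is_derive_eq; rewrite /GRing.scale/= mulr1; ring.
have [| |c] := MVT xy (f := fun z => (sin z)^-1 - z^-1)
    (df := fun c => - (sin c) ^- 2 * cos c + c ^- 2).
- by move=> c; rewrite in_itv/= => /andP[xc cy]; apply: dG; exact: ltW.
- apply: continuous_in_subspaceT => c; rewrite inE/= in_itv/= => /andP[xc cy].
  apply: differentiable_continuous; apply/derivable1_diffP.
  by have := dG c xc cy => -[].
rewrite in_itv/= => /andP[xc cy] ->.
rewrite normrM (gtr0_norm (x := y - x)) ?subr_gt0// ler_wpM2r ?subr_ge0 ?(ltW xy)//.
have c0 : 0 < c by exact: lt_trans xc.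
have s0 := sin0' c c0 (ltW cy).
have sh : c / 2 <= sin c by apply: sin_ge_half; rewrite ltW//=; lra.
have pi0 := @pi_gt0 R.
have sc : c * cos c <= sin c by apply: sin_ge_cos; rewrite ltW//=; lra.
have sl := sin_le (ltW c0).
have cl := cos_ge_square (ltW c0); have c1 := cos_le1 c.
have cc : 0 <= cos c by apply: cos_ge0_pihalf; apply/andP; split; lra.
have -> : - (sin c) ^- 2 * cos c + c ^- 2 =
    (sin c ^+ 2 - c ^+ 2 * cos c) / (c ^+ 2 * sin c ^+ 2).
  by field; rewrite !gt_eqF.
have den : 0 < c ^+ 2 * sin c ^+ 2 by rewrite mulr_gt0// exprn_gt0.
rewrite normrM normfV (gtr0_norm den) ler_pdivrMr//.
have s2 : c ^+ 2 / 4 <= sin c ^+ 2.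
  have -> : c ^+ 2 / 4 = (c / 2) ^+ 2 by field.
  by rewrite ler_sqr ?nnegrE// ?divr_ge0// ltW.
have c2 : 0 <= c ^+ 2 by exact: sqr_ge0.
have num : `|sin c ^+ 2 - c ^+ 2 * cos c| <= c ^+ 2 * (c ^+ 2 / 2).
  rewrite ler_norml; apply/andP; split.
    have : (c * cos c) ^+ 2 <= sin c ^+ 2.
      by rewrite ler_sqr ?nnegrE ?mulr_ge0// ltW.
    have : c ^+ 2 * (cos c * (1 - cos c)) <= c ^+ 2 * (c ^+ 2 / 2).
      rewrite ler_wpM2l// (le_trans _ cl)// ler_piMl//; lra.
    by rewrite exprMn; lra.
  have : sin c ^+ 2 <= c ^+ 2 by rewrite ler_sqr ?nnegrE// ltW.
  have : c ^+ 2 * (1 - cos c) <= c ^+ 2 * (c ^+ 2 / 2) by rewrite ler_wpM2l.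
  by lra.
apply: (le_trans num).
have : c ^+ 2 * (c ^+ 2 / 4) <= c ^+ 2 * sin c ^+ 2 by rewrite ler_wpM2l.
by lra.
Qed.

(** The triple angle formula at pi / 3 reads (cos + 1) (2 cos - 1)^2 = 0. *)
Lemma cos_pi_third : cos (pi / 3) = 2^-1 :> R.
Proof.
have pi0 := @pi_gt0 R; set y := pi / 3.
have piE : pi = y *+ 2 + y by rewrite /y -mulr_natr; field.
have s0 : 0 < sin y by apply: sin_gt0_pi; rewrite divr_gt0//= /y; lra.
have := @cospi R; rewrite piE cosD cos_mulr2n sin_mulr2n => E.
have E2 := cos2Dsin2 y.
have E3 : cos y * (cos y ^+ 2 + sin y ^+ 2) = cos y by rewrite E2 mulr1.
have /eqP : (cos y + 1) * (2 * cos y - 1) ^+ 2 = 0 by lra.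
rewrite mulf_eq0 sqrf_eq0 => /orP[/eqP c1|/eqP]; last by lra.
have c2 : cos y = -1 by lra.
have : sin y ^+ 2 = 0 by rewrite sin2cos2 c2; ring.
by move/eqP; rewrite sqrf_eq0 gt_eqF.
Qed.

(** Reduce to a common denominator, using
    sin(3 y) = 4 sin y sin(y + pi / 3) sin(y + 2 pi / 3). *)
Lemma cosecant_triple y : 0 < y < pi / 3 ->
  3 * (sin (3 * y))^-1 =
  (sin y)^-1 - (sin (y + pi / 3))^-1 + (sin (y + 2 * (pi / 3)))^-1.
Proof.
move=> /andP[y0 y3]; have pi0 := @pi_gt0 R.
have s0 : 0 < sin y by apply: sin_gt0_pi; lra.
have s1 : 0 < sin (y + pi / 3) by apply: sin_gt0_pi; lra.
have s2 : 0 < sin (y + 2 * (pi / 3)) by apply: sin_gt0_pi; lra.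
have s3 : 0 < sin (3 * y) by apply: sin_gt0_pi; lra.
have w2 : sin (pi / 3) ^+ 2 = 3 / 4 :> R by rewrite sin2cos2 cos_pi_third; field.
have cs := cos2Dsin2 y.
have E1 : sin (y + pi / 3) = cos y * sin (pi / 3) + sin y / 2.
  by rewrite sinD cos_pi_third addrC.
have E2 : sin (y + 2 * (pi / 3)) = cos y * sin (pi / 3) - sin y / 2.
  rewrite mulr_natl sinD cos_mulr2n sin_mulr2n cos_pi_third.
  by rewrite -(mulr_natl (_ * sin _) 2) -(mulr_natl (_ ^+ 2) 2); field.
have P : sin (y + pi / 3) * sin (y + 2 * (pi / 3)) = 3 / 4 - sin y ^+ 2.
  have -> : 3 / 4 = (cos y ^+ 2 + sin y ^+ 2) * (3 / 4) :> R by rewrite cs mul1r.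
  rewrite E1 E2; move: (sin (pi / 3)) w2 => w w2'.
  transitivity (cos y ^+ 2 * w ^+ 2 - sin y ^+ 2 / 4); first by field.
  by rewrite w2'; field.
have E3 : sin (3 * y) = 4 * sin y * (sin (y + pi / 3) * sin (y + 2 * (pi / 3))).
  have -> : 3 * y = y *+ 2 + y by rewrite -mulr_natl; ring.
  rewrite (sinD (y *+ 2)) cos_mulr2n sin_mulr2n P.
  have := cs; move: (sin y) (cos y) => s c E.
  rewrite -(mulr_natl (c * s) 2) -(mulr_natl (c ^+ 2) 2).
  transitivity (s * (2 * c ^+ 2 + (2 * c ^+ 2 - 1))); first by ring.
  by have {E}-> : c ^+ 2 = 1 - s ^+ 2; [lra|field].
have D12 : sin (y + pi / 3) - sin (y + 2 * (pi / 3)) = sin y by rewrite E1 E2; field.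
have P0 : 0 < sin (y + pi / 3) * sin (y + 2 * (pi / 3)) by rewrite mulr_gt0.
move: P D12 s1 s2 E3 s3 s0 {E1 E2}.
move: (sin (y + pi / 3)) (sin (y + 2 * (pi / 3))) (sin (3 * y)) (sin y) => A B C s.
move=> P D A0 B0 E C0 s0; rewrite E.
have sA : s = A - B by [].
have -> : s^-1 - A^-1 + B^-1 = (A * B + s ^+ 2) / (s * (A * B)).
  by rewrite sA; field; rewrite !gt_eqF//= -sA.
have -> : A * B + s ^+ 2 = 3 / 4 by rewrite P subrK.
by field; rewrite !gt_eqF.
Qed.

End sine.

(** * Euler's reflection formula *)

Section alternating_series.
Context (R : realType).
Local Notation mu := (@lebesgue_measure R).
Local Notation unit := (`]0%R, 1%R]%classic : set R).
Implicit Types k : R.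

(** The sum over n of (-1)^n / (n + k), as an integral. *)
Definition half_betaE k : \bar R :=
  (\int[mu]_(r in unit) (r `^ (k - 1) / (1 + r))%:E)%E.

Definition half_beta k : R := fine (half_betaE k).

Lemma measurable_half_beta k :
  measurable_fun unit (fun r : R => (r `^ (k - 1) / (1 + r))%:E).
Proof.
apply/measurable_EFinP.
apply: (eq_measurable_fun (fun r : R => r `^ (k - 1) * (1 + r) `^ (-1))).
  by move=> r; rewrite inE/= in_itv/= => /andP[r0 _]; rewrite powR_inv1//; lra.
apply: measurable_funTS; apply: measurable_funM; first exact: measurable_powR.
apply: (measurableT_comp (f := fun r : R => r `^ (-1))); first exact: measurable_powR.
exact: measurable_funD.
Qed.

Let half_beta_integrand_ge0 k r : unit r -> 0 <= r `^ (k - 1) / (1 + r).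
Proof.
by rewrite /= in_itv/= => /andP[r0 _]; rewrite divr_ge0 ?powR_ge0// addr_ge0// ltW.
Qed.

Lemma half_betaE_ge0 k : (0 <= half_betaE k)%E.
Proof.
by apply: integral_ge0 => r ur; rewrite lee_fin; exact: half_beta_integrand_ge0.
Qed.

Lemma half_betaE_step k : 0 < k -> (half_betaE k + half_betaE (k + 1) = (k^-1)%:E)%E.
Proof.
move=> k0; rewrite -integral_powR01// /half_betaE -ge0_integralD//=.
- apply: eq_integral => r; rewrite inE/= in_itv/= => /andP[r0 r1].
  rewrite -EFinD addrK; congr EFin.
  have -> : r `^ k = r `^ (k - 1) * r.
    by rewrite -[X in _ * X](powRr1 (ltW r0)) -powRD ?subrK// (gt_eqF r0) implybT.
  by field; rewrite gt_eqF// addr_gt0.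
- by move=> r ur; rewrite lee_fin; exact: half_beta_integrand_ge0.
- exact: measurable_half_beta.
- by move=> r ur; rewrite lee_fin; exact: half_beta_integrand_ge0.
- exact: measurable_half_beta.
Qed.

Lemma half_betaE_fin k : 0 < k -> half_betaE k = (half_beta k)%:E.
Proof.
move=> k0; rewrite fineK// ge0_fin_numE ?half_betaE_ge0//.
apply: (@le_lt_trans _ _ (k^-1)%:E); last exact: ltry.
by rewrite -half_betaE_step// leeDl// half_betaE_ge0.
Qed.

Lemma half_beta_ge0 k : 0 <= half_beta k.
Proof. by apply: fine_ge0; exact: half_betaE_ge0. Qed.

#[local] Opaque half_beta half_betaE sin pi.

Lemma half_beta_step k : 0 < k -> half_beta k + half_beta (k + 1) = k^-1.
Proof.
move=> k0; apply: EFin_inj; rewrite EFinD -!half_betaE_fin ?half_betaE_step//.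
by rewrite addr_gt0.
Qed.

Lemma half_beta_le k : 0 < k -> half_beta k <= k^-1.
Proof. by move=> k0; rewrite -half_beta_step// lerDl half_beta_ge0. Qed.

(** The difference D k of the two sides changes sign under k |-> k + 1, because
    both sides satisfy the recursion [half_beta_step] up to the same term; and
    it tends to 0 at infinity. *)
Lemma half_beta_triple k : 0 < k ->
  3 * half_beta k =
  half_beta (k / 3) - half_beta ((k + 1) / 3) + half_beta ((k + 2) / 3).
Proof.
pose D k := 3 * half_beta k -
  (half_beta (k / 3) - half_beta ((k + 1) / 3) + half_beta ((k + 2) / 3)).
have D1 l : 0 < l -> D (l + 1) = - D l.
  move=> l0; have s1 := half_beta_step l0.
  have l3 : 0 < l / 3 by rewrite divr_gt0.
  have s2 := half_beta_step l3.
  have E1 : (l + 1 + 1) / 3 = (l + 2) / 3 by congr (_ / 3); ring.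
  have E2 : (l + 1 + 2) / 3 = l / 3 + 1 by field.
  have E3 : (l / 3)^-1 = 3 * l^-1 by rewrite invfM invrK mulrC.
  rewrite /D E1 E2; move: s1 s2; rewrite E3 {D E1 E2 E3 l3 l0}.
  move: (half_beta ((l + 1) / 3)) (half_beta ((l + 2) / 3)) => t1 t2.
  move: (half_beta (l / 3)) (half_beta (l / 3 + 1)) => t3 t4.
  by move: (half_beta l) (half_beta (l + 1)) (l^-1) => t5 t6 t7; lra.
have Dn n l : 0 < l -> `|D (l + n%:R)| = `|D l|.
  move=> l0; elim: n => [|n IH]; first by rewrite addr0.
  by rewrite -natr1 addrA D1 ?normrN// ltr_wpDr.
have Db l : 0 < l -> `|D l| <= 12 / l.
  move=> l0; have b0 := half_beta_le l0; have a0 := half_beta_ge0 l.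
  have l3 : 0 < l / 3 by rewrite divr_gt0.
  have b x : l / 3 <= x -> 0 <= half_beta x <= 3 / l.
    move=> lx; rewrite half_beta_ge0/= (le_trans (half_beta_le (lt_le_trans l3 lx)))//.
    rewrite -[3 / l]invrK lef_pV2 ?posrE ?(lt_le_trans l3 lx)// ?invr_gt0 ?divr_gt0//.
    by rewrite invfM invrK mulrC.
  have /andP[x1 y1] := b (l / 3) (lexx _).
  have /b/andP[x2 y2] : l / 3 <= (l + 1) / 3 by rewrite ler_pM2r ?invr_gt0// lerDl.
  have /b/andP[x3 y3] : l / 3 <= (l + 2) / 3 by rewrite ler_pM2r ?invr_gt0// lerDl.
  rewrite /D ler_norml; move: x1 y1 x2 y2 x3 y3 a0 b0.
  move: (half_beta (l / 3)) (half_beta ((l + 1) / 3)) (half_beta ((l + 2) / 3)).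
  move: (half_beta l) (l^-1) => {b D1 Dn l0 l3} t m t1 t2 t3 *.
  by apply/andP; split; lra.
move=> k0; apply/eqP; rewrite -subr_eq0 -normr_eq0 eq_le normr_ge0 andbT -/(D k).
apply/ler_addgt0Pl => e e0; rewrite addr0.
pose n := Num.bound (12 / e).
have n0 : 0 < k + n%:R by rewrite ltr_wpDr.
rewrite -(Dn n)// (le_trans (Db _ n0))// ler_pdivrMr// mulrC -ler_pdivrMr//.
have := archi_boundP (divr_ge0 (ler0n R 12) (ltW e0)); rewrite -/n; lra.
Qed.

(** r^x - r^y <= 1 - r^{y - x} <= (y - x) |ln r|, and |ln r| <= 2 r^{- 1 / 2}. *)
Lemma powR_sub_le (r x y : R) : 0 < r <= 1 -> 0 <= x -> x <= y ->
  0 <= r `^ x - r `^ y <= (y - x) * (2 * r `^ (- 2^-1)).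
Proof.
move=> r01 x0 xy; have /andP[r0 r1] := r01; apply/andP; split.
  by rewrite subr_ge0; exact: ger_powR.
have lr : - ln r <= 2 * r `^ (- 2^-1).
  have : ln (r `^ (- 2^-1)) <= r `^ (- 2^-1) by apply/ltW/ln_sublinear; rewrite powR_gt0.
  by rewrite ln_powR; lra.
have lr0 : 0 <= - ln r by rewrite oppr_ge0 ln_le0.
have e1 : 1 - (y - x) * - ln r <= r `^ (y - x).
  by rewrite /powR gt_eqF//; have := expR_ge1Dx ((y - x) * ln r); lra.
have rx : r `^ y = r `^ x * r `^ (y - x).
  rewrite -powRD; last by rewrite (gt_eqF r0) implybT.
  by congr powR; ring.
have rx1 : r `^ x <= 1 by rewrite -(powRr0 r); exact: ger_powR.
have rx0 := powR_ge0 r x.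
rewrite rx -[X in X - _]mulr1 -mulrBr (le_trans (_ : _ <= 1 * ((y - x) * - ln r)))//.
  by apply: ler_pM => //; [rewrite subr_ge0 -(powRr0 r); apply: ger_powR => //; lra|lra].
by rewrite mul1r ler_wpM2l// subr_ge0.
Qed.

Lemma half_beta_lipschitz (x y : R) : 1 <= x -> x <= y ->
  `|half_beta x - half_beta y| <= 4 * (y - x).
Proof.
move=> x1 xy; have x0 : 0 < x by lra. have y0 : 0 < y by lra.
have bound (r : R) : unit r -> 0 <= r `^ (x - 1) - r `^ (y - 1) <=
    (y - x) * (2 * r `^ (2^-1 - 1)).
  rewrite /= in_itv/= => r01.
  have := @powR_sub_le r (x - 1) (y - 1) r01.
  rewrite !subr_ge0 lerD2r (_ : y - 1 - (x - 1) = y - x); last by ring.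
  by rewrite (_ : - 2^-1 = 2^-1 - 1 :> R); [apply|field].
have div1 r : unit r -> 0 < (1 + r)^-1 <= 1.
  rewrite /= in_itv/= => /andP[r0 r1]; have : 0 < 1 + r by lra.
  by move=> r2; rewrite invr_gt0 r2 invf_le1//; lra.
have le1 : (half_betaE y <= half_betaE x)%E.
  apply: ge0_le_integral => //.
  - by move=> r ur; rewrite lee_fin; exact: half_beta_integrand_ge0.
  - exact: measurable_half_beta.
  - exact: measurable_half_beta.
  - move=> r ur; rewrite lee_fin; have /andP[d0 _] := div1 r ur.
    by rewrite ler_pM2r// -subr_ge0; have /andP[] := bound r ur.
have le2 : (half_betaE x <= half_betaE y + (4 * (y - x))%:E)%E.
  have -> : (4 * (y - x))%:E =
      (\int[mu]_(r in unit) ((2 * (y - x))%:E * (r `^ (2^-1 - 1))%:E))%E.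
    rewrite ge0_integralZl//; last 3 first.
    - by apply/measurable_EFinP; apply: measurable_funTS; exact: measurable_powR.
    - by move=> r _; rewrite lee_fin powR_ge0.
    - by rewrite lee_fin mulr_ge0// subr_ge0.
    by rewrite integral_powR01// invrK -EFinM; congr EFin; ring.
  have mw : measurable_fun unit
      (fun r : R => ((2 * (y - x))%:E * (r `^ (2^-1 - 1))%:E)%E).
    apply: measurable_funeM; apply/measurable_EFinP; apply: measurable_funTS.
    exact: measurable_powR.
  rewrite -ge0_integralD//; last 3 first.
  - by move=> r ur; rewrite lee_fin; exact: half_beta_integrand_ge0.
  - exact: measurable_half_beta.
  - by move=> r _; rewrite -EFinM lee_fin !mulr_ge0 ?powR_ge0// subr_ge0.
  apply: ge0_le_integral => //.
  - by move=> r ur; rewrite lee_fin; exact: half_beta_integrand_ge0.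
  - exact: measurable_half_beta.
  - by apply: emeasurable_funD; [exact: measurable_half_beta|exact: mw].
  - move=> r ur; rewrite -EFinM -EFinD lee_fin -lerBlDl -mulrBl.
    have /andP[b0 b1] := bound r ur; have /andP[/ltW d0 d1] := div1 r ur.
    by rewrite (le_trans (ler_piMr b0 d1))// (le_trans b1)//; lra.
move: le1 le2; rewrite !half_betaE_fin// -EFinD !lee_fin => le1 le2.
move: le1 le2 xy; move: (half_beta x) (half_beta y) => bx byy; clear.
by rewrite ler_norml => *; apply/andP; split; lra.
Qed.

End alternating_series.

Section reflection.
#[local] Opaque half_beta half_betaE sin pi.
Context (R : realType).
Local Notation mu := (@lebesgue_measure R).
Local Notation pos := (`]0%R, +oo[%classic : set R).
Implicit Types a b x y : R.

Let q a : R := pi / sin (pi * a) - a^-1 - (1 - a)^-1.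

Let q_sym a : q (1 - a) = q a.
Proof.
rewrite /q subKr; have -> : pi * (1 - a) = - (pi * a) + pi by ring.
by rewrite sinDpi sinN opprK; ring.
Qed.

Let q_lipschitz_half x y : 0 < x -> x <= y -> y <= 2^-1 ->
  `|q y - q x| <= (2 * pi ^+ 2 + 4) * (y - x).
Proof.
move=> x0 xy y2; have pi0 := @pi_gt0 R.
have px : 0 < pi * x by rewrite mulr_gt0.
have pxy : pi * x <= pi * y by rewrite ler_pM2l.
have py : pi * y <= pi / 2 by rewrite ler_pM2l.
have L := cosecant_lipschitz px pxy py.
have xn : x != 0 by rewrite gt_eqF.
have yn : y != 0 by rewrite gt_eqF// (lt_le_trans x0).
have pn : pi != 0 :> R by rewrite gt_eqF.
have -> : q y - q x = pi * (((sin (pi * y))^-1 - (pi * y)^-1) -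
    ((sin (pi * x))^-1 - (pi * x)^-1)) - ((1 - y)^-1 - (1 - x)^-1).
  have pK (z : R) : pi * (pi * z)^-1 = z^-1 by rewrite invfM mulVKf.
  by rewrite /q !mulrBr !pK; ring.
rewrite (le_trans (ler_normB _ _))// (mulrDl (2 * pi ^+ 2)) lerD//.
  rewrite normrM (gtr0_norm pi0).
  have -> : 2 * pi ^+ 2 * (y - x) = pi * (2 * (pi * y - pi * x)) :> R by ring.
  by rewrite ler_pM2l.
have y1 : 0 < 1 - y by lra.
have x1 : 0 < 1 - x by lra.
have -> : (1 - y)^-1 - (1 - x)^-1 = (y - x) * ((1 - y)^-1 * (1 - x)^-1).
  by field; rewrite !gt_eqF.
rewrite ger0_norm; last by rewrite !mulr_ge0 ?invr_ge0 ?subr_ge0//; lra.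
rewrite mulrC ler_wpM2r ?subr_ge0// (_ : 4 = 2 * 2); last by ring.
have i (z : R) : 2^-1 <= 1 - z -> (1 - z)^-1 <= 2.
  by move=> z2; rewrite invf_ple ?posrE//; lra.
by apply: ler_pM; rewrite ?invr_ge0 ?i//; lra.
Qed.

Let q_lipschitz x y : 0 < x -> x <= y -> y < 1 ->
  `|q y - q x| <= (2 * pi ^+ 2 + 4) * (y - x).
Proof.
move=> x0 xy y1; have c0 : 0 <= 2 * pi ^+ 2 + 4 :> R.
  by have := sqr_ge0 (@pi R); lra.
have [y2|y2] := leP y 2^-1; first exact: q_lipschitz_half.
have [x2|x2] := leP x 2^-1; last first.
  rewrite -(q_sym x) -(q_sym y) distrC.
  by have := @q_lipschitz_half (1 - y) (1 - x); rewrite (_ : 1 - x - (1 - y) = y - x);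
    [apply; lra|ring].
rewrite -(q_sym y); have [xy1|xy1] := leP x (1 - y).
  apply: le_trans (q_lipschitz_half x0 xy1 _) _; first by lra.
  by apply: ler_wpM2l => //; lra.
rewrite distrC; apply: le_trans (q_lipschitz_half _ (ltW xy1) _) _; [lra|lra|].
by apply: ler_wpM2l => //; lra.
Qed.

(** Herglotz's trick. The difference h of the two sides extends to a Lipschitz
    function, since the poles 1 / a and 1 / (1 - a) cancel, and it satisfies
    3 h a = h (a / 3) - h ((a + 1) / 3) + h ((a + 2) / 3). This identity divides
    the Lipschitz constant by 3, so that h is constant; the constant c satisfies
    3 c = c. *)
Lemma half_beta_reflection a : 0 < a < 1 ->
  half_beta a + half_beta (1 - a) = pi / sin (pi * a).
Proof.
pose h (z : R) : R := half_beta z + half_beta (1 - z) - pi / sin (pi * z).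
pose L : R := 8 + (2 * pi ^+ 2 + 4).
have L0 : 0 <= L by rewrite /L; have := sqr_ge0 (@pi R); lra.
have hE (z : R) : 0 < z < 1 -> h z = - half_beta (z + 1) - half_beta (1 - z + 1) - q z.
  move=> /andP[z0 z1]; have z1' : 0 < 1 - z by lra.
  move: (half_beta_step z0) (half_beta_step z1'); rewrite /h /q.
  move: (half_beta (z + 1)) (half_beta (1 - z + 1)) (pi / _) => t1 t2 t3.
  move: (half_beta z) (half_beta (1 - z)) (z^-1) ((1 - z)^-1) => t4 t5 t6 t7.
  by clear; lra.
have Lh (x y : R) : 0 < x -> x <= y -> y < 1 -> `|h y - h x| <= L * (y - x).
  move=> x0 xy y1; rewrite !hE; last 2 first.
  - by rewrite x0 (le_lt_trans xy).
  - by rewrite y1 (lt_le_trans x0).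
  have b1 := @half_beta_lipschitz R (x + 1) (y + 1).
  have b2 := @half_beta_lipschitz R (1 - y + 1) (1 - x + 1).
  have b3 := q_lipschitz x0 xy y1.
  have {}b1 : `|half_beta (x + 1) - half_beta (y + 1)| <= 4 * (y - x).
    by have -> : y - x = y + 1 - (x + 1) by [ring]; apply: b1; lra.
  have {}b2 : `|half_beta (1 - y + 1) - half_beta (1 - x + 1)| <= 4 * (y - x).
    by have -> : y - x = 1 - x + 1 - (1 - y + 1) by [ring]; apply: b2; lra.
  move: b1 b2 b3; rewrite /L; move: (2 * pi ^+ 2 + 4) (half_beta _) (half_beta _).
  move=> c t1 t2; move: (half_beta _) (half_beta _) (q x) (q y) => t3 t4 q1 q2.
  rewrite !ler_norml => /andP[? ?] /andP[? ?] /andP[? ?].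
  by apply/andP; split; lra.
have tr (z : R) : 0 < z < 1 -> 3 * h z = h (z / 3) - h ((z + 1) / 3) + h ((z + 2) / 3).
  move=> /andP[z0 z1]; have pi0 := @pi_gt0 R.
  have t1 := half_beta_triple z0.
  have z1' : 0 < 1 - z by rewrite subr_gt0.
  have t2 := half_beta_triple z1'.
  have z3 : 0 < pi * z / 3 < pi / 3.
    have pz : 0 < pi * z by exact: mulr_gt0.
    rewrite divr_gt0//=; apply: (@le_lt_trans _ _ (pi * z * 3^-1)) => //.
    by rewrite (ltr_pM2r (x := 3^-1)) ?invr_gt0// gtr_pMr.
  have t3 := cosecant_triple z3.
  rewrite /h mulrBr mulrDr t1 t2.
  have -> : 1 - z / 3 = (1 - z + 2) / 3 by field.
  have -> : 1 - (z + 1) / 3 = (1 - z + 1) / 3 by field.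
  have -> : 1 - (z + 2) / 3 = (1 - z) / 3 by field.
  have -> : 3 * (pi / sin (pi * z)) = pi * (3 * (sin (pi * z))^-1) by ring.
  have -> : pi * z = 3 * (pi * z / 3) by field.
  rewrite t3.
  have -> : pi * (z / 3) = pi * z / 3 by ring.
  have -> : pi * ((z + 1) / 3) = pi * z / 3 + pi / 3 by field.
  have -> : pi * ((z + 2) / 3) = pi * z / 3 + 2 * (pi / 3) by field.
  move: (half_beta _) (half_beta _) (half_beta _) => b1 b2 b3.
  move: (half_beta _) (half_beta _) (half_beta _) => b4 b5 b6.
  move: (sin _)^-1 (sin _)^-1 (sin _)^-1 => s1 s2 s3.
  by clear; move: (pi : R) => p; ring.
have contr n (x y : R) : 0 < x -> x <= y -> y < 1 -> `|h y - h x| <= L / 3 ^+ n * (y - x).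
  elim: n x y => [|n IH] x y x0 xy y1; first by rewrite expr0 divr1; exact: Lh.
  have i (j : R) : 0 <= j -> j <= 2%:R -> `|h ((y + j) / 3) - h ((x + j) / 3)| <=
      L / 3 ^+ n * ((y - x) / 3).
    move=> j0 j2.
    have -> : (y - x) / 3 = (y + j) / 3 - (x + j) / 3 by field.
    by apply: IH; lra.
  have := i 0 (lexx _) (ler0n R 2).
  have := i 1 (ler0n R 1) (ler1n R 2); have := i 2 (ler0n R 2) (lexx _).
  have E : 3 * (L / 3 ^+ n.+1 * (y - x)) = 3 * (L / 3 ^+ n * ((y - x) / 3)).
    by rewrite exprS; field; rewrite expf_neq0.
  have -> : h y - h x = (3 * h y - 3 * h x) / 3 by field.
  rewrite !tr ?(lt_le_trans x0)// ?x0 ?(le_lt_trans xy)// !addr0.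
  move: E; move: (L / 3 ^+ n.+1 * (y - x)) (L / 3 ^+ n * ((y - x) / 3)).
  move=> B B' BB; rewrite !ler_norml => /andP[? ?] /andP[? ?] /andP[? ?].
  by apply/andP; split; lra.
have const (x y : R) : 0 < x -> x <= y -> y < 1 -> h y = h x.
  move=> x0 xy y1; apply/eqP; rewrite -subr_eq0 -normr_eq0 eq_le normr_ge0 andbT.
  apply/ler_addgt0Pl => e e0; rewrite addr0.
  pose n := Num.bound (L * (y - x) / e).
  apply: (le_trans (contr n _ _ x0 xy y1)).
  have n3 : n%:R <= 3 ^+ n :> R by rewrite -natrX ler_nat ltnW// ltn_expl.
  rewrite mulrAC ler_pdivrMr ?exprn_gt0// [leRHS]mulrC -ler_pdivrMr//.
  apply: le_trans n3; apply/ltW; apply: archi_boundP.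
  by rewrite divr_ge0 ?mulr_ge0 ?subr_ge0// ltW.
move=> /andP[a0 a1]; apply/eqP; rewrite -subr_eq0; apply/eqP.
have aa : 0 < a < 1 by rewrite a0.
have := tr a aa.
have -> : h (a / 3) = h a by apply/esym/const; lra.
have -> : h ((a + 2) / 3) = h a by apply: const; lra.
have -> : h ((a + 1) / 3) = h a.
  by have [?|?] := leP a ((a + 1) / 3); [apply: const|apply/esym/const]; lra.
by rewrite /h; lra.
Qed.

End reflection.

(** * Products of Gamma integrals *)

Section gamma_product.
Context (R : realType).
Local Notation mu := (@lebesgue_measure R).
Local Notation pos := (`]0%R, +oo[%classic : set R).
Local Open Scope ereal_scope.
Implicit Types a b : R.

(** Extended by 0, so that Tonelli's theorem applies on the whole plane. *)
Definition gamma_density a (u : R) : R :=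
  ((0 < u)%R%:R * (u `^ (a - 1) * expR (- u)))%R.

Lemma gamma_density_ge0 a u : (0 <= gamma_density a u)%R.
Proof. by rewrite /gamma_density !mulr_ge0 ?powR_ge0 ?expR_ge0. Qed.

Lemma measurable_gamma_density a : measurable_fun setT (gamma_density a).
Proof.
apply: measurable_funM; last apply: measurable_funM.
- apply: measurableT_comp => //; exact: measurable_fun_ltr.
- exact: measurable_powR.
- exact: measurableT_comp.
Qed.

Lemma gammaE_density a : gammaE a = \int[mu]_u (gamma_density a u)%:E.
Proof.
rewrite /gammaE integral_mkcond; apply: eq_integral => u _.
by rewrite patchE mem_setE in_itv/= andbT /gamma_density; case: ifP; rewrite ?mul1r ?mul0r.
Qed.

Lemma measurable_itv01 (b : bool) :
  measurable_fun setT (fun r : R => (r \in Interval (BRight 0%R) (BSide b 1%R))%:R : R).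
Proof.
rewrite (_ : (fun r => _) = \1_[set` Interval (BRight 0%R) (BSide b 1%R)]) //.
  apply/funext => r; rewrite indicE mem_setE//.
Qed.

(** In the coordinates u and r = v / u, the exponents add up to 0 and the
    integrand becomes r^{b - 1} e^{- (1 + r) u}, whose integral over u is
    r^{b - 1} / (1 + r). The power u `^ (-1) is the inverse for positive u and
    is measurable in u. *)
Lemma gamma_sector a b (c : bool) : (a + b = 1)%R ->
  \int[mu]_u \int[mu]_v (gamma_density a u * gamma_density b v *
    (u `^ (-1) * v \in Interval (BRight 0%R) (BSide c 1%R))%R%:R)%:E =
  \int[mu]_(r in [set` Interval (BRight 0%R) (BSide c 1%R)])
    (r `^ (b - 1) / (1 + r))%:E.
Proof.
move=> ab; set J := Interval _ _.
pose k (u r : R) : R :=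
  ((0 < u)%R%:R * (r \in J)%:R * (r `^ (b - 1) * expR (- ((1 + r) * u))))%R.
have mk : measurable_fun setT (fun x : R * R => (k x.1 x.2)%:E).
  apply/measurable_EFinP; apply: measurable_funM; first apply: measurable_funM.
  - apply: measurableT_comp => //; exact: measurable_fun_ltr.
  - by apply: (measurableT_comp (measurable_itv01 c)).
  - apply: measurable_funM.
      by apply: (measurableT_comp (f := fun r : R => (r `^ (b - 1))%R)).
    apply: measurableT_comp => //; apply: measurableT_comp => //.
    by apply: measurable_funM => //; exact: measurable_funD.
have k0 x : 0 <= (k x.1 x.2)%:E.
  by rewrite lee_fin /k !mulr_ge0 ?powR_ge0 ?expR_ge0.
transitivity (\int[mu]_u \int[mu]_r (k u r)%:E).
  apply: eq_integral => u _; have [u0|u0] := ltP 0%R u; last first.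
    rewrite !integral0_eq// => v _.
      by rewrite /k ltNge u0 !mul0r.
    by rewrite /gamma_density ltNge u0 !mul0r.
  pose g v : \bar R := (gamma_density a u * gamma_density b v * (u `^ (-1) * v \in J)%R%:R)%:E.
  have mg : measurable_fun setT g.
    apply/measurable_EFinP; apply: measurable_funM.
      by apply: measurable_funM => //; exact: measurable_gamma_density.
    apply: (measurableT_comp (measurable_itv01 c)); exact: measurable_funM.
  have g0 v : 0 <= g v.
    by rewrite lee_fin mulr_ge0// mulr_ge0 ?gamma_density_ge0.
  have := ge0_integral_scale u0 mg g0 => /(congr1 (fun z => u%:E * z)).
  rewrite muleA -EFinM mulfV ?gt_eqF// mul1e => <-.
  have mgu : measurable_fun setT (fun r => g (u * r)%R).
    by apply: measurableT_comp => //; exact: measurable_funM.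
  rewrite -ge0_integralZl//; last by rewrite lee_fin ltW.
  apply: eq_integral => r _; rewrite /g /k -EFinM; congr EFin.
  rewrite powR_inv1 ?(ltW u0)// mulKf ?gt_eqF//; case: (boolP (r \in J)) => rJ; last by rewrite !(mulr0,mul0r).
  have r0 : (0 < r)%R by move: rJ; rewrite in_itv => /andP[].
  rewrite /gamma_density u0 mulr_gt0// !mul1r !mulr1 powRM ?(ltW u0) ?(ltW r0)//.
  have -> : expR (- ((1 + r) * u)) = (expR (- u) * expR (- (u * r)))%R.
    by rewrite -expRD; congr expR; ring.
  have uu : (u * (u `^ (a - 1) * u `^ (b - 1)) = 1)%R.
    rewrite -[X in (X * _)%R](powRr1 (ltW u0)) -!powRD ?(gt_eqF u0) ?implybT//.
    by rewrite (_ : 1 + _ = 0)%R ?powRr0//; lra.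
  transitivity (u * (u `^ (a - 1) * u `^ (b - 1)) *
    (r `^ (b - 1) * (expR (- u) * expR (- (u * r)))))%R; first by ring.
  by rewrite uu mul1r.
rewrite (@fubini_tonelli _ _ _ _ _ mu mu (fun x => (k x.1 x.2)%:E))//=.
rewrite [RHS]integral_mkcond; apply: eq_integral => r _.
rewrite patchE mem_setE; case: ifPn => rJ; last first.
  by rewrite integral0_eq// => u _; rewrite /k (negbTE rJ) mulr0 mul0r.
have r0 : (0 < 1 + r)%R.
  by move: rJ; rewrite in_itv => /andP[/= r0 _]; rewrite addr_gt0.
rewrite EFinM -(integral_expR r0) -ge0_integralZl//; last 2 first.
- apply/measurable_EFinP; apply: measurable_funTS; apply: measurableT_comp => //.
  by apply: measurableT_comp => //; exact: measurable_funM.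
- by rewrite lee_fin powR_ge0.
rewrite [RHS]integral_mkcond; apply: eq_integral => u _.
rewrite patchE mem_setE in_itv/= andbT /k rJ mulr1.
by case: ifPn => u0; rewrite ?mul1r ?mul0r ?EFinM.
Qed.

(** Split the quadrant along the diagonal, and exchange the two variables on one
    side. *)
Lemma gammaE_mul a b : (0 < a)%R -> (0 < b)%R -> (a + b = 1)%R ->
  gammaE a * gammaE b = (half_beta a + half_beta b)%:E.
Proof.
move=> a0 b0 ab; pose J c : interval R := Interval (BRight 0%R) (BSide c 1%R).
pose F u v : R := (gamma_density a u * gamma_density b v)%R.
pose G c u v : R := (F u v * (u `^ (-1) * v \in J c)%R%:R)%R.
pose G' u v : R := (F u v * (v `^ (-1) * u \in J true)%R%:R)%R.
have mF : measurable_fun setT (fun x : R * R => F x.1 x.2).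
  by apply: measurable_funM; apply: (measurableT_comp (@measurable_gamma_density _)).
have FG u v : F u v = (G false u v + G' u v)%R.
  rewrite /G/G' -mulrDr /F /gamma_density.
  have [u0|] := ltP 0%R u; last by rewrite !mul0r.
  have [v0|] := ltP 0%R v; last by rewrite !(mul0r,mulr0).
  rewrite !powR_inv1 ?(ltW u0) ?(ltW v0)//.
  rewrite !in_itv/= !mulr_gt0 ?invr_gt0//= ler_pdivrMl// ltr_pdivrMl// !mulr1.
  by case: leP; rewrite ?addr0 ?add0r ?mulr1.
have ga : gammaE a * gammaE b = \int[mu]_u \int[mu]_v (F u v)%:E.
  rewrite !gammaE_density -ge0_integralZr//; last 3 first.
  - by apply/measurable_EFinP; exact: measurable_gamma_density.
  - by move=> u _; rewrite lee_fin gamma_density_ge0.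
  - by apply: integral_ge0 => u _; rewrite lee_fin gamma_density_ge0.
  apply: eq_integral => u _; rewrite -ge0_integralZl//.
  - by apply/measurable_EFinP; exact: measurable_gamma_density.
  - by move=> v _; rewrite lee_fin gamma_density_ge0.
  - by rewrite lee_fin gamma_density_ge0.
have mG : measurable_fun setT (fun x : R * R => (G false x.1 x.2)%:E).
  apply/measurable_EFinP; apply: measurable_funM => //.
  apply: (measurableT_comp (measurable_itv01 false)); apply: measurable_funM => //.
  by apply: (measurableT_comp (f := fun r : R => (r `^ (-1))%R)).
have mG' : measurable_fun setT (fun x : R * R => (G' x.1 x.2)%:E).
  apply/measurable_EFinP; apply: measurable_funM => //.
  apply: (measurableT_comp (measurable_itv01 true)); apply: measurable_funM => //.
  by apply: (measurableT_comp (f := fun r : R => (r `^ (-1))%R)).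
have F0 u v : (0 <= F u v)%R by rewrite mulr_ge0 ?gamma_density_ge0.
have G0 (x : R * R) : 0 <= (G false x.1 x.2)%:E by rewrite lee_fin mulr_ge0.
have G'0 (x : R * R) : 0 <= (G' x.1 x.2)%:E by rewrite lee_fin mulr_ge0.
transitivity (\int[mu \x mu]_x (G false x.1 x.2)%:E + \int[mu \x mu]_x (G' x.1 x.2)%:E).
  rewrite ga -ge0_integralD//.
  rewrite -(@fubini_tonelli1 _ _ _ _ _ mu mu (fun x => (F x.1 x.2)%:E))//; last 2 first.
  - exact/measurable_EFinP.
  - by move=> x; rewrite lee_fin.
  by apply: eq_integral => x _; rewrite FG EFinD.
rewrite [X in X + _]fubini_tonelli1// [X in _ + X]fubini_tonelli2//.
rewrite /fubini_F/fubini_G /=.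
have -> : \int[mu]_u \int[mu]_v (G false u v)%:E = (half_beta b)%:E.
  by rewrite gamma_sector// -half_betaE_fin.
have -> : \int[mu]_v \int[mu]_u (G' u v)%:E = (half_beta a)%:E.
  rewrite -half_betaE_fin// /half_betaE.
  transitivity (\int[mu]_(r in [set` J true]) (r `^ (a - 1) / (1 + r))%:E).
    have ba : (b + a = 1)%R by rewrite addrC.
    rewrite -(gamma_sector true ba).
    apply: eq_integral => v _; apply: eq_integral => u _.
    by rewrite /G' /F [(gamma_density a u * _)%R]mulrC.
  apply: integral_itv_bndo_bndc.
  have JS : [set` J true] `<=` [set` J false].
    by move=> r /=; rewrite !in_itv/= => /andP[-> r1]; exact: ltW.
  exact: (measurable_funS (measurable_itv (J false)) JS (@measurable_half_beta R a)).
by rewrite addeC -EFinD.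
Qed.

End gamma_product.

(** * Renewal measures of the sites *)

Section renewal.
Context d (Omega : measurableType d) (R : realType) (P : probability Omega R).
Variables (theta T : nat -> nat -> {RV P >-> R}).
Hypothesis hD : K_drivers theta T.
Variable f : nat -> R.
Hypothesis f0 : forall x, 0 < f x.
Hypothesis sf : (\sum_(x <oo) (f x)%:E < +oo)%E.
Let Y x i := pre_jump theta T f x i.
Let mY x i : measurable_fun setT (Y x i) := measurable_pre_jump theta T f0 x i.
Let tau x := (f x)^-1.

Let Y_ge0 x i w : 0 <= Y x i w.
Proof. by apply: fine_ge0; apply: pre_clock_ge0. Qed.

Let law x i : {measure set R -> \bar R} :=
  measure_function_pushforward__canonical__measure_function_Measure P (mY x i).

(** The expected number of events of site [x] whose preceding clock value lies in
    a given set. *)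
Definition renewal_measure x : {measure set R -> \bar R} := mseries (law x) 0.
Local Notation U := renewal_measure.

Lemma ge0_integral_renewal x (h : R -> \bar R) : measurable_fun setT h ->
  (forall y, 0 <= h y)%E ->
  (\int[U x]_y h y = \sum_(i <oo) \int[P]_w h (Y x i w))%E.
Proof.
move=> mh h0; rewrite ge0_integral_measure_series//.
by apply: eq_eseriesr => i _; rewrite ge0_integral_pushforward.
Qed.

Lemma eq_integral_renewal x (h g : R -> \bar R) : measurable_fun setT h ->
  (forall y, 0 <= h y)%E -> measurable_fun setT g -> (forall y, 0 <= g y)%E ->
  (forall y, 0 <= y -> h y = g y) -> (\int[U x]_y h y = \int[U x]_y g y)%E.
Proof.
move=> mh h0 mg g0 hg; rewrite !ge0_integral_renewal//.
by apply: eq_eseriesr => i _; apply: eq_integral => w _; rewrite hg.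
Qed.

Lemma le_integral_renewal x (h g : R -> \bar R) : measurable_fun setT h ->
  (forall y, 0 <= h y)%E -> measurable_fun setT g -> (forall y, 0 <= g y)%E ->
  (forall y : R, (0 <= y)%R -> h y <= g y)%E -> (\int[U x]_y h y <= \int[U x]_y g y)%E.
Proof.
move=> mh h0 mg g0 hg; rewrite !ge0_integral_renewal//.
apply: lee_nneseries => i _ *; first by apply: integral_ge0.
by apply: ge0_le_integral => //= [||w _];
  [exact: measurableT_comp|exact: measurableT_comp|exact: hg].
Qed.

(** The sum over x of 1 - 1 / (1 + l f x) = 1 / (1 + tau x / l): the Laplace
    exponent of the clock. *)
Definition renewal_exponent (l : R) : R := fine (stieltjes_series tau l^-1).
Local Notation Phi := renewal_exponent.

Hypothesis Phi_fin : forall l, 0 < l -> (stieltjes_series tau l < +oo)%E.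

Let term l x : 0 < l -> 1 - (1 + l * f x)^-1 = (1 + l^-1 * tau x)^-1.
Proof.
move=> l0; have fx := f0 x; have lf : 0 < l * f x by rewrite mulr_gt0.
by rewrite /tau; field; rewrite !gt_eqF//= ?addr_gt0.
Qed.

Let term_ge0 l x : 0 < l -> 0 <= (1 + l^-1 * tau x)^-1.
Proof. by move=> l0; rewrite invr_ge0 addr_ge0// mulr_ge0// invr_ge0 ltW. Qed.

Lemma renewal_exponentE l : 0 < l ->
  (stieltjes_series tau l^-1 = (Phi l)%:E)%E.
Proof.
move=> l0; rewrite /Phi fineK// ge0_fin_numE ?Phi_fin ?invr_gt0//.
by apply: nneseries_ge0 => x _ _; rewrite lee_fin term_ge0.
Qed.

Lemma renewal_exponent_gt0 l : 0 < l -> 0 < Phi l.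
Proof.
move=> l0; rewrite -lte_fin -renewal_exponentE//.
apply: (@lt_le_trans _ _ ((1 + l^-1 * tau 0%N)^-1)%:E).
  by rewrite lte_fin invr_gt0 addr_gt0// mulr_gt0// invr_gt0.
rewrite /stieltjes_series (nneseriesD1 (n := 0%N))//.
  by rewrite leeDl// nneseries_ge0// => x _ _; rewrite lee_fin term_ge0.
by move=> k _; rewrite lee_fin term_ge0.
Qed.

(** By [pre_clock_laplace] the integral is a geometric series in i, with sum
    1 / (1 + C - (1 + l f x)^-1) = 1 / Phi l. *)
Lemma renewal_laplace x l : 0 < l ->
  (\int[U x]_y (expR (- (l * `|y|)))%:E = ((Phi l)^-1)%:E)%E.
Proof.
move=> l0; pose C := Phi l - (1 - (1 + l * f x)^-1).
have lf y : 0 < 1 + l * f y by rewrite addr_gt0// mulr_gt0.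
have cvC : \sum_(0 <= y < n | y != x) (1 - (1 + l * f y)^-1) @[n --> \oo] --> C.
  have cP : \sum_(0 <= y < n) (1 - (1 + l * f y)^-1) @[n --> \oo] --> Phi l.
    under eq_fun do under eq_bigr do rewrite (term _ l0).
    apply: nneseries_EFin_cvg => [y|]; first exact: term_ge0.
    by apply: Phi_fin; rewrite invr_gt0.
  have cx : 1 - (1 + l * f x)^-1 @[_ --> \oo] --> 1 - (1 + l * f x)^-1 by exact: cvg_cst.
  apply: cvg_trans (cvgB cP cx); apply: near_eq_cvg; exists x.+1 => // n /= xn.
  rewrite fctE (bigD1_seq x)/= ?mem_index_iota ?iota_uniq//.
  by rewrite addrAC subrr add0r.
rewrite ge0_integral_renewal//; last first.
  apply/measurable_EFinP; apply: measurableT_comp => //; apply: measurableT_comp => //.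
  by apply: measurable_funM => //; exact: measurableT_comp.
have zx0 : 0 < (1 + l * f x)^-1 by rewrite invr_gt0.
have C1 : 0 < 1 + C - (1 + l * f x)^-1.
  by have := renewal_exponent_gt0 l0; rewrite /C; lra.
have C0 : 0 < 1 + C by lra.
transitivity (\sum_(i <oo) ((1 + C)^-1 * ((1 + l * f x)^-1 * (1 + C)^-1) ^+ i)%:E)%E.
  apply: eq_eseriesr => i _.
  rewrite (eq_integral (fun w => (expR (- (l * Y x i w)))%:E)); last first.
    by move=> w _; rewrite ger0_norm.
  rewrite (pre_clock_laplace hD f0 _ (ltW l0) sf cvC) exprMn exprS.
  by congr (_%:E); ring.
set A := (1 + C)^-1; set q := _ * A.
have q1 : `|q| < 1.
  rewrite ger0_norm ?mulr_ge0 ?invr_ge0 ?(ltW C0)//; last exact: ltW.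
  by rewrite ltr_pdivrMr// mul1r; lra.
have -> : (Phi l)^-1 = A / (1 - q).
  have z1 : (1 + l * f x)^-1 != 1 + C by rewrite lt_eqF//; lra.
  have -> : Phi l = 1 + C - (1 + l * f x)^-1 by rewrite /C; ring.
  rewrite /q; move: ((1 + l * f x)^-1) C1 => z C1.
  by rewrite /A; field; rewrite !gt_eqF.
apply: cvg_lim => //; under eq_fun do rewrite sumEFin.
apply: cvg_EFin; first by near=> n.
exact: (cvg_geometric_series q1).
Unshelve. all: by end_near. Qed.

Let damp (s y : R) : R := expR (- (s^-1 * `|y|)).

Let measurable_damp s : measurable_fun setT (damp s).
Proof.
apply: measurableT_comp => //; apply: measurableT_comp => //.
by apply: measurable_funM => //; exact: measurableT_comp.
Qed.

Let damp01 s y : 0 < s -> 0 <= damp s y <= 1.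
Proof.
move=> s0; rewrite /damp expR_ge0/= -[leRHS]expR0 ler_expR oppr_le0.
by rewrite mulr_ge0// invr_ge0 ltW.
Qed.

(** The measure c e^{- y / s} U_x(dy) seen through v = e^{- y / s}, so that its
    moments are values of the Laplace transform. *)
Definition renewal_functional x s c : (R -> R) -> R :=
  weighted_integral (U x) setT (fun y => c * damp s y) (damp s).

Let renewal_weight x s c : 0 < s -> 0 <= c ->
  (U x).-integrable setT (EFin \o (fun y => c * damp s y)).
Proof.
move=> s0 c0; apply: (integrableZl (f := fun y => (damp s y)%:E) measurableT c).
apply/integrableP; split; first exact/measurable_EFinP.
under eq_integral do rewrite /= ger0_norm ?expR_ge0//.
by rewrite renewal_laplace ?invr_gt0// ltry.
Qed.

Let measurable_renewal_weight s c : measurable_fun setT (fun y : R => c * damp s y).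
Proof. exact: measurable_funM. Qed.

Lemma renewal_functional_positive x s c : 0 < s -> 0 <= c ->
  positive_functional (renewal_functional x s c).
Proof.
move=> s0 c0; apply: weighted_integral_positive => //.
- by move=> y _; rewrite mulr_ge0// expR_ge0.
- exact: renewal_weight.
- by move=> y _; exact: damp01.
Qed.

Lemma renewal_functionalE x s c h : 0 < s -> 0 <= c -> test_fun h ->
  ((renewal_functional x s c h)%:E = \int[U x]_y (c * damp s y * h (damp s y))%:E)%E.
Proof.
move=> s0 c0 th; rewrite /renewal_functional weighted_integralE//.
- exact: renewal_weight.
- by move=> y _; exact: damp01.
Qed.

Lemma renewal_functional_moment x s c k : 0 < s -> 0 <= c ->
  renewal_functional x s c (fun v => v ^+ k) = c / Phi (k.+1%:R / s).
Proof.
move=> s0 c0; apply: EFin_inj; rewrite renewal_functionalE//; last exact: test_fun_exp.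
have ks : 0 < k.+1%:R / s by rewrite divr_gt0.
rewrite EFinM -(renewal_laplace x ks) -ge0_integralZl//; last first.
  apply/measurable_EFinP; apply: measurableT_comp => //; apply: measurableT_comp => //.
  by apply: measurable_funM => //; exact: measurableT_comp.
apply: eq_integral => y _; rewrite -EFinM -mulrA -exprS -expRM_natl.
by congr (_ * expR _)%:E; rewrite mulrN mulrA.
Qed.

(** Up to the cutoff at v = e^{-1}, which makes it continuous, the function
    v |-> K (- ln v) / v: against the weight v it becomes K u for v = e^{- u} and
    u <= 1. *)
Definition jump_weight (K : R -> R) (v : R) : R :=
  (Num.max v (expR (-1)))^-1 * K (- ln (Num.max v (expR (-1)))).

Definition jump_test (K : R -> R) (v : R) : R :=
  (expR (-1) <= v)%R%:R * jump_weight K v.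

Lemma continuous_jump_weight (K : R -> R) : (forall y : R, y <= 1 -> continuous_at y K) ->
  continuous (jump_weight K).
Proof.
move=> cK v; pose m (u : R) : R := Num.max u (expR (-1)).
have m0 u : 0 < m u by rewrite /m lt_max expR_gt0 orbT.
have cm : continuous_at v m.
  by apply: (@continuous_max _ _ id (fun=> expR (-1))); [exact: cvg_id|exact: cvg_cst].
apply: cvgM; first by apply: cvgV; [rewrite gt_eqF ?(m0 v)|exact: cm].
apply: (continuous_comp (f := fun v => - ln (m v)) (g := K)).
  have cl : {for v, continuous (fun u => ln (m u))}.
    by apply: continuous_comp; [exact: cm|exact: continuous_ln].
  exact: (cvgN cl).
apply: cK; rewrite lerNl -[leLHS]expRK ler_ln ?posrE ?expR_gt0//.
by rewrite /m le_max lexx orbT.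
Qed.

Lemma jump_weight_ge0 K : (forall y : R, y <= 1 -> 0 <= K y) ->
  forall v, 0 <= jump_weight K v.
Proof.
move=> K0 v; rewrite mulr_ge0// ?invr_ge0 ?le_max ?expR_ge0 ?orbT//.
apply: K0; rewrite lerNl -[leLHS]expRK ler_ln ?posrE ?expR_gt0 ?lt_max ?expR_gt0 ?orbT//.
by rewrite le_max lexx orbT.
Qed.

Lemma jump_test_exp K u : 0 <= u ->
  expR (- u) * jump_test K (expR (- u)) = (u <= 1)%R%:R * K u.
Proof.
move=> u0; rewrite /jump_test ler_expR lerN2; case: leP => u1; last by rewrite !mul0r mulr0.
rewrite !mul1r /jump_weight max_l ?ler_expR ?lerN2// expRK opprK.
by rewrite mulrA divff ?mul1r// gt_eqF// expR_gt0.
Qed.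

Lemma renewal_functional_jump x s c (K : R -> R) : 0 < s -> 0 <= c ->
  (forall y : R, y <= 1 -> continuous_at y K) -> (forall y : R, y <= 1 -> 0 <= K y) ->
  measurable_fun setT K ->
  ((renewal_functional x s c (jump_test K))%:E =
   \int[U x]_y (c * ((y <= s)%R%:R * K (y / s)))%:E)%E.
Proof.
move=> s0 c0 cK K0 mK.
have cJ := continuous_jump_weight cK; have J0 := jump_weight_ge0 K0.
rewrite renewal_functionalE//; last exact: test_fun_jump.
have [mj _] : test_fun (jump_test K) by exact: test_fun_jump.
apply: eq_integral_renewal.
- apply/measurable_EFinP; apply: measurable_funM => //.
  exact: (measurableT_comp mj).
- by move=> y; rewrite lee_fin; apply: mulr_ge0; apply: mulr_ge0 => //; exact: expR_ge0.
- apply/measurable_EFinP; apply: measurable_funM => //; apply: measurable_funM.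
    by apply: measurableT_comp => //; exact: measurable_fun_ler.
  by apply: (measurableT_comp mK); exact: measurable_funM.
- move=> y; rewrite lee_fin mulr_ge0//; case: (leP y s) => ys; last by rewrite mul0r.
  by rewrite mul1r; apply: K0; rewrite ler_pdivrMr// mul1r.
move=> y y0; congr EFin; rewrite -mulrA; congr (_ * _).
have us : 0 <= y / s by rewrite divr_ge0// ltW.
have := jump_test_exp K us; rewrite ler_pdivrMr// mul1r => <-.
by rewrite /damp ger0_norm// [s^-1 * y]mulrC.
Qed.

(** The moments do not depend on the site. *)
Lemma renewal_functional_site x s c (K : R -> R) : 0 < s -> 0 <= c ->
  (forall y : R, y <= 1 -> continuous_at y K) -> (forall y : R, y <= 1 -> 0 <= K y) ->
  renewal_functional x s c (jump_test K) = renewal_functional 0%N s c (jump_test K).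
Proof.
move=> s0 c0 cK K0; apply: moment_unique_jump.
- exact: continuous_jump_weight.
- exact: renewal_functional_positive.
- exact: renewal_functional_positive.
by move=> k; rewrite !renewal_functional_moment.
Qed.

(** All sites may be referred to the renewal measure of site 0, and then the sum
    over the sites goes inside the integral. *)
Lemma no_jump_renewal s t : 0 < s -> 0 < t ->
  (no_jump_probability theta T f s t =
   \int[U 0%N]_y (((y <= s)%R%:R)%:E * laplace_series tau (s + t - y)))%E.
Proof.
move=> s0 t0; rewrite (no_jump_probabilityE hD f0 sf (ltW s0) t0).
pose K x u : R := expR (- ((s + t - s * u) * tau x)).
have mK x : measurable_fun setT (K x).
  apply: measurableT_comp => //; apply: measurableT_comp => //.
  by apply: measurable_funM => //; apply: measurable_funB => //; exact: measurable_funM.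
have cK x (y : R) : y <= 1 -> continuous_at y (K x).
  move=> _; apply: (continuous_comp (f := fun u => - ((s + t - s * u) * tau x)));
    last exact: continuous_expR.
  apply: cvgN; apply: cvgM; last exact: cvg_cst.
  apply: cvgB; first exact: cvg_cst.
  by apply: cvgM; [exact: cvg_cst|exact: cvg_id].
have K0 x (y : R) : y <= 1 -> 0 <= K x y by rewrite expR_ge0.
have mi : measurable_fun setT (fun y : R => ((y <= s)%R%:R)%:E : \bar R).
  by apply/measurable_EFinP; apply: measurableT_comp => //; exact: measurable_fun_ler.
have mE x : measurable_fun setT
    (fun y : R => ((y <= s)%R%:R * expR (- ((s + t - y) * tau x)))%:E).
  apply/measurable_EFinP; apply: measurable_funM.
    by apply: measurableT_comp => //; exact: measurable_fun_ler.
  apply: measurableT_comp => //; apply: measurableT_comp => //.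
  by apply: measurable_funM => //; exact: measurable_funB.
have E0 x y : (0 <= ((y <= s)%R%:R * expR (- ((s + t - y) * tau x)))%:E)%E.
  by rewrite lee_fin mulr_ge0 ?expR_ge0.
have Ux z x : (\int[U z]_y ((y <= s)%R%:R * expR (- ((s + t - y) * tau x)))%:E =
    (renewal_functional z s 1 (jump_test (K x)))%:E)%E.
  rewrite renewal_functional_jump ?ler01//; [|exact: cK|exact: K0].
  apply: eq_integral => y _; rewrite mul1r /K.
  by rewrite [s * _]mulrC divfK// gt_eqF.
transitivity (\sum_(x <oo)
    \int[U 0%N]_y ((y <= s)%R%:R * expR (- ((s + t - y) * tau x)))%:E)%E.
  apply: eq_eseriesr => x _; rewrite Ux -(renewal_functional_site x) ?ler01//.
  - by rewrite -Ux ge0_integral_renewal.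
  - exact: cK.
  - exact: K0.
rewrite -integral_nneseries//; apply: eq_integral => y _.
rewrite /laplace_series -nneseriesZl; last by move=> x _; rewrite lee_fin expR_ge0.
by apply: eq_eseriesr => x _; rewrite -EFinM.
Qed.

End renewal.

(** * Aging in a fixed environment *)

Section limit_functional.
Context (R : realType).
Local Notation mu := (@lebesgue_measure R).
Local Notation pos := (`]0%R, +oo[%classic : set R).
Variables (al c : R).
Hypotheses (al01 : 0 < al < 1) (c0 : 0 <= c).

Let al0 : 0 < al. Proof. by have /andP[] := al01. Qed.
Let al1 : al < 1. Proof. by have /andP[] := al01. Qed.

Let weight (u : R) : R := c * (u `^ (al - 1) * expR (- u)).

Let weight_ge0 u : 0 <= weight u.
Proof. by rewrite /weight !mulr_ge0 ?powR_ge0 ?expR_ge0. Qed.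

Let measurable_weight : measurable_fun (pos : set (measurableTypeR R)) weight.
Proof.
apply: measurable_funTS; apply: measurable_funM => //; apply: measurable_funM.
  exact: measurable_powR.
exact: measurableT_comp.
Qed.

Let measurable_exp : measurable_fun (pos : set (measurableTypeR R)) (fun u => expR (- u)).
Proof. by apply: measurable_funTS; exact: measurableT_comp. Qed.

Let exp01 u : pos u -> 0 <= expR (- u) <= 1.
Proof.
rewrite /= in_itv/= andbT => u0; rewrite expR_ge0/= -[leRHS]expR0 ler_expR.
by rewrite oppr_le0 ltW.
Qed.

Lemma gammaE_fin : gammaE al = (fine (gammaE al))%:E.
Proof.
by rewrite fineK// ge0_fin_numE ?gammaE_ge0// gammaE_lty// al0 (le_trans (ltW al1))// ler1n.
Qed.

Let integrable_weight : mu.-integrable pos (EFin \o weight).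
Proof.
have i1 : mu.-integrable pos (fun u : R => (u `^ (al - 1) * expR (- u))%:E).
  apply/integrableP; split.
    apply/measurable_EFinP; apply: measurable_funTS; apply: measurable_funM.
      exact: measurable_powR.
    exact: measurableT_comp.
  under eq_integral do rewrite /= ger0_norm ?mulr_ge0 ?powR_ge0 ?expR_ge0//.
  by rewrite -/(gammaE al) gammaE_fin ltry.
have mpos : measurable (pos : set (measurableTypeR R)) by exact: measurable_itv.
have := integrableZl mpos c i1.
by apply: eq_integrable => // u _; rewrite /weight /= EFinM.
Qed.

(** The measure c u^{al - 1} e^{- u} du seen through v = e^{- u}. *)
Definition gamma_functional : (R -> R) -> R :=
  weighted_integral mu pos weight (fun u => expR (- u)).

Lemma gamma_functional_positive : positive_functional gamma_functional.
Proof. by apply: weighted_integral_positive => //. Qed.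

Lemma gamma_functionalE h : test_fun h ->
  ((gamma_functional h)%:E = \int[mu]_(u in pos) (weight u * h (expR (- u)))%:E)%E.
Proof. by move=> th; rewrite /gamma_functional weighted_integralE. Qed.

Lemma gamma_functional_moment k :
  gamma_functional (fun v => v ^+ k) = c * (k.+1%:R `^ (- al) * fine (gammaE al)).
Proof.
apply: EFin_inj; rewrite gamma_functionalE; last exact: test_fun_exp.
rewrite 2!EFinM -gammaE_fin -gammaE_scale// -ge0_integralZl//; last 2 first.
- exact: measurable_gamma_integrand.
- by move=> u _; rewrite lee_fin mulr_ge0 ?powR_ge0 ?expR_ge0.
apply: eq_integral => u _; rewrite /weight -EFinM -!mulrA -exprS -expRM_natl.
by rewrite mulrN.
Qed.

Lemma gamma_functional_point v0 : gamma_functional (fun v => (v == v0)%:R) = 0.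
Proof.
rewrite /gamma_functional /weighted_integral /Rintegral.
rewrite (ae_eq_integral (fun=> 0%E)) ?integral0//.
- apply/measurable_EFinP; apply: measurable_funM => //.
  by apply: measurableT_comp => //; exact: measurable_fun_eqr.
exists [set - ln v0]; split => //; first exact: lebesgue_measure_set1.
move=> u /= /not_implyP[_]; apply: contra_notP => /eqP u0.
case: eqP => [E|_]; last by rewrite mulr0.
by move: u0; rewrite -E expRK opprK eqxx.
Qed.

Lemma gamma_functional_jump (K : R -> R) :
  (forall y : R, y <= 1 -> {for y, continuous K}) ->
  ((gamma_functional (jump_test K))%:E =
   \int[mu]_(u in `]0%R, 1%R]) (c * (u `^ (al - 1) * K u))%:E)%E.
Proof.
move=> cK; rewrite gamma_functionalE; last first.
  exact/test_fun_jump/continuous_jump_weight.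
rewrite [LHS]integral_mkcond [RHS]integral_mkcond; apply: eq_integral => u _.
rewrite !patchE !mem_setE !in_itv/= andbT; case: (ltP 0 u) => //= u0.
rewrite /weight -!mulrA jump_test_exp ?(ltW u0)//.
by case: leP => _; rewrite ?mul1r// mul0r !mulr0.
Qed.

End limit_functional.

Section incomplete_beta.
Context (R : realType).
Local Notation mu := (@lebesgue_measure R).

(** The substitution u = rho x. *)
Lemma incomplete_beta (al rho : R) : 0 < al -> 1 < rho ->
  (\int[mu]_(u in `]0%R, 1%R]) (u `^ (al - 1) * (rho - u) `^ (- al))%:E =
   \int[mu]_(x in `[0%R, (rho^-1)%R]) (x `^ (- (1 - al)) * (1 - x) `^ (- al))%:E)%E.
Proof.
move=> al0 rho1; have rho0 : 0 < rho by exact: lt_trans rho1.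
pose g u : \bar R := ((u <= 1)%R%:R * (u `^ (al - 1) * (rho - u) `^ (- al)))%:E.
have mg : measurable_fun setT g.
  apply/measurable_EFinP; apply: measurable_funM.
    by apply: measurableT_comp => //; exact: measurable_fun_ler.
  apply: measurable_funM; first exact: measurable_powR.
  apply: (measurableT_comp (f := fun u : R => u `^ (- al))).
    exact: measurable_powR.
  exact: measurable_funB.
have g0 u : (0 <= g u)%E by rewrite lee_fin !mulr_ge0 ?powR_ge0.
have mb (D : set R) : measurable_fun D
    (fun x : R => (x `^ (- (1 - al)) * (1 - x) `^ (- al))%:E).
  apply/measurable_EFinP; apply: measurable_funTS.
  apply: measurable_funM; first exact: measurable_powR.
  apply: (measurableT_comp (f := fun u : R => u `^ (- al))).
    exact: measurable_powR.
  exact: measurable_funB.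
have -> : (\int[mu]_(u in `]0%R, 1%R]) (u `^ (al - 1) * (rho - u) `^ (- al))%:E =
    \int[mu]_(u in `]0%R, +oo[) g u)%E.
  rewrite [LHS]integral_mkcond [RHS]integral_mkcond; apply: eq_integral => u _.
  rewrite !patchE !mem_setE !in_itv/= andbT /g; case: (ltP 0 u) => //= u0.
  by case: leP => _; rewrite ?mul1r// mul0r.
have E := ge0_integral_scale_pos rho0 (measurable_funTS mg) (fun u _ => g0 u).
have {}E : (\int[mu]_(u in `]0%R, +oo[) g u =
    rho%:E * \int[mu]_(u in `]0%R, +oo[) g (rho * u)%R)%E.
  by rewrite E muleA -EFinM mulfV ?gt_eqF// mul1e.
rewrite E -ge0_integralZl//; last 2 first.
- by apply: measurable_funTS; apply: (measurableT_comp mg); exact: measurable_funM.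
- by rewrite lee_fin ltW.
rewrite -integral_itv_obnd_cbnd; last exact: mb.
rewrite [LHS]integral_mkcond [RHS]integral_mkcond; apply: eq_integral => x _.
rewrite !patchE !mem_setE !in_itv/= andbT; case: (ltP 0 x) => //= x0.
rewrite /g -EFinM -[X in (x <= X)]div1r ler_pdivlMr// mulrC [x * _]mulrC.
case: (leP (rho * x) 1) => x1; last by rewrite !mul0r.
rewrite mul1r; congr EFin; have -> : rho - rho * x = rho * (1 - x) by ring.
have x1' : 0 <= 1 - x by rewrite subr_ge0 -(ler_pM2l rho0) mulr1 (le_trans x1)// ltW.
rewrite !powRM ?(ltW rho0) ?(ltW x0)//.
have -> : - (1 - al) = al - 1 by ring.
have rr : rho `^ (al - 1) * rho `^ (- al) * rho = 1.
  rewrite -[X in _ * X](powRr1 (ltW rho0)) -!powRD ?(gt_eqF rho0) ?implybT//.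
  by rewrite (_ : al - 1 - al + 1 = 0) ?powRr0//; ring.
transitivity (rho `^ (al - 1) * rho `^ (- al) * rho * (x `^ (al - 1) * (1 - x) `^ (- al))).
  by ring.
by rewrite rr mul1r.
Qed.

End incomplete_beta.

Section aging_regime.
Context (R : realType).

Lemma aging_regime_proper (th : R) : 0 < th -> ProperFilter (aging_regime th).
Proof.
move=> th0; apply: filter_from_proper => e /= e0.
have m0 : 0 < 1 + th by rewrite addr_gt0.
pose s := e / (2 * (1 + th)).
have s0 : 0 < s by rewrite divr_gt0// mulr_gt0.
have se : s * (1 + th) < e.
  have -> : s * (1 + th) = e / 2 by rewrite /s; field; rewrite gt_eqF.
  by lra.
exists (s, th * s) => /=; rewrite s0 mulr_gt0//=.
have st : 0 < s * th by rewrite mulr_gt0.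
split; [lra|lra|].
by rewrite mulfK ?gt_eqF// subrr normr0.
Qed.

Lemma aging_regime_near (th e : R) : 0 < e ->
  \forall z \near aging_regime th,
    [/\ 0 < z.1 < e, 0 < z.2 < e & `|z.2 / z.1 - th| < e].
Proof. by move=> e0; exists e. Qed.

Lemma powR_dist1 (al q : R) : 0 < al < 1 -> 0 < q -> `|q `^ al - 1| <= `|q - 1|.
Proof.
move=> /andP[al0 al1] q0; have [q1|q1] := leP 1 q.
  rewrite !ger0_norm ?subr_ge0//; last by rewrite -(powRr0 q) ler_powR// ltW.
  by rewrite lerD2r -[leRHS](powRr1 (ltW q0)) ler_powR// ltW.
have q01 : 0 < q <= 1 by rewrite q0 ltW.
rewrite !ler0_norm ?subr_le0 ?(ltW q1)//; last first.
  by rewrite -(powRr0 q) ger_powR// ltW.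
by rewrite lerN2 lerD2r -[leLHS](powRr1 (ltW q0)) ger_powR// ltW.
Qed.

Lemma powR_small (al e D : R) : 0 < al -> 0 < e -> 0 <= D ->
  exists2 del, 0 < del & forall a, 0 < a -> a <= del -> D <= e * a `^ (- al).
Proof.
move=> al0 e0 D0; pose m := e / (D + 1).
have D1 : 0 < D + 1 by rewrite ltr_wpDl.
have m0 : 0 < m by rewrite divr_gt0.
exists (m `^ al^-1); first by rewrite powR_gt0.
move=> a a0 am; have aal : a `^ al <= m.
  rewrite -[leRHS](powRr1 (ltW m0)) -(mulVf (lt0r_neq0 al0)) powRrM.
  by apply: ge0_ler_powR; rewrite ?nnegrE ?powR_ge0 ?(ltW al0) ?(ltW a0).
rewrite powRN ler_pdivlMr ?powR_gt0// (le_trans (ler_wpM2l D0 aal))//.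
rewrite /m mulrA ler_pdivrMr// mulrC ler_wpM2l ?(ltW e0)//; lra.
Qed.

(** The ratio q of the two bases satisfies |q - 1| <= k, since its denominator
    s + t - y is at least t; and |q^al - 1| <= |q - 1|. *)
Lemma powR_sandwich (al th s t y k : R) : 0 < al < 1 -> 0 < th -> 0 < s -> 0 < t ->
  y <= s -> `|th * s - t| <= k * t ->
  `|(s + t - y) `^ (- al) - (s + th * s - y) `^ (- al)| <=
  k * (s + th * s - y) `^ (- al).
Proof.
move=> al01 th0 s0 t0 ys kt; set a := s + t - y; set b := s + th * s - y.
have a0 : 0 < a by rewrite /a; lra.
have b0 : 0 < b by rewrite /b; have := mulr_gt0 th0 s0; lra.
have q0 : 0 < b / a by rewrite divr_gt0.
have -> : a `^ (- al) = b `^ (- al) * (b / a) `^ al.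
  have bb : b `^ (- al) * b `^ al = 1 by rewrite powRN mulVf// gt_eqF// powR_gt0.
  have aa : a^-1 `^ al = a `^ (- al) by rewrite -(powR_inv1 (ltW a0)) -powRrM mulN1r.
  by rewrite powRM ?(ltW b0) ?invr_ge0 ?(ltW a0)// mulrA bb mul1r aa.
have -> : b `^ (- al) * (b / a) `^ al - b `^ (- al) =
    b `^ (- al) * ((b / a) `^ al - 1) by ring.
rewrite normrM ger0_norm ?powR_ge0// mulrC ler_wpM2r ?powR_ge0//.
apply: le_trans (powR_dist1 al01 q0) _.
have -> : b / a - 1 = (th * s - t) / a.
  by rewrite -[X in _ - X](divff (lt0r_neq0 a0)) -mulrBl; congr (_ / _); rewrite /a/b; ring.
rewrite normrM normfV (gtr0_norm a0) ler_pdivrMr// (le_trans kt)// ler_wpM2l//.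
  by rewrite -(pmulr_lge0 k t0); exact: le_trans (normr_ge0 _) kt.
by rewrite /a; lra.
Qed.

Lemma power_like_cvg (g : R -> \bar R) (h : R -> R) (C al : R) : 0 < al ->
  power_like g C (- al) -> (forall a, 0 < a -> g a = (h a)%:E) ->
  a `^ al * h a @[a --> 0^'+] --> C.
Proof.
move=> al0 gC gh; apply/cvgrPdist_le => e e0.
have e2 : 0 < e / 2 by rewrite divr_gt0.
have [D D0 DE] := gC _ e2.
have [del del0 dD] := powR_small al0 e2 D0.
near=> a.
have a0 : 0 < a by near: a; exact: nbhs_right_gt.
have ad : a <= del by near: a; exact: nbhs_right_le.
have Da := dD a a0 ad; have := DE a a0; rewrite gh// -EFinD !lee_fin => -[l u].
have aa : a `^ al * a `^ (- al) = 1 by rewrite powRN mulfV// gt_eqF// powR_gt0.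
have p0 := powR_gt0 al a0.
have E x : x = a `^ al * (x * a `^ (- al)) by rewrite mulrCA aa mulr1.
rewrite {1}(E C) -mulrBr normrM (gtr0_norm p0) {1}(E e) ler_pM2l//.
by rewrite ler_norml; apply/andP; split; lra.
Unshelve. all: by end_near. Qed.

End aging_regime.

Section aging_limit.
Context d (Omega : measurableType d) (R : realType) (P : probability Omega R).
Variables (theta T : nat -> nat -> {RV P >-> R}).
Hypothesis hD : K_drivers theta T.
Variable f : nat -> R.
Hypothesis f0 : forall x, 0 < f x.
Hypothesis sf : (\sum_(x <oo) (f x)%:E < +oo)%E.
Let tau x := (f x)^-1.
Let tau0 x : 0 < tau x. Proof. by rewrite invr_gt0. Qed.
Variables (al K : R).
Hypotheses (al01 : 0 < al < 1) (K0 : 0 < K).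
Let al0 : 0 < al. Proof. by have /andP[] := al01. Qed.
Let al1 : al < 1. Proof. by have /andP[] := al01. Qed.
Hypothesis nuK : power_like (laplace_series tau) K (- al).
Let C := K * fine (gammaE (1 - al)).
Let phiC : power_like (stieltjes_series tau) C (- al).
Proof. by apply: power_like_stieltjes => //; exact: ltW. Qed.
Let c := (C * fine (gammaE al))^-1.

Let gamma_fine (k : R) : 0 < k < 1 -> 0 < fine (gammaE k).
Proof.
move=> /andP[k0 k1]; rewrite fine_gt0// gammaE_gt0//= gammaE_lty// k0.
by rewrite (le_trans (ltW k1))// ler1n.
Qed.

Let al01' : 0 < 1 - al < 1. Proof. by rewrite subr_gt0 al1/= ltrBlDr ltrDl. Qed.
Let C0 : 0 < C. Proof. by rewrite mulr_gt0// gamma_fine. Qed.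
Let c0 : 0 < c. Proof. by rewrite invr_gt0 mulr_gt0// gamma_fine. Qed.

Let Phi_fin l : 0 < l -> (stieltjes_series tau l < +oo)%E.
Proof.
move=> l0; have [D _ /(_ l l0)[_ u]] := phiC ltr01.
by apply: le_lt_trans u _; exact: ltry.
Qed.

Let Phi := renewal_exponent f.
Let U := renewal_measure theta T f0 0%N.

Variable th : R.
Hypothesis th0 : 0 < th.
Let rho := 1 + th.
Let kern (u : R) : R := (rho - u) `^ (- al).

Let kern_continuous (y : R) : y <= 1 -> {for y, continuous kern}.
Proof.
move=> y1; have cr : {for y, continuous (fun u => rho - u)}.
  by apply: cvgB; [exact: cvg_cst|exact: cvg_id].
have r0 : 0 < rho - y by have := th0; rewrite /rho; lra.
exact: (continuous_comp cr (@continuous_powR _ (- al) _ r0)).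
Qed.

Let kern_ge0 (y : R) : y <= 1 -> 0 <= kern y.
Proof. by move=> _; exact: powR_ge0. Qed.

Let measurable_kern : measurable_fun setT kern.
Proof.
apply: (measurableT_comp (f := fun u : R => u `^ (- al))).
  exact: measurable_powR.
exact: measurable_funB.
Qed.

Let S (z : R * R) : R := if 0 < z.1 then z.1 else 1.
Let S0 z : 0 < S z. Proof. by rewrite /S; case: ifPn. Qed.
(** With S z = z.1 in the aging regime, the integral over y <= s of
    (s + th s - y)^{- al} against the renewal measure is [M z] at the function
    [jump_test kern], which does not depend on [z]. *)
Let M z := renewal_functional theta T f0 0%N (S z) (S z `^ (- al)).

(** The k-th moment is S^{- al} / Phi ((k + 1) / S), which converges because Phi
    behaves like a power. *)
Let M_cvg : M z (jump_test kern) @[z --> aging_regime th] -->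
  gamma_functional al c (jump_test kern).
Proof.
have PF := aging_regime_proper th0.
apply: moment_cvg_jump.
- exact: continuous_jump_weight.
- exact: jump_weight_ge0.
- by move=> z; apply: renewal_functional_positive => //; exact: powR_ge0.
- by apply: gamma_functional_positive => //; exact: ltW.
- move=> k; rewrite gamma_functional_moment//; last exact: ltW.
  have ME z : M z (fun v => v ^+ k) = S z `^ (- al) / Phi (k.+1%:R / S z).
    by rewrite /M renewal_functional_moment ?powR_ge0.
  under eq_fun do rewrite ME.
  have k0 : 0 < k.+1%:R :> R by [].
  have cS : S z / k.+1%:R @[z --> aging_regime th] --> 0^'+.
    move=> A; rewrite /at_right /within/= => /nbhs_ballP[e /= e0 HA].
    apply: filterS (aging_regime_near th e0) => z [/andP[z1 ze] _ _].
    apply: HA; last by rewrite divr_gt0.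
    rewrite /ball/= sub0r normrN gtr0_norm ?divr_gt0//.
    rewrite ltr_pdivrMr// /S z1 (lt_le_trans ze)// ler_peMr ?(ltW e0)//.
    by rewrite ler1n.
  have hE a : 0 < a -> stieltjes_series tau a = (fine (stieltjes_series tau a))%:E.
    move=> a0; rewrite fineK// ge0_fin_numE ?Phi_fin//.
    apply: nneseries_ge0 => x _ _; rewrite lee_fin invr_ge0 addr_ge0//.
    by rewrite mulr_ge0 ?(ltW a0) ?(ltW (tau0 x)).
  have cP := power_like_cvg al0 phiC hE.
  have cV : (a `^ al * fine (stieltjes_series tau a))^-1 @[a --> 0^'+] --> C^-1.
    by apply: cvgV => //; exact: lt0r_neq0.
  have c1 : k.+1%:R `^ (- al) @[_ --> aging_regime th] --> (k.+1%:R `^ (- al) : R).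
    exact: cvg_cst.
  have := cvgM c1 (cvg_comp _ _ cS cV) => /(_ _).
  rewrite (_ : _ / C = c * (k.+1%:R `^ (- al) * fine (gammaE al))); last first.
    by rewrite /c; field; rewrite !gt_eqF ?gamma_fine.
  apply: cvg_trans; apply: near_eq_cvg; near=> z.
  have Sk : 0 < S z / k.+1%:R by rewrite divr_gt0.
  have Ez : S z `^ (- al) = ((S z / k.+1%:R) `^ al)^-1 * k.+1%:R `^ (- al).
    by rewrite -[X in X * _]powRN -powRM ?(ltW Sk)// divfK.
  have Ek : (k.+1%:R / S z)^-1 = S z / k.+1%:R by rewrite invfM invrK mulrC.
  rewrite Ez /Phi /renewal_exponent Ek fctE /=.
  by rewrite invfM; ring.
- exact: gamma_functional_point.
Unshelve. all: by end_near. Qed.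

(** For small s + t, [nu] may be replaced by K times a power, and since t is close
    to th s, s + t by s + th s. *)
Let sandwich (eta : R) : 0 < eta -> eta <= K ->
  \forall z \near aging_regime th,
   ((((K - eta) * M z (jump_test kern))%:E <= no_jump_probability theta T f z.1 z.2)%E /\
    (no_jump_probability theta T f z.1 z.2 <= ((K + eta) * M z (jump_test kern))%:E)%E).
Proof.
move=> eta0 etaK.
pose e := eta / 4; have e0 : 0 < e by rewrite divr_gt0.
have [D D0 DE] := nuK e0.
have [del del0 dD] := powR_small al0 e0 D0.
(* With e = eta / 4 and this k, (K + 2 e) (1 + k) <= K + eta and
   K - eta <= (K - 2 e) (1 - k). *)
pose k := eta / (2 * (K + eta)).
have Ke : 0 < K + eta by rewrite addr_gt0.
have k0 : 0 < k by rewrite divr_gt0// mulr_gt0.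
have kE : (K + eta) * k = eta / 2 by rewrite /k; field; rewrite gt_eqF.
have k1 : k <= 1.
  by rewrite -(ler_pM2l Ke) kE mulr1; lra.
pose g := Num.min (del / 2) (Num.min (th / 2) (k * th / 2)).
have g0 : 0 < g by rewrite !lt_min !divr_gt0// mulr_gt0.
apply: filterS (aging_regime_near th g0) => -[s t] /= [/andP[s0 sg] /andP[t0 tg] rg].
have stdel : s + t <= del.
  have : g <= del / 2 by rewrite ge_min lexx.
  by lra.
have gth : g <= th / 2 by rewrite !ge_min lexx orbT.
have gk : g <= k * th / 2 by rewrite !ge_min lexx !orbT.
have kt : `|th * s - t| <= k * t.
  have ts : `|t - th * s| < g * s.
    have -> : t - th * s = (t / s - th) * s by rewrite mulrBl divfK// gt_eqF.
    by rewrite normrM (gtr0_norm s0) ltr_pM2r.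
  have gs : g * s <= th / 2 * s by rewrite ler_pM2r.
  have gs2 : g * s <= k * th / 2 * s by rewrite ler_pM2r.
  have ths : th * s <= 2 * t.
    by move: ts; rewrite ltr_norml => /andP[+ _]; lra.
  have : k * (th * s) <= k * (2 * t) by rewrite ler_pM2l.
  by rewrite distrC; move: ts; lra.
have Sz : S (s, t) = s by rewrite /S /= s0.
pose B y := (s + th * s - y) `^ (- al).
have BE y : y <= s -> s `^ (- al) * kern (y / s) = B y.
  move=> ys; have ys1 : y / s <= 1 by rewrite ler_pdivrMr// mul1r.
  rewrite /kern -powRM ?(ltW s0)//; last by rewrite /rho; lra.
  by congr (_ `^ _); rewrite /rho mulrBr mulrDr mulr1 [s * (y / s)]mulrC divfK ?gt_eqF// [s * th]mulrC.
have main y : 0 <= y -> y <= s ->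
    (((K - eta) * B y)%:E <= laplace_series tau (s + t - y))%E /\
    (laplace_series tau (s + t - y) <= ((K + eta) * B y)%:E)%E.
  move=> y0 ys; have a0 : 0 < s + t - y by lra.
  have ad : s + t - y <= del by lra.
  have [l u] := DE _ a0; have Da := dD _ a0 ad.
  have AB := powR_sandwich al01 th0 s0 t0 ys kt.
  have B0 : 0 <= B y by exact: powR_ge0.
  move: AB l u Da; rewrite -/(B y); set A := _ `^ _ => AB l u Da.
  move: AB; rewrite ler_norml => /andP[AB1 AB2].
  have KA1 : K * A <= K * ((1 + k) * B y) by rewrite ler_pM2l//; lra.
  have eA1 : e * A <= e * ((1 + k) * B y) by rewrite ler_pM2l//; lra.
  have KA2 : (K - 2 * e) * ((1 - k) * B y) <= (K - 2 * e) * A.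
    by rewrite ler_wpM2l//; rewrite /e; lra.
  have kB : (K + eta) * k * B y = eta / 2 * B y by rewrite kE.
  have ekB : 0 <= eta * k * B y.
    by rewrite mulr_ge0// mulr_ge0 ?(ltW eta0) ?(ltW k0).
  split.
    rewrite -(leeD2rE _ _ (_ : (e * A + D)%:E \is a fin_num))//.
    apply: le_trans l; rewrite -EFinD lee_fin.
    have : (K - eta) * B y <= (K - 2 * e) * ((1 - k) * B y) by rewrite /e; lra.
    by lra.
  apply: (le_trans u); rewrite lee_fin.
  have : (K + 2 * e) * ((1 + k) * B y) <= (K + eta) * B y by rewrite /e; lra.
  by lra.
rewrite (no_jump_renewal hD f0 sf Phi_fin s0 t0) !EFinM /M.
rewrite (renewal_functional_jump hD f0 sf Phi_fin 0%N (S0 _) (powR_ge0 _ _)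
  kern_continuous kern_ge0 measurable_kern) Sz -/U.
have mI : measurable_fun setT (fun y : R => ((y <= s)%R%:R)%:E : \bar R).
  by apply/measurable_EFinP; apply: measurableT_comp => //; exact: measurable_fun_ler.
have mnu : measurable_fun setT
    (fun y : R => (((y <= s)%R%:R)%:E * laplace_series tau (s + t - y))%E).
  apply: emeasurable_funM => //.
  apply: (measurableT_comp (measurable_laplace_series tau)).
  exact: measurable_funB.
have mB : measurable_fun setT
    (fun y : R => (s `^ (- al) * ((y <= s)%R%:R * kern (y / s)))%:E).
  apply/measurable_EFinP; apply: measurable_funM => //; apply: measurable_funM.
    by apply: measurableT_comp => //; exact: measurable_fun_ler.
  by apply: (measurableT_comp measurable_kern); exact: measurable_funM.
have B0 y : (0 <= (s `^ (- al) * ((y <= s)%R%:R * kern (y / s)))%:E)%E.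
  by rewrite lee_fin !mulr_ge0 ?powR_ge0.
have nu0 y : (0 <= ((y <= s)%R%:R)%:E * laplace_series tau (s + t - y))%E.
  by rewrite mule_ge0 ?lee_fin//; apply: nneseries_ge0 => x _ _; rewrite lee_fin expR_ge0.
rewrite -!ge0_integralZl//; last 2 first.
- by rewrite lee_fin ltW.
- by rewrite lee_fin subr_ge0.
split; apply: le_integral_renewal => //.
- exact: measurable_funeM.
- by move=> y; rewrite mule_ge0// lee_fin subr_ge0.
- move=> y y0; rewrite -EFinM; case: (leP y s) => ys; last by rewrite !(mul0r,mulr0,mul0e).
  by rewrite mul1r BE// mul1e; have [] := main y y0 ys.
- exact: measurable_funeM.
- by move=> y; rewrite mule_ge0// lee_fin ltW.
- move=> y y0; rewrite -EFinM; case: (leP y s) => ys; last by rewrite !(mul0r,mulr0,mul0e).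
  by rewrite mul1r BE// mul1e; have [] := main y y0 ys.
Qed.

Lemma no_jump_limit :
  no_jump_probability theta T f z.1 z.2 @[z --> aging_regime th] -->
  (K * gamma_functional al c (jump_test kern))%:E.
Proof.
have PF := aging_regime_proper th0.
set m := gamma_functional _ _ _.
have m0 : 0 <= m.
  rewrite -lee_fin /m (gamma_functional_jump c al01 kern_continuous).
  apply: integral_ge0 => u; rewrite /= in_itv/= => /andP[_ u1].
  by rewrite lee_fin mulr_ge0 ?(ltW c0)// mulr_ge0 ?powR_ge0// kern_ge0.
apply/fine_cvgP; split.
  have := sandwich K0 (lexx K); apply: filterS => z [l u].
  by rewrite fin_numElt (lt_le_trans _ l) ?ltNyr// (le_lt_trans u) ?ltry.
apply/cvgrPdist_le => e e0.
pose eta := Num.min K (e / (2 * (m + 1))).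
have eta0 : 0 < eta by rewrite lt_min K0 divr_gt0// mulr_gt0// ltr_wpDl.
have e2 : 0 < Num.min 1 (e / (2 * K)).
  by rewrite lt_min ltr01 divr_gt0// mulr_gt0.
near=> z.
have mM : `|m - M z (jump_test kern)| <= Num.min 1 (e / (2 * K)).
  by near: z; have /cvgrPdist_le := M_cvg; exact.
have [l u] : ((((K - eta) * M z (jump_test kern))%:E <= no_jump_probability theta T f z.1 z.2)%E /\
    (no_jump_probability theta T f z.1 z.2 <= ((K + eta) * M z (jump_test kern))%:E)%E).
  by near: z; apply: sandwich => //; rewrite /eta ge_min lexx.
move: mM l u; set J := M z _ => /=.
move: (no_jump_probability theta T f z.1 z.2) => [p| |]//=.
rewrite !lee_fin le_min => /andP[mM1 mM2] l u.
have etam : eta * (m + 1) <= e / 2.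
  have m1 : 0 < m + 1 by rewrite ltr_wpDl.
  apply: (@le_trans _ _ (e / (2 * (m + 1)) * (m + 1))).
    by rewrite ler_pM2r// /eta ge_min lexx orbT.
  by rewrite (_ : _ * _ = e / 2)//; field; rewrite gt_eqF.
have J1 : J <= m + 1 by move: mM1; rewrite ler_norml => /andP[+ _]; lra.
have eJ : eta * J <= eta * (m + 1) by rewrite ler_pM2l.
have : K * `|m - J| <= K * (e / (2 * K)) by rewrite ler_pM2l.
rewrite (_ : K * (e / (2 * K)) = e / 2); last by field; rewrite gt_eqF.
rewrite -[X in X * _](gtr0_norm K0) -normrM !ler_norml => /andP[? ?].
by apply/andP; split; lra.
Unshelve. all: by end_near. Qed.

End aging_limit.

(** * Poisson deviations along squares *)

Section poisson.
Context (R : realType).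

(** Summation by parts. The boundary term is nonnegative for n >= r, so that the
    partial sums of the variance of the Poisson law are at most r e^r. *)
Lemma poisson_square_sum (r : R) n :
  \sum_(k < n.+1) (k%:R - r) ^+ 2 * (r ^+ k / k`!%:R) +
    (n%:R - r) * (r ^+ n.+1 / n`!%:R) =
  r * \sum_(k < n) r ^+ k / k`!%:R.
Proof.
elim: n => [|n IH].
  by rewrite big_ord_recr/= !big_ord0 fact0 expr0 expr1; field.
rewrite big_ord_recr/= [in RHS]big_ord_recr/= mulrDr -IH.
have nf : n`!%:R != 0 :> R by rewrite pnatr_eq0 -lt0n fact_gt0.
have n1 : n%:R + 1 != 0 :> R by rewrite natr1 pnatr_eq0.
rewrite -!addrA; congr (_ + _); rewrite factS natrM [r ^+ n.+2]exprS [r ^+ n.+1]exprS.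
by rewrite -natr1; field; rewrite nf n1.
Qed.

Context d (Omega : measurableType d) (P : probability Omega R).

(** Chebyshev's inequality; only the probabilities of single values are known,
    so the complement of finitely many good values is estimated. *)
Lemma poisson_deviation (N : Omega -> \bar R) (r u : R) :
  measurable_fun setT N -> 0 <= r -> 0 < u ->
  (forall k : nat, P [set w | N w = k%:R%:E] = (r ^+ k / k`!%:R * expR (- r))%:E) ->
  (P [set w | ~ exists k : nat, N w = k%:R%:E /\ (`|k%:R - r| < u)%R] <= (r / u ^+ 2)%:E)%E.
Proof.
move=> mN r0 u0 law; set bad := [set w | _].
pose pmf k : R := r ^+ k / k`!%:R.
have pmf0 k : 0 <= pmf k by rewrite divr_ge0// exprn_ge0.
pose G k : set Omega := if `|k%:R - r| < u then [set w | N w = k%:R%:E] else set0.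
have mNk (k : nat) : measurable [set w | N w = k%:R%:E].
  by rewrite -[X in measurable X]setTI; exact: (mN measurableT [set k%:R%:E]).
have mG k : measurable (G k) by rewrite /G; case: ifP.
have PG k : P (G k) = ((`|k%:R - r| < u)%R%:R * (pmf k * expR (- r)))%:E.
  by rewrite /G; case: ifP => _; rewrite ?law ?mul1r// measure0 mul0r.
have tG : trivIset setT G.
  apply/trivIsetP => i j _ _ ij; apply/seteqP; split => // w [].
  rewrite /G; case: ifP => // _ /= Ni; case: ifP => //= _; rewrite Ni => -[] /eqP.
  by rewrite eqr_nat (negbTE ij).
have bnd n : r <= n%:R -> (P bad <= (1 - expR (- r) * (\sum_(k < n.+1) pmf k) + r / u ^+ 2)%:E)%E.
  move=> rn; pose B := \big[setU/set0]_(k < n.+1) G k.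
  have mB : measurable B by exact: bigsetU_measurable.
  apply: (@le_trans _ _ (P (~` B))).
    apply: le_measure; rewrite ?inE//; last 2 first.
    - exact: measurableC.
    - move=> w badw; rewrite /B -bigcup_mkord => -[k _ Gk]; apply: badw; exists k.
      by move: Gk; rewrite /G; case: ifP.
    rewrite (_ : bad = ~` \bigcup_k G k); first exact/measurableC/bigcupT_measurable.
    apply/seteqP; split => w badw.
      move=> [k _ Gk]; apply: badw; exists k.
      by move: Gk; rewrite /G; case: ifP.
    by move=> [k [Nk ku]]; apply: badw; exists k => //; rewrite /G ku.
  rewrite probability_setC// /B measure_bigsetU//.
  rewrite (eq_bigr _ (fun (k : 'I_n.+1) _ => PG k)) sumEFin -EFinB lee_fin.
  have sq : \sum_(k < n.+1) (~~ (`|k%:R - r| < u)%R)%:R * pmf k <= r * expR r / u ^+ 2.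
    have u2 : 0 < u ^+ 2 by rewrite exprn_gt0.
    rewrite ler_pdivlMr// mulr_suml.
    apply: (@le_trans _ _ (\sum_(k < n.+1) (k%:R - r) ^+ 2 * pmf k)).
      apply: ler_sum => k _; case: ltP => uk /=.
        by rewrite !mul0r; apply: mulr_ge0; [exact: sqr_ge0|exact: pmf0].
      rewrite mul1r mulrC ler_wpM2r// -[leRHS]real_normK ?num_real// ler_sqr ?nnegrE//.
      exact: ltW.
    have := poisson_square_sum r n; rewrite -/pmf => E.
    have b0 : 0 <= (n%:R - r) * (r ^+ n.+1 / n`!%:R).
      by rewrite mulr_ge0 ?subr_ge0// divr_ge0// exprn_ge0.
    apply: (@le_trans _ _ (r * \sum_(k < n) r ^+ k / k`!%:R)).
      by rewrite -E lerDl.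
    rewrite ler_wpM2l//.
    have nd : nondecreasing_seq (series (exp_coeff r)).
      by apply: nondecreasing_series => k _ _; exact: exp_coeff_ge0.
    have := nondecreasing_cvgn_le nd (is_cvg_series_exp_coeff r) n.
    by rewrite /series/= big_mkord.
  have e0 : 0 < expR (- r) by exact: expR_gt0.
  have -> : \sum_(k < n.+1) (`|k%:R - r| < u)%R%:R * (pmf k * expR (- r)) =
      expR (- r) * (\sum_(k < n.+1) pmf k -
        \sum_(k < n.+1) (~~ (`|k%:R - r| < u)%R)%:R * pmf k).
    rewrite -sumrB mulr_sumr; apply: eq_bigr => k _.
    by case: (_ < u) => /=; ring.
  have : expR (- r) * \sum_(k < n.+1) (~~ (`|k%:R - r| < u)%R)%:R * pmf k <=
      expR (- r) * (r * expR r / u ^+ 2) by rewrite ler_pM2l.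
  have -> : expR (- r) * (r * expR r / u ^+ 2) = r / u ^+ 2.
    by rewrite expRN; field; rewrite ?expf_neq0 ?gt_eqF ?expR_gt0.
  by rewrite mulrBr; lra.
have cv : (1 - expR (- r) * (\sum_(k < n.+1) pmf k) + r / u ^+ 2)%:E @[n --> \oo] -->
    (1 - expR (- r) * expR r + r / u ^+ 2)%:E.
  apply: cvg_EFin; first by near=> n.
  apply: cvgD; last exact: cvg_cst.
  apply: cvgB; first exact: cvg_cst.
  apply: cvgM; first exact: cvg_cst.
  have : series (exp_coeff r) n @[n --> \oo] --> expR r.
    exact: (is_cvg_series_exp_coeff r).
  by rewrite -cvg_shiftS; under eq_fun do rewrite /series/= big_mkord.
have -> : r / u ^+ 2 = 1 - expR (- r) * expR r + r / u ^+ 2.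
  by rewrite -expRD addNr expR0 subrr add0r.
rewrite -(cvg_lim _ cv)//; apply: lime_ge; first by apply/cvg_ex; eexists; exact: cv.
near=> n; apply: bnd; apply: (le_trans (ltW (archi_boundP r0))).
by rewrite ler_nat; near: n; exact: nbhs_infty_ge.
Unshelve. all: by end_near. Qed.

End poisson.

Section counting.
Context d (Omega : measurableType d) (R : realType).

Lemma point_countE (gamma : nat -> Omega -> R) (B : set R) w :
  point_count gamma B w = (\sum_(x <oo) ((gamma x w \in B)%:R)%:E)%E.
Proof.
rewrite /point_count counting_dirac; apply: eq_eseriesr => x _.
by rewrite diracE; congr (_%:R%:E); apply/idP/idP; rewrite !inE.
Qed.

End counting.

Section squares.
Context (R : realType).
Local Open Scope ereal_scope.

(** A monotone function is controlled by its values at squares, because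
    consecutive squares differ by 2 k + 1 = o(k^2). *)
Lemma square_sandwich (V : R -> \bar R) : (forall r, 0 <= V r) ->
  (forall r s, (0 < r)%R -> (r <= s)%R -> V r <= V s) ->
  (forall e : R, (0 < e)%R -> exists k0 : nat, forall k, (k0 <= k)%N ->
     ((1 - e) * k.+1%:R ^+ 2)%:E <= V (k.+1%:R ^+ 2)%R /\
     V (k.+1%:R ^+ 2)%R <= ((1 + e) * k.+1%:R ^+ 2)%:E) ->
  forall e : R, (0 < e)%R -> exists2 D : R, (0 <= D)%R & forall r, (0 < r)%R ->
    r%:E <= V r + (e * r + D)%:E /\ V r <= ((1 + e) * r + D)%:E.
Proof.
move=> V0 Vmono Vsq e e0.
pose h : R := (Num.min 1 (e / 4))%R.
have h0 : (0 < h)%R by rewrite lt_min ltr01 divr_gt0.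
have h1 : (h <= 1)%R by rewrite ge_min lexx.
have h4 : (4 * h <= e)%R.
  have : (h <= e / 4)%R by rewrite ge_min lexx orbT.
  by lra.
have [k0 Hk] := Vsq h h0.
pose b : R := (k0.+1%:R ^+ 2)%R.
have b1 : (1 <= b)%R by rewrite exprn_ege1// ler1n.
have b0 : (0 < b)%R by exact: lt_le_trans b1.
pose D : R := (2 * b + 2 * (h^-1 + 1))%R.
have hi : (0 < h^-1)%R by rewrite invr_gt0.
have D0 : (0 <= D)%R by rewrite /D; lra.
exists D => // r r0; have [rb|rb] := leP r b.
  have er : (0 <= e * r)%R by rewrite mulr_ge0 ?ltW.
  split.
    apply: (@le_trans _ _ (e * r + D)%:E); last by rewrite leeDr.
    by rewrite lee_fin /D; lra.
  apply: le_trans (Vmono _ _ r0 rb) _.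
  have [_ u] := Hk k0 (leqnn _); apply: le_trans u _; rewrite lee_fin -/b.
  have : (h * b <= b)%R by rewrite ler_piMl// ltW.
  by rewrite /D; lra.
pose k := Num.truncn (Num.sqrt r).
have kr : (k%:R <= Num.sqrt r < k.+1%:R)%R by apply: truncn_itv; exact: sqrtr_ge0.
have {}kr : ((k%:R : R) ^+ 2 <= r < (k.+1%:R : R) ^+ 2)%R.
  rewrite -[r in (_ <= r < _)%R](sqr_sqrtr (ltW r0)); have /andP[k1 k2] := kr.
  by rewrite ler_sqr ?nnegrE ?sqrtr_ge0// k1/= ltr_sqr ?nnegrE ?sqrtr_ge0.
have /andP[k1 k2] := kr.
have k0k : (k0.+1 <= k)%N.
  by rewrite -ltnS -(ltr_nat R) -(ltr_pXn2r (n := 2))// ?nnegrE//; exact: lt_trans rb k2.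
have kE : k.-1.+1 = k by rewrite prednK// (leq_trans _ k0k).
have [l _] : ((1 - h) * (k%:R : R) ^+ 2)%:E <= V ((k%:R : R) ^+ 2)%R /\
     V ((k%:R : R) ^+ 2)%R <= ((1 + h) * (k%:R : R) ^+ 2)%:E.
  by have := Hk k.-1; rewrite kE; apply; rewrite -ltnS kE.
have [_ u] := Hk k (ltnW k0k).
(* 2 k <= h k^2 + 1 / h. *)
have sq : ((k.+1%:R : R) ^+ 2 <= (1 + h) * (k%:R : R) ^+ 2 + (h^-1 + 1))%R.
  have hh : (h * h^-1 = 1)%R by rewrite divff// gt_eqF.
  have : (0 <= h * (k%:R - h^-1) ^+ 2)%R by rewrite mulr_ge0 ?sqr_ge0// ltW.
  have -> : (h * (k%:R - h^-1) ^+ 2 =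
      h * k%:R ^+ 2 - 2 * k%:R * (h * h^-1) + h * h^-1 * h^-1)%R by ring.
  by rewrite hh -natr1; lra.
move: k1 k2 sq; set x : R := (k%:R ^+ 2)%R; set y : R := (k.+1%:R ^+ 2)%R.
move=> k1 k2 sq; have x0 : (0 < x)%R by rewrite exprn_gt0// ltr0n (leq_trans _ k0k).
have hx : (h * h * x <= h * x)%R by rewrite ler_wpM2r ?(ltW x0)// ler_piMr// ltW.
have hr : (h * x <= h * r)%R by rewrite ler_wpM2l// ltW.
have hr0 : (0 <= h * r)%R by rewrite mulr_ge0 ?(ltW h0) ?(ltW r0).
have hh1 : (h * h^-1 = 1)%R by rewrite divff// gt_eqF.
have er : (4 * h * r <= e * r)%R by rewrite ler_wpM2r// ltW.
split.
  apply: (@le_trans _ _ (V x + (e * r + D)%:E)); last first.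
    by rewrite leeD2r// Vmono.
  apply: (@le_trans _ _ (((1 - h) * x)%:E + (e * r + D)%:E)); last by rewrite leeD2r.
  rewrite -EFinD lee_fin /D.
  have : (r <= (1 + h) * x + (h^-1 + 1))%R by rewrite (le_trans _ sq)// ltW.
  by lra.
apply: le_trans (Vmono _ _ r0 (ltW k2)) _; apply: le_trans u _; rewrite lee_fin -/y /D.
have : ((1 + h) * y <= (1 + h) * ((1 + h) * x + (h^-1 + 1)))%R.
  by rewrite ler_wpM2l// addr_ge0// ltW.
have -> : ((1 + h) * ((1 + h) * x + (h^-1 + 1)) =
  x + 2 * (h * x) + h * h * x + h^-1 + 1 + h * h^-1 + h)%R by ring.
by rewrite hh1; lra.
Qed.

End squares.

(** * Growth of the random environment *)

Section environment.
Context d (Omega : measurableType d) (R : realType) (P : probability Omega R).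
Variables (al : R) (gamma : nat -> {RV P >-> R}).
Hypothesis al0 : 0 < al.
Hypothesis env : random_environment al gamma.

Lemma powRN_cvgy : x `^ (- al) @[x --> +oo%R] --> (0 : R).
Proof.
apply/cvgrPdist_le => e e0; near=> x.
have x0 : 0 < x by near: x; exact: nbhs_pinfty_gt.
rewrite sub0r normrN ger0_norm ?powR_ge0// powRN invf_ple ?posrE ?powR_gt0//.
have -> : e^-1 = (e^-1 `^ al^-1) `^ al.
  by rewrite -powRrM mulVf ?gt_eqF// powRr1// invr_ge0 ltW.
apply: ge0_ler_powR; rewrite ?nnegrE ?powR_ge0 ?(ltW al0) ?(ltW x0)//.
Unshelve. all: by end_near. Qed.

Lemma stable_intensity_tail (c : R) : 0 < c ->
  stable_intensity al `[c, +oo[ = (c `^ (- al))%:E.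
Proof.
move=> c0; rewrite /stable_intensity.
have dF (x : R) : 0 < x -> is_derive x 1 (fun y => - y `^ (- al)) (al * x `^ (- 1 - al)).
  move=> x0; have D := is_derive1_powR (- al) x0.
  apply: is_derive_eq.
  by rewrite mulNr opprK; congr (_ * _ `^ _); ring.
rewrite (@ge0_continuous_FTC2y _ (fun x => al * x `^ (- 1 - al)) (fun y => - y `^ (- al)) _ 0).
- by rewrite -EFinB sub0r opprK.
- by move=> x _; rewrite mulr_ge0 ?powR_ge0 ?(ltW al0).
- apply: continuous_in_subspaceT => x; rewrite inE/= in_itv/= andbT => cx.
  apply: cvgM; first exact: cvg_cst.
  by apply: continuous_powR; exact: lt_le_trans cx.
- by rewrite -oppr0; apply: cvgN; exact: powRN_cvgy.
- by move=> x cx; have [] := dF x (lt_trans c0 cx).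
- apply: cvg_at_right_filter; apply: cvgN; exact: continuous_powR.
- move=> x; rewrite in_itv/= andbT => cx.
  by rewrite derive1E; have [_ ->] := dF x (lt_trans c0 cx).
Qed.

Definition points_above (c : R) (w : Omega) : \bar R :=
  point_count (fun x => gamma x : Omega -> R) `[c, +oo[ w.

Lemma points_aboveE c w :
  (points_above c w = \sum_(x <oo) ((c <= gamma x w)%R%:R)%:E)%E.
Proof.
rewrite /points_above point_countE; apply: eq_eseriesr => x _.
by rewrite mem_setE in_itv/= andbT.
Qed.

Lemma measurable_points_above c : measurable_fun setT (points_above c).
Proof.
rewrite (_ : points_above c = fun w => \sum_(x <oo) ((c <= gamma x w)%R%:R)%:E)%E; last first.
  by apply/funext => w; exact: points_aboveE.
apply: ge0_emeasurable_sum => [k w _ _|k _]; first by rewrite lee_fin.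
apply/measurable_EFinP; apply: measurableT_comp => //.
exact: measurable_fun_ler.
Qed.

Lemma points_above_law (c : R) (k : nat) : 0 < c ->
  P [set w | points_above c w = k%:R%:E] =
  ((c `^ (- al)) ^+ k / k`!%:R * expR (- (c `^ (- al))))%:E.
Proof.
move=> c0; have [[_ law _ _] _] := env.
rewrite /points_above law ?stable_intensity_tail ?ltry//.
by move=> x /=; rewrite !in_itv/= !andbT; exact: lt_le_trans.
Qed.

(** The level above which the expected number of points is (k + 1)^2. *)
Let level k : R := (k.+1%:R ^+ 2) `^ (- al^-1).

Let level_gt0 k : 0 < level k.
Proof. by rewrite powR_gt0// exprn_gt0. Qed.

Let levelE k : level k `^ (- al) = k.+1%:R ^+ 2.
Proof. by rewrite -powRrM mulrNN mulVf ?gt_eqF// powRr1// exprn_ge0. Qed.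

Let exceptional (e : R) k : set Omega := [set w | ~ exists n : nat,
  points_above (level k) w = n%:R%:E /\ `|n%:R - k.+1%:R ^+ 2| < e * k.+1%:R ^+ 2].

Let exceptional_le (e : R) k : 0 < e ->
  (P (exceptional e k) <= (e^-2 * k.+1%:R ^- 2)%:E)%E.
Proof.
move=> e0; have k0 : 0 < k.+1%:R :> R by [].
have u0 : 0 < e * k.+1%:R ^+ 2 by rewrite mulr_gt0// exprn_gt0.
have := @poisson_deviation R _ _ P _ (k.+1%:R ^+ 2) _ (measurable_points_above (level k))
  (exprn_ge0 2 (ltW k0)) u0.
move=> /(_ _)/le_trans; apply.
  by move=> n; rewrite points_above_law// levelE.
rewrite lee_fin le_eqVlt; apply/orP; left; apply/eqP.
by field; rewrite !gt_eqF.
Qed.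

Let measurable_exceptional e k : measurable (exceptional e k).
Proof.
pose G n : set Omega := if `|n%:R - k.+1%:R ^+ 2| < e * k.+1%:R ^+ 2
  then [set w | points_above (level k) w = n%:R%:E] else set0.
rewrite (_ : exceptional e k = ~` \bigcup_n G n).
  apply/measurableC/bigcupT_measurable => n; rewrite /G; case: ifP => // _.
  rewrite -[X in measurable X]setTI.
  have mp := measurable_points_above (level k).
  exact: (mp measurableT [set n%:R%:E]).
apply/seteqP; split => w badw.
  by move=> [n _ Gn]; apply: badw; exists n; move: Gn; rewrite /G; case: ifP.
by move=> [n [Nn nu]]; apply: badw; exists n => //; rewrite /G nu.
Qed.

(** By [exceptional_le] the exceptional probabilities are summable, and the lemma
    of Borel and Cantelli applies for each e = 1 / (m + 1). *)
Lemma ae_points_above_squares : {ae P, forall w, forall e : R, 0 < e ->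
  exists k0 : nat, forall k, (k0 <= k)%N ->
     (((1 - e) * k.+1%:R ^+ 2)%:E <= points_above (level k) w)%E /\
     (points_above (level k) w <= ((1 + e) * k.+1%:R ^+ 2)%:E)%E}.
Proof.
suff : {ae P, forall w, forall m : nat, ~ lim_sup_set (exceptional m.+1%:R^-1) w}.
  apply: filterS => w good e e0.
  pose m := Num.bound e^-1.
  have me : m.+1%:R^-1 <= e.
    rewrite invf_ple ?posrE// (le_trans (ltW (archi_boundP _))) ?ler_nat ?leqnSn//.
    by rewrite invr_ge0 ltW.
  have := good m; rewrite /lim_sup_set/= => nl.
  have [k0 Hk] : exists k0, forall k, (k0 <= k)%N -> ~ exceptional m.+1%:R^-1 k w.
    apply: contrapT => H; apply: nl => n _.
    apply: contrapT => H2; apply: H; exists n => k nk Ek.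
    by apply: H2; exists k.
  exists k0 => k /Hk /contrapT[n [-> ]].
  rewrite ltr_norml => /andP[l u]; rewrite !lee_fin.
  have : m.+1%:R^-1 * k.+1%:R ^+ 2 <= e * k.+1%:R ^+ 2 by rewrite ler_wpM2r// exprn_ge0.
  move: l u; move: (k.+1%:R ^+ 2 : R) (m.+1%:R^-1 : R) (n%:R : R) => q v x l u vq.
  by split; lra.
apply: ae_forall_countType => m.
have m0 : 0 < m.+1%:R^-1 :> R by rewrite invr_gt0.
have mE k : measurable (exceptional m.+1%:R^-1 k) by exact: measurable_exceptional.
exists (lim_sup_set (exceptional m.+1%:R^-1)); split.
- by apply: bigcap_measurable => // n _; exact: bigcup_measurable.
- apply: lim_sup_set_cvg0 => //.
  pose C : R := m.+1%:R^-1 ^- 2.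
  have C0 : 0 <= C by rewrite invr_ge0 exprn_ge0// ltW.
  apply: (@le_lt_trans _ _ (2 * C)%:E); last exact: ltry.
  apply: lime_le; first by apply: is_cvg_nneseries.
  apply: nearW => n.
  (* 1 / (k + 1)^2 <= 2 (1 / (k + 1) - 1 / (k + 2)). *)
  apply: (@le_trans _ _ (C * 2 * (1 - n.+1%:R^-1))%:E).
    elim: n => [|n IH]; first by rewrite big_geq// invr1 subrr mulr0.
    rewrite big_nat_recr//= (le_trans (leeD IH (exceptional_le n m0)))//.
    rewrite -EFinD lee_fin -/C -!mulrA -mulrDr ler_wpM2l//.
    have n1 : 0 < n.+1%:R :> R by [].
    have n2 : 0 < n.+2%:R :> R by [].
    have nn : n.+2%:R = n.+1%:R + 1 :> R by rewrite natr1.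
    rewrite nn; move: (n.+1%:R : R) n1 (ler1n R n.+1) => x x0 x1.
    have x2 : 0 < x + 1 by rewrite addr_gt0.
    rewrite -subr_ge0.
    have -> : 2 * (1 - (x + 1)^-1) - (2 * (1 - x^-1) + x ^- 2) =
        (x - 1) / (x ^+ 2 * (x + 1)) by field; rewrite !gt_eqF.
    by rewrite divr_ge0 ?subr_ge0// mulr_ge0 ?exprn_ge0 ?(ltW x0) ?(ltW x2).
  have n0 : 0 <= n.+1%:R^-1 :> R by rewrite invr_ge0.
  by rewrite lee_fin [leRHS]mulrC ler_piMr ?mulr_ge0// gerBl.
- by move=> w /= /contrapT.
Qed.

Variable p : R.
Hypothesis p0 : 0 < p.

(** The inverse of [p^-1 * gamma x w] is at most [a] exactly when [gamma x w] is at
    least p / a, a level above which p^{- al} a^al points are expected. *)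
Lemma ae_environment : {ae P, forall w,
  [/\ forall x, 0 < gamma x w,
      nonincreasing_seq (fun x => gamma x w) &
      power_like (counting_function (fun x => (p^-1 * gamma x w)^-1)) (p `^ (- al)) al]}.
Proof.
have [[pos _ _ _] mono] := env.
near=> w.
have gp x : 0 < gamma x w.
  have : forall x, `]0, +oo[%classic (gamma x w) by near: w; exact: pos.
  by move=> /(_ x) /=; rewrite in_itv/= andbT.
split => //; first by near: w; exact: mono.
pose V r := points_above (r `^ (- al^-1)) w.
have sq : forall e : R, 0 < e -> exists k0 : nat, forall k, (k0 <= k)%N ->
     (((1 - e) * k.+1%:R ^+ 2)%:E <= points_above (level k) w)%E /\
     (points_above (level k) w <= ((1 + e) * k.+1%:R ^+ 2)%:E)%E.
  by near: w; exact: ae_points_above_squares.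
have V0 r : (0 <= V r)%E.
  by rewrite /V points_aboveE; apply: nneseries_ge0 => x _ _; rewrite lee_fin.
have Vmono r s : 0 < r -> r <= s -> (V r <= V s)%E.
  move=> r0 rs; rewrite /V !points_aboveE; apply: lee_nneseries => x _; rewrite ?lee_fin// ler_nat.
  suff : s `^ (- al^-1) <= r `^ (- al^-1).
    by case: (leP (r `^ _)) => // rx sr; rewrite (le_trans sr rx).
  rewrite !powRN lef_pV2 ?posrE ?powR_gt0// ?(lt_le_trans r0 rs)//.
  apply: ge0_ler_powR => //; rewrite ?nnegrE ?invr_ge0 ?(ltW al0) ?(ltW r0)//.
  by rewrite (le_trans (ltW r0)).
have S := square_sandwich V0 Vmono sq.
move=> e e0; have K0 : 0 < p `^ (- al) by rewrite powR_gt0.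
have [D D0 DE] := S (e / p `^ (- al)) (divr_gt0 e0 K0).
exists D => // a a0; have aal : 0 < a `^ al by rewrite powR_gt0.
have [] := DE (p `^ (- al) * a `^ al) (mulr_gt0 K0 aal).
have -> : V (p `^ (- al) * a `^ al) =
    counting_function (fun x => (p^-1 * gamma x w)^-1) a.
  rewrite /V points_aboveE; apply: eq_eseriesr => x _; congr (_%:R%:E); congr nat_of_bool.
  have -> : (p `^ (- al) * a `^ al) `^ (- al^-1) = p / a.
    rewrite powRM ?powR_ge0// -!powRrM mulrNN mulrN mulfV ?gt_eqF//.
    by rewrite powRr1 ?(ltW p0)// powRN powRr1 ?(ltW a0).
  by rewrite invfM invrK ler_pdivrMr ?gp// ler_pdivrMr// mulrC.
have -> : e / p `^ (- al) * (p `^ (- al) * a `^ al) = e * a `^ al by rewrite mulrA divfK// gt_eqF.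
have -> : (1 + e / p `^ (- al)) * (p `^ (- al) * a `^ al) = (p `^ (- al) + e) * a `^ al.
  by field; rewrite gt_eqF.
by [].
Unshelve. all: by end_near. Qed.

End environment.

(** * The arcsine law *)

Section value.
Context (R : realType).
Local Notation mu := (@lebesgue_measure R).

Lemma gammaE_reflection (al : R) : 0 < al < 1 ->
  fine (gammaE al) * fine (gammaE (1 - al)) = pi / sin (pi * al).
Proof.
move=> al01; have /andP[al0 al1] := al01.
have b0 : 0 < 1 - al by rewrite subr_gt0.
have b01 : 0 < 1 - al < 1 by rewrite b0 ltrBlDr ltrDl.
have ab : al + (1 - al) = 1 by rewrite addrC subrK.
have := gammaE_mul al0 b0 ab.
rewrite (gammaE_fin al01) (gammaE_fin b01) -EFinM half_beta_reflection//.
by case.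
Qed.

(** K cancels, and [gammaE_reflection] evaluates the remaining constant. *)
Lemma gamma_functional_Asl (al K th : R) : 0 < al < 1 -> 0 < K -> 0 < th ->
  K * gamma_functional al (K * fine (gammaE (1 - al)) * fine (gammaE al))^-1
    (jump_test (fun u => (1 + th - u) `^ (- al))) = Asl al (1 / (1 + th)).
Proof.
move=> al01 K0 th0; have /andP[al0 al1] := al01.
set c := _^-1; set kern := fun u : R => _.
have refl := gammaE_reflection al01.
have s0 : 0 < sin (pi * al).
  by apply: sin_gt0_pi; rewrite mulr_gt0 ?pi_gt0//= gtr_pMr ?pi_gt0.
have pi0 := @pi_gt0 R.
have gg : fine (gammaE (1 - al)) * fine (gammaE al) != 0.
  by rewrite mulrC refl mulf_neq0 ?invr_eq0 ?gt_eqF.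
have cE : K * c = sin (pi * al) / pi.
  rewrite /c -mulrA invfM mulrA divff ?gt_eqF// mul1r [X in X^-1]mulrC refl.
  by rewrite invfM invrK mulrC.
have c0 : 0 < c by rewrite -(pmulr_rgt0 _ K0) cE divr_gt0.
have kc (y : R) : y <= 1 -> {for y, continuous kern}.
  move=> y1; have cr : {for y, continuous (fun u => 1 + th - u)}.
    by apply: cvgB; [exact: cvg_cst|exact: cvg_id].
  have r0 : 0 < 1 + th - y by rewrite subr_gt0 (le_lt_trans y1)// ltrDl.
  exact: (continuous_comp cr (@continuous_powR _ (- al) _ r0)).
have := gamma_functional_jump c al01 kc.
set g := gamma_functional _ _ _.
pose I := (\int[mu]_(x in `[0%R, ((1 + th)^-1)%R])
  (x `^ (- (1 - al)) * (1 - x) `^ (- al))%:E)%E.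
have -> : (\int[mu]_(u in `]0%R, 1%R]) (c * (u `^ (al - 1) * kern u))%:E = c%:E * I)%E.
  have th1 : 1 < 1 + th by rewrite ltrDl.
  rewrite /I -incomplete_beta// -ge0_integralZl//.
  - apply/measurable_EFinP; apply: measurable_funTS; apply: measurable_funM.
      exact: measurable_powR.
    apply: (measurableT_comp (f := fun u : R => u `^ (- al))).
      exact: measurable_powR.
    exact: measurable_funB.
  - by move=> u _; rewrite lee_fin mulr_ge0 ?powR_ge0.
  - by rewrite lee_fin ltW.
move=> gE; rewrite /Asl div1r /Rintegral -/I -cE -mulrA; congr (_ * _).
move: gE; have : (0 <= I)%E.
  by apply: integral_ge0 => x _; rewrite lee_fin mulr_ge0 ?powR_ge0.
case: I => [r _ [->]//|_|//].
by rewrite gt0_muley ?lte_fin.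
Qed.

(** f / (1 + f 0) <= f / (1 + f) = 1 / (1 + 1 / f). *)
Lemma summable_of_stieltjes (f : nat -> R) : (forall x, 0 < f x) ->
  nonincreasing_seq f -> (stieltjes_series (fun x => (f x)^-1)%R 1 < +oo)%E ->
  (\sum_(x <oo) (f x)%:E < +oo)%E.
Proof.
move=> f0 mono fin; apply: (@le_lt_trans _ _
  ((1 + f 0%N)%:E * stieltjes_series (fun x => (f x)^-1)%R 1)%E); last first.
  rewrite lte_mul_pinfty// lee_fin addr_ge0// ltW//.
have pos x : 0 < 1 + 1 * (f x)^-1 by rewrite mul1r addr_gt0// invr_gt0.
rewrite /stieltjes_series -nneseriesZl; last first.
  by move=> x _; rewrite lee_fin invr_ge0 ltW.
apply: lee_nneseries => x _; first by rewrite lee_fin ltW.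
rewrite -EFinM lee_fin ler_pdivlMr// mulrDr mulr1 mul1r divff ?gt_eqF//.
by rewrite [leLHS]addrC lerD2l mono.
Qed.

End value.

Theorem mainTheorem6 (R : realType) (p a beta : R)
  (hp : 0 < p) (hpa : p < a) (ha : a < 1)
  (hbeta1 : beta1_cr p a < beta) (hbeta2 : beta < beta2_cr p a)
  (hbeta : beta < 2 * (Num.sqrt (a * p) / (1 - a)) * beta_star)
  (d1 : measure_display) (Omega1 : measurableType d1)
  (P1 : probability Omega1 R) (gamma1 : nat -> {RV P1 >-> R})
  (hgamma1 : random_environment (beta1_cr p a / beta) gamma1)
  (d2 : measure_display) (Omega2 : measurableType d2)
  (P2 : probability Omega2 R) (clocks T : nat -> nat -> {RV P2 >-> R})
  (hdrivers : K_drivers clocks T) :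
  forall theta : R, 0 < theta ->
    {ae P1, forall w,
      no_jump_probability clocks T (fun x => p^-1 * gamma1 x w) z.1 z.2
        @[z --> aging_regime theta]
      --> (Asl (beta1_cr p a / beta) (1 / (1 + theta)))%:E}.
Proof.
move=> theta theta0; set al := beta1_cr p a / beta in hgamma1 *.
have b1 : 0 < beta1_cr p a.
  apply: mulr_gt0; rewrite sqrtr_gt0; last by rewrite divr_gt0// (lt_trans hp).
  by rewrite mulr_gt0// ln_gt0// ltr1n.
have b0 : 0 < beta by exact: lt_trans hbeta1.
have al01 : 0 < al < 1 by rewrite divr_gt0//= ltr_pdivrMr// mul1r.
have /andP[al0 al1] := al01.
apply: filterS (ae_environment al0 hgamma1 hp) => w [g0 mono cnt].
pose f x := p^-1 * gamma1 x w.
have f0 x : 0 < f x by rewrite mulr_gt0// invr_gt0.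
have tau0 x : 0 < (f x)^-1 by rewrite invr_gt0.
have K0 : 0 < p `^ (- al) by rewrite powR_gt0.
have nuK := power_like_laplace tau0 al01 (ltW K0) cnt.
have G0 : 0 < fine (gammaE (1 + al)).
  rewrite fine_gt0// gammaE_gt0 ?addr_gt0//= gammaE_lty// addr_gt0//=.
  by rewrite -[2]/(1 + 1) lerD2l ltW.
have C0 : 0 < p `^ (- al) * fine (gammaE (1 + al)) by rewrite mulr_gt0.
have sf : (\sum_(x <oo) (f x)%:E < +oo)%E.
  apply: summable_of_stieltjes => //.
    by move=> x y xy; rewrite ler_pM2l ?invr_gt0//; exact: mono.
  have [D _ /(_ 1 ltr01)[_ u]] := power_like_stieltjes tau0 al01 (ltW C0) nuK ltr01.
  by apply: le_lt_trans u _; exact: ltry.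
rewrite -(gamma_functional_Asl al01 C0 theta0).
exact: (no_jump_limit hdrivers f0 sf al01 C0 nuK theta0).
Qed.
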